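(* Let $r=8$. There exists $\delta>0$ such that for every $\Omega\in\mathcal S^r_\delta$ the operator $\mathcal T_\Omega:C^r_{\mathrm{sym}}\to\ell^\infty$, $\mathcal T_\Omega\nu=(\ell_{\Omega,0}(\nu),\ell_{\Omega,1}(\nu),\dots,\ell_{\Omega,q}(\nu),\dots)$, is injective (for any choice of the marked symmetric maximal periodic orbits defining $\ell_{\Omega,q}$, $q\ge2$).
   Context: $\mathcal D^r$: strictly convex bounded open planar domains with $C^{r+1}$ boundary oriented counterclockwise; $\mathcal S^r$: those invariant under a reflection. A perimeter-$1$ domain with arc-length parameterization $\gamma$ is $\delta$-close to a circle if $\|\gamma-\gamma_{\mathbb D}\|_{C^{r+1}}\le\delta$ with $\gamma_{\mathbb D}$ the arc-length parameterization of a perimeter-$1$ disk tangent at $s=0$; a domain is $\delta$-close to a circle if its rescaling to perimeter $1$ is; $\mathcal S^r_\delta$ is the set of such domains in $\mathcal S^r$. For $\Omega\in\mathcal S^r$ (scaled to perimeter $1$) let $\gamma:\mathbb T^1\to\partial\Omega$ be the counterclockwise arc-length parameterization with $\gamma(0)$ the marked point (one of the two intersections of a fixed symmetry axis with $\partial\Omega$), so $\gamma(1/2)$ is the other (auxiliary) point and $\gamma(-s)$ is the reflection of $\gamma(s)$. $C^r_{\mathrm{sym}}=\{\nu\in C^r(\mathbb T^1):\nu(s)=\nu(-s)\}$. With $\rho_\Omega$ the radius of curvature: $\ell_{\Omega,0}(\nu)=\int_0^1\nu(s)/\rho_\Omega(s)\,ds$; $\ell_{\Omega,1}(\nu)=\nu(0)$;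 for $q\ge2$, $\ell_{\Omega,q}(\nu)=\sum_{k=0}^{q-1}\nu(s_q^k)\sin\varphi_q^k$ where $\gamma(s_q^k)$ are the collision points of a marked symmetric maximal periodic orbit of rotation number $1/q$ and $\varphi_q^k$ the angles between outgoing chords and the positive tangent. Such an orbit is obtained from a maximizer $\bar{\mathbf s}$ of $L_q$ (with $L(s,s')=\|\gamma(s)-\gamma(s')\|$, $L_q(\mathbf s)=2\sum_{i=0}^{k-1}L(s_i,s_{i+1})$ on $\{0=s_0\le\dots\le s_k=1/2\}$ if $q=2k$, and $L_q(\mathbf s)=\sum_{i=0}^{k-1}2L(s_i,s_{i+1})+L(s_k,-s_k)$ on $\{0=s_0\le\dots\le s_k\le1/2\}$ if $q=2k+1$) by taking the points $\bar s_i$ together with their reflections $-\bar s_i$. *)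

(* Defs.v *)
From Stdlib Require Import Reals Lra Arith.
Open Scope R_scope.

Definition r_reg : nat := 8.

Definition deriv_chain (k : nat) (f : R -> R) (d : nat -> R -> R) : Prop :=
  (forall s, d O s = f s) /\
  (forall i, (i < k)%nat -> forall s, derivable_pt_lim (d i) s (d (S i) s)) /\
  (forall s, continuity_pt (d k) s).

(** A perimeter-1 boundary curve gamma = (x,y), 1-periodic, given with its
    derivatives dx, dy (of order <= r+1).  Conditions: C^{r+1}, arc-length
    (unit speed), and strictly convex, counterclockwise: the curve lies strictly
    to the left of every tangent line except at the point of tangency. *)
Definition cross (a1 a2 b1 b2 : R) : R := a1 * b2 - a2 * b1.

Definition boundary_curve (x y : R -> R) (dx dy : nat -> R -> R) : Prop :=
  deriv_chain (S r_reg) x dx /\ deriv_chain (S r_reg) y dy /\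
  (forall s, x (s + 1) = x s /\ y (s + 1) = y s) /\
  (forall s, dx 1%nat s ^ 2 + dy 1%nat s ^ 2 = 1) /\
  (forall s t, (forall n : Z, t - s <> IZR n) ->
     cross (dx 1%nat s) (dy 1%nat s) (x t - x s) (y t - y s) > 0).

Definition curvature (dx dy : nat -> R -> R) (s : R) : R :=
  dx 1%nat s * dy 2%nat s - dy 1%nat s * dx 2%nat s.

(** Reflection symmetry with marked point gamma(0): there is a line (through
    (px,py) with unit direction (ux,uy)) whose reflection maps gamma(s) to
    gamma(-s). *)
Definition symmetric_marked (x y : R -> R) : Prop :=
  exists px py ux uy : R, ux ^ 2 + uy ^ 2 = 1 /\
    forall s, let a := x s - px in let b := y s - py in
      let c := a * ux + b * uy in
      x (- s) = px + 2 * c * ux - a /\ y (- s) = py + 2 * c * uy - b.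

(** Arc-length parameterization of the perimeter-1 disk tangent to gamma at
    s = 0 (same point, same unit tangent (t1,t2), on the same side). *)
Definition disk_x (x0 t1 t2 s : R) : R :=
  x0 + (sin (2 * PI * s) * t1 - (1 - cos (2 * PI * s)) * t2) / (2 * PI).
Definition disk_y (y0 t1 t2 s : R) : R :=
  y0 + (sin (2 * PI * s) * t2 + (1 - cos (2 * PI * s)) * t1) / (2 * PI).

Definition close_to_circle (delta : R) (x y : R -> R) (dx dy : nat -> R -> R)
  : Prop :=
  exists ex ey : nat -> R -> R,
    deriv_chain (S r_reg)
      (fun s => x s - disk_x (x 0) (dx 1%nat 0) (dy 1%nat 0) s) ex /\
    deriv_chain (S r_reg)
      (fun s => y s - disk_y (y 0) (dx 1%nat 0) (dy 1%nat 0) s) ey /\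
    forall i s, (i <= S r_reg)%nat -> sqrt (ex i s ^ 2 + ey i s ^ 2) <= delta.

Definition C_sym (nu : R -> R) : Prop :=
  (exists d, deriv_chain r_reg nu d) /\
  (forall s, nu (s + 1) = nu s) /\ (forall s, nu (- s) = nu s).

Definition is_RInt (f : R -> R) (a b I : R) : Prop :=
  exists pr : Riemann_integrable f a b, RiemannInt pr = I.

Definition chord (x y : R -> R) (a b : R) : R :=
  sqrt ((x b - x a) ^ 2 + (y b - y a) ^ 2).

Fixpoint sumR (n : nat) (f : nat -> R) : R :=
  match n with O => 0 | S m => sumR m f + f m end.

Definition half (q : nat) : nat := Nat.div2 q.

Definition admissible (q : nat) (s : nat -> R) : Prop :=
  s O = 0 /\ (forall i, (i < half q)%nat -> s i <= s (S i)) /\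
  (if Nat.even q then s (half q) = 1 / 2 else s (half q) <= 1 / 2).

Definition Lq (x y : R -> R) (q : nat) (s : nat -> R) : R :=
  2 * sumR (half q) (fun i => chord x y (s i) (s (S i))) +
  (if Nat.even q then 0 else chord x y (s (half q)) (- s (half q))).

Definition maximizer (x y : R -> R) (q : nat) (s : nat -> R) : Prop :=
  admissible q s /\ forall s', admissible q s' -> Lq x y q s' <= Lq x y q s.

(** Collision parameters s_q^j, j = 0..q-1, in counterclockwise order:
    s_0,...,s_k, then the reflections -s_{q-j}. *)
Definition collision (q : nat) (s : nat -> R) (j : nat) : R :=
  if (j <=? half q)%nat then s j else - s (q - j)%nat.

Definition sin_angle (x y : R -> R) (dx dy : nat -> R -> R) (a b : R) : R :=
  Rabs (cross (dx 1%nat a) (dy 1%nat a) (x b - x a) (y b - y a)) / chord x y a b.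

Definition ell_q (x y : R -> R) (dx dy : nat -> R -> R) (q : nat)
  (s : nat -> R) (nu : R -> R) : R :=
  sumR q (fun j => nu (collision q s j) *
    sin_angle x y dx dy (collision q s j) (collision q s ((j + 1) mod q))).

(* Main.v *)
(** Put [nu = nu1 - nu2], let [kappa] be the curvature and use the Lazutkin coordinate [X], [X' = K kappa^(2/3)].
    With this choice the reflection law makes consecutive steps of an orbit differ, in the [X] coordinate, by
    [O(delta * step^4)] only, so the [q] collision points of a maximal orbit of rotation number [1/q] satisfy
    [X s_(j+1) - X s_j = 1/q + O(delta/q^3)], and [sin phi_j] is [c(s_j) sin(PI/q) / PI] up to [O(delta/q^3)],
    where [c = kappa / (2 X')].

    Hence [u = (nu c) o X^-1] is even, has mean zero, vanishes at 0 and has an almost vanishing average over almost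
    equidistributed nodes.  Let [a_l] be its cosine coefficients and [A = sup l^2 |a_l|].  On exactly equidistributed
    nodes the average is [sum_(m >= 1) a_(m q)].  The nodes are displaced by [theta_j = O(delta/q^2)] with increments
    [O(delta/q^3)]; by summation by parts, mode [l] at distance [r] from the multiples of [q] feels this as
    [O(delta l q^-2 / r)], and as [O(sqrt(delta l) / q)] in any case, so that the total error is
    [O(sqrt(delta) A / q^2)].  Therefore [q^2 |a_q| <= (sum_(m >= 2) m^-2 + O(sqrt delta)) A] for all [q >= 1]; since
    [sum_(m >= 2) m^-2 <= 3/4], this forces [A = 0]. *)

From Coquelicot Require Import Coquelicot.
Require Import Defs.
From Stdlib Require Import Reals Lra Lia Arith ZArith.
Open Scope R_scope.

(** * Finite sums *)

(** The gain from summation by parts is indispensable. The displacement alone bounds mode [l] by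
    [delta l / q^2]; against the weight [l^-2] the modes below [q^2] then add up to
    [delta log q / q^2], and no [delta] uniform in [q] absorbs the logarithm. The factor [1 / r]
    removes it, and above [q^2] the square-root bound sums to the size [q^-2]. The three kinds of
    data enter separately: [u dX = nu kappa ds / 2] turns [ell_0] into mean zero, [nu 0 = 0] is the
    average over the single node 0 and supplies the case [q = 1], and the orbits supply [q >= 2].
    The exponent 2/3 removes the quadratic term in the comparison of angle and Lazutkin step. The
    cubic term has size [delta], as the disk has none, and its contributions from the two sides of a
    collision point cancel up to fourth order. All constants must hold at once for every [q >= 2],
    every base point and every domain, because [delta] is fixed first. Hence the geometry is
    developed for families of functions indexed by domain and base point, with errors linear in the
    distance to the disk. *)

Lemma sumR_ext n f g : (forall i, (i < n)%nat -> f i = g i) -> sumR n f = sumR n g.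
Proof.
  induction n as [|n IH]; intros H; simpl; [reflexivity|].
  rewrite IH; [rewrite H; auto|]. intros; apply H; lia.
Qed.

Lemma sumR_le n f g : (forall i, (i < n)%nat -> f i <= g i) -> sumR n f <= sumR n g.
Proof.
  induction n as [|n IH]; intros H; simpl; [lra|].
  apply Rplus_le_compat; [apply IH; intros; apply H; lia|apply H; lia].
Qed.

Lemma sumR_plus n f g : sumR n (fun i => f i + g i) = sumR n f + sumR n g.
Proof. induction n; simpl; [ring|rewrite IHn; ring]. Qed.

Lemma sumR_minus n f g : sumR n (fun i => f i - g i) = sumR n f - sumR n g.
Proof. induction n; simpl; [ring|rewrite IHn; ring]. Qed.

Lemma sumR_scal n c f : sumR n (fun i => c * f i) = c * sumR n f.
Proof. induction n; simpl; [ring|rewrite IHn; ring]. Qed.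

Lemma sumR_const n c : sumR n (fun _ => c) = INR n * c.
Proof. induction n as [|n IH]; [simpl; ring|]. rewrite S_INR; simpl; rewrite IH; ring. Qed.

Lemma sumR_0 n f : (forall i, (i < n)%nat -> f i = 0) -> sumR n f = 0.
Proof.
  intros H; rewrite (sumR_ext n f (fun _ => 0)) by auto. rewrite sumR_const; ring.
Qed.

Lemma sumR_abs n f : Rabs (sumR n f) <= sumR n (fun i => Rabs (f i)).
Proof.
  induction n; simpl; [rewrite Rabs_R0; lra|].
  eapply Rle_trans; [apply Rabs_triang|lra].
Qed.

Lemma sumR_nonneg n f : (forall i, (i < n)%nat -> 0 <= f i) -> 0 <= sumR n f.
Proof.
  intros H; rewrite <- (sumR_0 n (fun _ => 0)) by auto. now apply sumR_le.
Qed.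

Lemma sumR_add n m f : sumR (n + m) f = sumR n f + sumR m (fun i => f (n + i)%nat).
Proof.
  induction m; simpl; [rewrite Nat.add_0_r; ring|].
  rewrite Nat.add_succ_r; simpl; rewrite IHm; ring.
Qed.

Lemma sumR_mul n m f :
  sumR (n * m) f = sumR n (fun i => sumR m (fun j => f (i * m + j)%nat)).
Proof.
  induction n as [|n IH]; [reflexivity|].
  change (S n * m)%nat with (m + n * m)%nat.
  rewrite Nat.add_comm, sumR_add, IH; reflexivity.
Qed.

Lemma sumR_swap n m f :
  sumR n (fun i => sumR m (fun j => f i j)) = sumR m (fun j => sumR n (fun i => f i j)).
Proof.
  induction n; simpl; [symmetry; now apply sumR_0|].
  now rewrite IHn, sumR_plus.
Qed.

Lemma sumR_telescope n f : sumR n (fun i => f (S i) - f i) = f n - f O.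
Proof. induction n; simpl; [ring|rewrite IHn; ring]. Qed.

Lemma sumR_rev n f : sumR n f = sumR n (fun i => f (n - 1 - i)%nat).
Proof.
  induction n as [|n IH]; [reflexivity|].
  transitivity (f n + sumR n f); [simpl; ring|]. rewrite IH.
  change (sumR (S n)) with (sumR (1 + n)). rewrite sumR_add. cbn [sumR].
  replace (S n - 1 - 0)%nat with n by lia. rewrite Rplus_0_l. f_equal.
  apply sumR_ext; intros; f_equal; lia.
Qed.

Lemma sumR_mono n m f :
  (n <= m)%nat -> (forall i, 0 <= f i) -> sumR n f <= sumR m f.
Proof.
  intros H Hf; replace m with (n + (m - n))%nat by lia; rewrite sumR_add.
  assert (0 <= sumR (m - n) (fun i => f (n + i)%nat)) by (apply sumR_nonneg; auto). lra.
Qed.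

Lemma sumR_le_scal n c f g :
  (forall i, (i < n)%nat -> f i <= c * g i) -> sumR n f <= c * sumR n g.
Proof. intros H; rewrite <- sumR_scal; now apply sumR_le. Qed.

Lemma sumR_abel n U g :
  sumR n (fun j => (U (S j) - U j) * g j) =
  U n * g n - U O * g O - sumR n (fun j => U (S j) * (g (S j) - g j)).
Proof. induction n; simpl; [ring|rewrite IHn; ring]. Qed.

(** * Trigonometric inequalities and summation by parts *)

(** The bound vanishes linearly at both ends and is symmetric under [t -> 1 - t]; it serves wherever
    a sine must be kept away from 0, from resonance denominators to the Dirichlet kernel. *)
Lemma sin_PI_lower t : 0 <= t <= 1 -> t * (1 - t) <= sin (PI * t).
Proof.
  assert (HP := PI_4). assert (HP2 := PI2_3_2).
  assert (L : forall z, 0 <= z <= 1/2 -> z * (1 - z) <= sin (PI * z)).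
  { intros z Hz. apply Rle_trans with z; [nra|].
    pose proof (SIN (PI * z)) as S1.
    destruct S1 as [S1 _]; [nra|nra|].
    unfold sin_lb, sin_approx, sum_f_R0, sin_term in S1; simpl in S1.
    set (x := PI * z) in *.
    assert (Hx : 0 <= x <= 2) by (unfold x; nra).
    assert (3 * z <= x) by (unfold x; nra).
    assert (x - x*x*x/6 <= sin x).
    { eapply Rle_trans; [|apply S1].
      assert (0 <= x*x*x) by (apply Rmult_le_pos; [nra|lra]).
      assert (0 <= x*x*x*x*x*(42 - x*x)).
      { apply Rmult_le_pos; [|nra]. apply Rmult_le_pos; [|lra]. apply Rmult_le_pos; [auto|lra]. }
      field_simplify. field_simplify in H1. nra. }
    nra. }
  intros Ht. destruct (Rle_dec t (1/2)); [apply L; lra|].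
  replace (PI * t) with (PI - PI * (1 - t)) by ring.
  rewrite sin_PI_x. specialize (L (1 - t)). nra.
Qed.

Lemma Rabs_cos_diff a b : Rabs (cos a - cos b) <= Rabs (a - b).
Proof.
  destruct (MVT_gen cos b a (fun x => - sin x)) as [c [_ Hc]].
  - intros; auto_derive; auto; ring.
  - intros; apply continuity_pt_filterlim; apply continuous_cos.
  - rewrite Hc, Rabs_mult, Rabs_Ropp.
    assert (Rabs (sin c) <= 1) by (apply Rabs_le; apply SIN_bound).
    pose proof (Rabs_pos (a - b)). nra.
Qed.

Lemma Rabs_sin_diff a b : Rabs (sin a - sin b) <= Rabs (a - b).
Proof.
  rewrite <- 2!cos_shift.
  eapply Rle_trans; [apply Rabs_cos_diff|].
  replace (PI/2 - a - (PI/2 - b)) with (- (a - b)) by ring. rewrite Rabs_Ropp; lra.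
Qed.

(** A cosine along an arithmetic progression is the increment of [U], a sine divided by
    [2 sin (alpha / 2)]. Abel summation moves the increments to [g], and the boundary terms cancel
    because [q] steps of [alpha] make whole turns and [g] closes up. *)
Lemma char_sum_bound (q : nat) (alpha M : R) (phi : R) (g : nat -> R) :
  sin (alpha / 2) <> 0 -> (exists z : Z, alpha * INR q = 2 * PI * IZR z) ->
  g q = g O -> (forall j, (j < q)%nat -> Rabs (g (S j) - g j) <= M) ->
  Rabs (sumR q (fun j => cos (alpha * INR j + phi) * g j)) <=
    INR q * M / (2 * Rabs (sin (alpha / 2))).
Proof.
  intros Hs [z Hz] Hg HM.
  set (s := sin (alpha / 2)) in *.
  assert (Hsp : 0 < Rabs s) by now apply Rabs_pos_lt.
  set (U := fun j : nat => sin (alpha * INR j - alpha / 2 + phi) / (2 * s)).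
  rewrite (sumR_ext q _ (fun j => (U (S j) - U j) * g j)).
  2:{ intros j _. f_equal. unfold U. rewrite S_INR.
      replace (alpha * (INR j + 1) - alpha / 2 + phi) with ((alpha * INR j + phi) + alpha / 2) by field.
      replace (alpha * INR j - alpha / 2 + phi) with ((alpha * INR j + phi) - alpha / 2) by field.
      rewrite sin_plus, sin_minus. fold s. field. exact Hs. }
  rewrite sumR_abel.
  assert (HU : U q = U O).
  { unfold U. rewrite Hz. f_equal. simpl INR.
    replace (2 * PI * IZR z - alpha / 2 + phi) with ((alpha * 0 - alpha / 2 + phi) + 2 * IZR z * PI) by ring.
    destruct (Z_le_dec 0 z).
    - rewrite <- (Z2Nat.id z) by auto. rewrite <- INR_IZR_INZ. apply sin_period.
    - rewrite <- (sin_period (_ + 2 * IZR z * PI) (Z.to_nat (- z))).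
      rewrite INR_IZR_INZ, Z2Nat.id by lia. rewrite opp_IZR. f_equal; ring. }
  rewrite HU, Hg.
  replace (U O * g O - U O * g O - _) with (- sumR q (fun j => U (S j) * (g (S j) - g j))) by ring.
  rewrite Rabs_Ropp. eapply Rle_trans; [apply sumR_abs|].
  eapply Rle_trans; [apply sumR_le with (g := fun _ => M / (2 * Rabs s))|].
  - intros j Hj. rewrite Rabs_mult. unfold U, Rdiv at 1. rewrite Rabs_mult, Rabs_inv, Rabs_mult.
    rewrite (Rabs_right 2) by lra.
    assert (B1 : Rabs (sin (alpha * INR (S j) - alpha / 2 + phi)) <= 1) by (apply Rabs_le; apply SIN_bound).
    specialize (HM j Hj).
    assert (0 < / (2 * Rabs s)) by (apply Rinv_0_lt_compat; lra).
    pose proof (Rabs_pos (sin (alpha * INR (S j) - alpha / 2 + phi))).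
    pose proof (Rabs_pos (g (S j) - g j)).
    unfold Rdiv. rewrite (Rmult_comm M).
    apply Rmult_le_compat; auto. 1: apply Rmult_le_pos; lra.
    rewrite <- (Rmult_1_l (/ (2 * Rabs s))) at 2. apply Rmult_le_compat_r; lra.
  - rewrite sumR_const. right; field; lra.
Qed.

(** * Aliasing of almost equidistributed nodes *)

(** A square root stands in for the logarithm: two such sums multiply to [Q], which the factor
    [/ Q ^ 3] of a block turns into the required [/ Q ^ 2]. *)
Lemma harmonic_le_sqrt n : sumR n (fun i => / INR (S i)) <= 2 * sqrt (INR n).
Proof.
  induction n as [|n IH]; [simpl; rewrite sqrt_0; lra|].
  cbn [sumR]. rewrite S_INR. pose proof (pos_INR n).
  set (a := sqrt (INR n)) in *. set (b := sqrt (INR n + 1)).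
  assert (Ha : 0 <= a) by apply sqrt_pos.
  assert (Hb : 1 <= b) by (unfold b; rewrite <- sqrt_1 at 1; apply sqrt_le_1_alt; lra).
  assert (Ea : a * a = INR n) by (apply sqrt_sqrt; lra).
  assert (Eb : b * b = INR n + 1) by (apply sqrt_sqrt; lra).
  assert (a <= b) by (unfold a, b; apply sqrt_le_1_alt; lra).
  rewrite <- Eb.
  assert (/ (b * b) <= 2 * (b - a)).
  { apply (Rmult_le_reg_r (b * b)); [nra|]. rewrite Rinv_l by nra.
    assert ((b - a) * (b + a) = 1) by lra. nra. }
  lra.
Qed.

Lemma inv_square_sum_le n : sumR n (fun i => / INR (S i) ^ 2) <= 2.
Proof.
  destruct n as [|n]; [simpl; lra|].
  assert (H : sumR (S n) (fun i => / INR (S i) ^ 2) <= 2 - / INR (S n)); [|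
    assert (0 < / INR (S n)) by (apply Rinv_0_lt_compat, lt_0_INR; lia); lra].
  induction n as [|n IH]; [simpl; lra|].
  change (sumR (S (S n)) (fun i => / INR (S i) ^ 2))
    with (sumR (S n) (fun i => / INR (S i) ^ 2) + / INR (S (S n)) ^ 2).
  rewrite (S_INR (S n)).
  assert (1 <= INR (S n)) by (rewrite S_INR; pose proof (pos_INR n); lra).
  set (a := INR (S n)) in *.
  assert (/ (a+1) ^ 2 <= / a - / (a + 1)).
  { replace (/ a - / (a+1)) with (/ (a * (a+1))) by (field; lra).
    apply Rinv_le_contravar; nra. }
  lra.
Qed.

Lemma Rabs_sin_shift m y : Rabs (sin (INR m * PI + y)) = Rabs (sin y).
Proof.
  induction m as [|m IH]; [simpl; f_equal; f_equal; ring|].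
  rewrite S_INR. replace ((INR m + 1) * PI + y) with (INR m * PI + y + PI) by ring.
  now rewrite neg_sin, Rabs_Ropp.
Qed.

Section AlmostEquidistributed.
Variables (q : nat) (eps : R) (x : nat -> R).
Hypothesis Hq : (1 <= q)%nat.
Hypothesis Heps : 0 <= eps <= 1.
Hypothesis Hx0 : x O = 0.
Hypothesis Hxq : x q = 1.
Hypothesis Hstep : forall j, (j < q)%nat -> Rabs (x (S j) - x j - / INR q) <= eps / INR q ^ 3.

Let Q := INR q.
Let HQ : 1 <= Q.
Proof. unfold Q; change 1 with (INR 1); now apply le_INR. Qed.

Lemma node_deviation j : (j <= q)%nat -> Rabs (x j - INR j / Q) <= eps / Q ^ 2.
Proof.
  intros Hj.
  assert (L : forall i, (i <= q)%nat -> Rabs (x i - INR i / Q) <= INR i * (eps / Q ^ 3)).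
  { induction i as [|i IH]; intros Hi.
    - simpl. rewrite Hx0. unfold Rdiv; rewrite Rmult_0_l, Rminus_0_r, Rabs_R0; lra.
    - rewrite S_INR.
      replace (x (S i) - (INR i + 1) / Q) with ((x i - INR i / Q) + (x (S i) - x i - / Q)) by (field; lra).
      eapply Rle_trans; [apply Rabs_triang|].
      specialize (IH ltac:(lia)). specialize (Hstep i ltac:(lia)). fold Q in Hstep. lra. }
  eapply Rle_trans; [apply L; auto|].
  assert (INR j <= Q) by (now apply le_INR).
  replace (eps / Q ^ 2) with (Q * (eps / Q ^ 3)) by (field; lra).
  apply Rmult_le_compat_r; auto. apply Rdiv_le_0_compat; [lra|apply pow_lt; lra].
Qed.

(** The average of mode [l] over the actual nodes minus its average over exactly equidistributed
    ones, the latter being 1 or 0 according as [q] divides [l]. *)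
Definition alias_defect (l : nat) : R :=
  sumR q (fun j => cos (2 * PI * INR l * x j) - cos (2 * PI * INR l / Q * INR j)) / Q.

Lemma alias_defect_small l : Rabs (alias_defect l) <= 2 * PI * eps * INR l / Q ^ 2.
Proof.
  unfold alias_defect, Rdiv at 1. rewrite Rabs_mult, (Rabs_right (/ Q)) by (left; apply Rinv_0_lt_compat; lra).
  apply (Rmult_le_reg_r Q); [lra|]. rewrite Rmult_assoc, Rinv_l, Rmult_1_r by lra.
  eapply Rle_trans; [apply sumR_abs|].
  eapply Rle_trans; [apply sumR_le with (g := fun _ => 2 * PI * eps * INR l / Q ^ 2)|].
  - intros j Hj. eapply Rle_trans; [apply Rabs_cos_diff|].
    replace (2 * PI * INR l * x j - 2 * PI * INR l / Q * INR j)
      with (2 * PI * INR l * (x j - INR j / Q)) by (field; lra).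
    assert (HP := PI_RGT_0). pose proof (pos_INR l).
    assert (0 <= 2 * PI * INR l) by nra.
    rewrite Rabs_mult, (Rabs_right (2 * PI * INR l)) by lra.
    replace (2 * PI * eps * INR l / Q ^ 2) with ((2 * PI * INR l) * (eps / Q ^ 2)) by (field; lra).
    apply Rmult_le_compat_l; auto. apply node_deviation; lia.
  - rewrite sumR_const. fold Q. lra.
Qed.

Lemma alias_defect_le_2 l : Rabs (alias_defect l) <= 2.
Proof.
  unfold alias_defect, Rdiv at 1. rewrite Rabs_mult, (Rabs_right (/ Q)) by (left; apply Rinv_0_lt_compat; lra).
  apply (Rmult_le_reg_r Q); [lra|]. rewrite Rmult_assoc, Rinv_l, Rmult_1_r by lra.
  eapply Rle_trans; [apply sumR_abs|].
  eapply Rle_trans; [apply sumR_le with (g := fun _ => 2)|].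
  - intros j Hj. apply Rabs_le.
    pose proof (COS_bound (2 * PI * INR l * x j)).
    pose proof (COS_bound (2 * PI * INR l / Q * INR j)). lra.
  - rewrite sumR_const. fold Q. lra.
Qed.

(** With the phase of a node written as [alpha j + beta j], the addition formula leaves two
    character sums, weighted by [cos beta - 1] and [sin beta], whose increments are at most those of
    [beta]. Since [alpha / 2] is [PI r / q] up to a multiple of [PI], the denominator measures the
    distance of the frequency to the multiples of [q]. *)
Lemma alias_defect_nonresonant m r :
  (1 <= r)%nat -> (r < q)%nat ->
  Rabs (alias_defect (m * q + r)) <=
    2 * PI * eps * INR (m * q + r) / Q ^ 2 * (/ INR r + / (Q - INR r)).
Proof.
  intros Hr1 Hr2. set (l := (m * q + r)%nat).
  assert (HP := PI_RGT_0).
  assert (Hl : INR l = INR m * Q + INR r) by (unfold l, Q; rewrite plus_INR, mult_INR; ring).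
  assert (R1 : 1 <= INR r) by (change 1 with (INR 1); now apply le_INR).
  assert (R2 : INR r < Q) by (now apply lt_INR).
  pose proof (pos_INR l) as Hl0.
  set (alpha := 2 * PI * INR l / Q).
  assert (Hsin : INR r * (Q - INR r) / Q ^ 2 <= Rabs (sin (alpha / 2))).
  { replace (alpha / 2) with (INR m * PI + PI * (INR r / Q)) by (unfold alpha; rewrite Hl; field; lra).
    rewrite Rabs_sin_shift.
    replace (INR r * (Q - INR r) / Q ^ 2) with (INR r / Q * (1 - INR r / Q)) by (field; lra).
    eapply Rle_trans; [apply sin_PI_lower|apply Rle_abs].
    split; [apply Rdiv_le_0_compat; lra|].
    apply (Rmult_le_reg_r Q); [lra|]. unfold Rdiv; rewrite Rmult_assoc, Rinv_l; lra. }
  assert (Hpos : 0 < INR r * (Q - INR r) / Q ^ 2).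
  { apply Rdiv_lt_0_compat; [nra|apply pow_lt; lra]. }
  assert (Hs0 : sin (alpha / 2) <> 0).
  { intros E; rewrite E, Rabs_R0 in Hsin; lra. }
  set (beta := fun j => 2 * PI * INR l * (x j - INR j / Q)).
  set (M := 2 * PI * INR l * (eps / Q ^ 3)).
  assert (Hb : forall j, (j < q)%nat -> Rabs (beta (S j) - beta j) <= M).
  { intros j Hj. unfold beta, M.
    replace (2 * PI * INR l * (x (S j) - INR (S j) / Q) - 2 * PI * INR l * (x j - INR j / Q))
      with (2 * PI * INR l * (x (S j) - x j - / Q)) by (rewrite S_INR; field; lra).
    assert (0 <= 2 * PI * INR l) by nra.
    rewrite Rabs_mult, (Rabs_right (2 * PI * INR l)) by lra.
    apply Rmult_le_compat_l; auto. }
  assert (Hper : exists z : Z, alpha * INR q = 2 * PI * IZR z).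
  { exists (Z.of_nat l). rewrite <- INR_IZR_INZ. unfold alpha. fold Q. field; lra. }
  assert (Hbq : beta q = beta O).
  { unfold beta. rewrite Hx0, Hxq. fold Q. simpl INR. field; lra. }
  assert (B1 := char_sum_bound q alpha M 0 (fun j => cos (beta j) - 1) Hs0 Hper).
  assert (B2 := char_sum_bound q alpha M (PI/2) (fun j => sin (beta j)) Hs0 Hper).
  unfold alias_defect. fold alpha.
  rewrite (sumR_ext q _ (fun j => cos (alpha * INR j + 0) * (cos (beta j) - 1)
                                 + cos (alpha * INR j + PI / 2) * sin (beta j))).
  2:{ intros j _. replace (2 * PI * INR l * x j) with (alpha * INR j + beta j)
        by (unfold alpha, beta; field; lra).
      rewrite cos_plus, Rplus_0_r, (cos_plus (alpha * INR j) (PI/2)), cos_PI2, sin_PI2. ring. }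
  rewrite sumR_plus. unfold Rdiv at 1.
  rewrite Rabs_mult, (Rabs_right (/ Q)) by (left; apply Rinv_0_lt_compat; lra).
  apply (Rmult_le_reg_r Q); [lra|]. rewrite Rmult_assoc, Rinv_l, Rmult_1_r by lra.
  eapply Rle_trans; [apply Rabs_triang|].
  eapply Rle_trans; [apply Rplus_le_compat; [apply B1|apply B2]|].
  - now rewrite Hbq.
  - intros j Hj. eapply Rle_trans; [|exact (Hb j Hj)].
    replace (cos (beta (S j)) - 1 - (cos (beta j) - 1)) with (cos (beta (S j)) - cos (beta j)) by ring.
    apply Rabs_cos_diff.
  - now rewrite Hbq.
  - intros j Hj. eapply Rle_trans; [|exact (Hb j Hj)]. apply Rabs_sin_diff.
  - fold Q. replace (Q * M / (2 * Rabs (sin (alpha / 2))) + Q * M / (2 * Rabs (sin (alpha / 2))))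
      with (Q * M * / Rabs (sin (alpha / 2))) by (field; lra).
    apply Rle_trans with (Q * M * / (INR r * (Q - INR r) / Q ^ 2)).
    + apply Rmult_le_compat_l; [|now apply Rinv_le_contravar].
      unfold M. apply Rmult_le_pos; [lra|]. apply Rmult_le_pos; [nra|].
      apply Rdiv_le_0_compat; [lra|apply pow_lt; lra].
    + right. unfold M. field. lra.
Qed.

Let G (l : nat) : R := Rabs (alias_defect l) / INR l ^ 2.

Let HE : 0 <= 2 * PI * eps <= 8 * eps.
Proof. assert (HP := PI_4). assert (HP' := PI_RGT_0). split; nra. Qed.

Let G_pos l : 0 <= G l.
Proof.
  (* At [l = 0] the defect itself vanishes, so the division by zero is harmless. *)
  unfold G. destruct l; [simpl; unfold Rdiv|].
  - replace (alias_defect 0) with 0; [rewrite Rabs_R0; lra|].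
    unfold alias_defect. rewrite sumR_0; [field; lra|].
    intros i _. simpl. unfold Rdiv. rewrite !Rmult_0_r, !Rmult_0_l, Rminus_diag; reflexivity.
  - apply Rdiv_le_0_compat; [apply Rabs_pos|apply pow_lt, lt_0_INR; lia].
Qed.

Let harm_rev n : (S n = q)%nat ->
  sumR n (fun i => / INR (S i) + / (Q - INR (S i))) = 2 * sumR n (fun i => / INR (S i)).
Proof.
  intros Hn. rewrite sumR_plus, (sumR_rev n (fun i => / (Q - INR (S i)))).
  rewrite (sumR_ext n (fun i => / (Q - INR (S (n - 1 - i)))) (fun i => / INR (S i))); [ring|].
  intros i Hi. f_equal. unfold Q. rewrite <- minus_INR by lia. f_equal. lia.
Qed.

(** Below [q] the growth [l] of the defect cancels against the distance [l] to the resonance 0,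
    which leaves the summable [/ l ^ 2]; the resonance at [q] contributes at most [/ INR n] for each
    mode. *)
Lemma alias_block_0 : sumR q G <= 24 * eps / Q ^ 2.
Proof.
  assert (En : exists n, q = S n) by (exists (q - 1)%nat; lia). destruct En as [n Eq].
  assert (Hs : sumR q G = sumR (1 + n) G) by (f_equal; exact Eq).
  rewrite Hs, sumR_add. cbn [sumR Nat.add].
  assert (HQn : Q = INR n + 1) by (unfold Q; rewrite Eq, S_INR; reflexivity).
  assert (G0 : G 0 = 0).
  { unfold G. replace (alias_defect 0) with 0; [rewrite Rabs_R0; unfold Rdiv; ring|].
    unfold alias_defect. rewrite sumR_0; [field; lra|].
    intros i _. simpl. unfold Rdiv. rewrite !Rmult_0_r, !Rmult_0_l, Rminus_diag; reflexivity. }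
  rewrite G0.
  assert (Hc : 0 <= 2 * PI * eps / Q ^ 2) by (apply Rdiv_le_0_compat; [lra|apply pow_lt; lra]).
  assert (B : sumR n (fun i => G (S i)) <= 2 * PI * eps / Q ^ 2 * sumR n (fun i => / INR (S i) ^ 2 + / INR n)).
  { apply sumR_le_scal. intros i Hi. unfold G.
    pose proof (alias_defect_nonresonant 0 (S i) ltac:(lia) ltac:(lia)) as D.
    cbn [Nat.mul Nat.add] in D.
    assert (R1 : 1 <= INR (S i)) by (rewrite S_INR; pose proof (pos_INR i); lra).
    assert (R2 : INR (S i) <= INR n) by (apply le_INR; lia).
    set (l := INR (S i)) in *.
    apply (Rmult_le_reg_r (l ^ 2)); [apply pow_lt; lra|].
    unfold Rdiv at 1. rewrite Rmult_assoc, Rinv_l by (apply pow_nonzero; lra). rewrite Rmult_1_r.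
    eapply Rle_trans; [apply D|].
    replace (2 * PI * eps * l / Q ^ 2 * (/ l + / (Q - l)))
      with (2 * PI * eps / Q ^ 2 * (1 + l * / (Q - l))) by (field; lra).
    apply Rle_trans with (2 * PI * eps / Q ^ 2 * ((/ l ^ 2 + / INR n) * l ^ 2)); [|right; ring].
    apply Rmult_le_compat_l; auto.
    rewrite Rmult_plus_distr_r, Rinv_l by (apply pow_nonzero; lra).
    apply Rplus_le_compat_l.
    apply (Rmult_le_reg_r ((Q - l) * INR n)); [apply Rmult_lt_0_compat; lra|].
    replace (l * / (Q - l) * ((Q - l) * INR n)) with (l * INR n) by (field; lra).
    replace (/ INR n * l ^ 2 * ((Q - l) * INR n)) with (l * (l * (Q - l))) by (field; lra).
    (* By concavity [l * (Q - l)] is least at the ends of [1 <= l <= INR n], where it equals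
       [INR n]. *)
    apply Rmult_le_compat_l; [lra|]. rewrite HQn. nra. }
  rewrite sumR_plus, sumR_const in B.
  assert (INR n * / INR n <= 1).
  { destruct n; [simpl; lra|]. rewrite Rinv_r; [lra|]. apply not_0_INR; lia. }
  pose proof (inv_square_sum_le n).
  assert (sumR n (fun i => / INR (S i) ^ 2) + INR n * / INR n <= 3) by lra.
  apply (Rmult_le_compat_l _ _ _ Hc) in H1.
  assert (2 * PI * eps / Q ^ 2 * 3 <= 24 * eps / Q ^ 2).
  { unfold Rdiv. assert (0 < / Q ^ 2) by (apply Rinv_0_lt_compat, pow_lt; lra). nra. }
  lra.
Qed.

(** The resonant mode of the block has no gain and takes the crude bound; the others carry [/ r] and
    [/ (Q - r)]. As [l >= S m * Q] throughout, one remaining factor [/ l] gives [/ (Q * S m)], and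
    only harmonic sums over [r] are left. *)
Lemma alias_block m :
  sumR q (fun r => G (S m * q + r)%nat) <= 40 * eps / Q ^ 3 * sqrt Q * / INR (S m).
Proof.
  assert (En : exists n, q = S n) by (exists (q - 1)%nat; lia). destruct En as [n Eq].
  assert (Hs : forall F, sumR q F = sumR (1 + n) F) by (intros F; f_equal; exact Eq).
  rewrite Hs, sumR_add. cbn [sumR]. rewrite Rplus_0_l.
  assert (HQn : Q = INR n + 1) by (unfold Q; rewrite Eq, S_INR; reflexivity).
  assert (HM : 1 <= INR (S m)) by (rewrite S_INR; pose proof (pos_INR m); lra).
  set (mm := INR (S m)) in *.
  set (c := 2 * PI * eps / Q ^ 3 * / mm).
  assert (Hc : 0 <= c).
  { apply Rmult_le_pos; [apply Rdiv_le_0_compat; [lra|apply pow_lt; lra]|].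
    left; apply Rinv_0_lt_compat; lra. }
  assert (Hl : forall r, mm * Q <= INR (S m * q + r)).
  { intros r. rewrite plus_INR, mult_INR. fold Q mm. pose proof (pos_INR r). lra. }
  assert (gen : forall l D, mm * Q <= l -> 0 <= D ->
     2 * PI * eps * l / Q ^ 2 * D / l ^ 2 <= c * D).
  { intros l D H HD. assert (HmQ : 1 <= mm * Q) by nra.
    replace (2 * PI * eps * l / Q ^ 2 * D / l ^ 2) with ((2 * PI * eps * D / Q ^ 2) * / l) by (field; lra).
    replace (c * D) with ((2 * PI * eps * D / Q ^ 2) * / (mm * Q)) by (unfold c; field; lra).
    apply Rmult_le_compat_l.
    - apply Rdiv_le_0_compat; [apply Rmult_le_pos; lra|apply pow_lt; lra].
    - apply Rinv_le_contravar; lra. }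
  assert (HmQ : 1 <= mm * Q) by nra.
  assert (B0 : G (S m * q + 0) <= c * 1).
  { eapply Rle_trans; [|apply (gen (INR (S m * q + 0)) 1); [apply Hl|lra]].
    unfold G, Rdiv at 1 3. apply Rmult_le_compat_r.
    - left; apply Rinv_0_lt_compat, pow_lt. specialize (Hl O); lra.
    - rewrite Rmult_1_r. apply alias_defect_small. }
  assert (B : sumR n (fun i => G (S m * q + (1 + i))%nat)
     <= c * sumR n (fun i => / INR (S i) + / (Q - INR (S i)))).
  { apply sumR_le_scal. intros i Hi.
    assert (R1 : 1 <= INR (S i)) by (rewrite S_INR; pose proof (pos_INR i); lra).
    assert (R2 : INR (S i) <= INR n) by (apply le_INR; lia).
    eapply Rle_trans; [|apply (gen (INR (S m * q + S i))); [apply Hl|]].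
    - unfold G, Rdiv at 1 3. apply Rmult_le_compat_r.
      + left; apply Rinv_0_lt_compat, pow_lt. pose proof (Hl (1 + i)%nat); pose proof (Hl (S i)); lra.
      + apply alias_defect_nonresonant; lia.
    - apply Rplus_le_le_0_compat; left; apply Rinv_0_lt_compat; lra. }
  rewrite (harm_rev n) in B by auto.
  pose proof (harmonic_le_sqrt n) as H.
  assert (S1 : 1 <= sqrt Q) by (rewrite <- sqrt_1 at 1; apply sqrt_le_1_alt; lra).
  assert (sqrt (INR n) <= sqrt Q) by (apply sqrt_le_1_alt; lra).
  apply Rle_trans with (c * (5 * sqrt Q)).
  - eapply Rle_trans; [apply Rplus_le_compat; [apply B0|apply B]|].
    rewrite <- Rmult_plus_distr_l. apply Rmult_le_compat_l; auto. lra.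
  - replace (40 * eps / Q ^ 3 * sqrt Q * / mm) with ((8 * eps) * (5 * sqrt Q) * (/ Q ^ 3 * / mm)) by (field; lra).
    replace (c * (5 * sqrt Q)) with ((2 * PI * eps) * (5 * sqrt Q) * (/ Q ^ 3 * / mm)) by (unfold c; field; lra).
    apply Rmult_le_compat_r.
    + apply Rmult_le_pos; left; apply Rinv_0_lt_compat; [apply pow_lt|]; lra.
    + apply Rmult_le_compat_r; lra.
Qed.

(** Past [q^2] the distance to resonances no longer helps. The geometric mean of the linear bound
    and the trivial bound 2 grows like [sqrt l]; after division by [l ^ 2] the sum is dominated by
    increments of [/ sqrt (l - 1)] and telescopes. *)
Lemma alias_tail n :
  sumR n (fun i => G ((q + 1) * q + i)%nat) <= 8 * sqrt eps / Q ^ 2.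
Proof.
  (* The first index after the blocks 0 to [q]; it exceeds [Q ^ 2] by at least one, which pays for
     the shift [l - 1] in the telescoping sum. *)
  set (L := ((q + 1) * q)%nat).
  assert (HL : Q ^ 2 <= INR L - 1).
  { unfold L. rewrite mult_INR, plus_INR. fold Q. simpl INR. nra. }
  assert (Q2 : 1 <= Q ^ 2) by nra.
  set (c := 4 * sqrt eps / Q).
  assert (Hse := sqrt_pos eps).
  assert (Hc : 0 <= c) by (apply Rdiv_le_0_compat; lra).
  set (f := fun i => / sqrt (INR (L + i) - 1)).
  assert (B : sumR n (fun i => G (L + i)%nat) <= (c * 2) * sumR n (fun i => - (f (S i) - f i))).
  { apply sumR_le_scal. intros i _. unfold f.
    replace (L + S i)%nat with (S (L + i)) by lia. rewrite S_INR.
    assert (HLi : 2 <= INR (L + i)) by (rewrite plus_INR; pose proof (pos_INR i); lra).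
    unfold G.
    pose proof (alias_defect_small (L + i)) as D1. pose proof (alias_defect_le_2 (L + i)) as D2.
    set (D := Rabs (alias_defect (L + i))) in *. set (l := INR (L + i)) in *.
    replace (l + 1 - 1) with l by ring.
    assert (D0 : 0 <= D) by apply Rabs_pos.
    (* [D * D] is at most the product of the bounds [2] and [2 PI eps l / Q ^ 2]. *)
    assert (DD : D <= c * sqrt l).
    { apply Rsqr_incr_0_var; [|apply Rmult_le_pos; [auto|apply sqrt_pos]].
      unfold Rsqr. replace (c * sqrt l * (c * sqrt l)) with (c * c * (sqrt l * sqrt l)) by ring.
      rewrite sqrt_sqrt by lra.
      replace (c * c) with (16 * (sqrt eps * sqrt eps) / Q ^ 2) by (unfold c; field; lra).
      rewrite sqrt_sqrt by lra.
      apply Rle_trans with (2 * (2 * PI * eps * l / Q ^ 2)); [nra|].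
      assert (0 < / Q ^ 2) by (apply Rinv_0_lt_compat, pow_lt; lra).
      unfold Rdiv.
      replace (2 * (2 * PI * eps * l * / Q ^ 2)) with ((2 * PI * eps) * (2 * l * / Q ^ 2)) by ring.
      replace (16 * eps * / Q ^ 2 * l) with ((8 * eps) * (2 * l * / Q ^ 2)) by ring.
      apply Rmult_le_compat_r; [nra|lra]. }
    set (a := sqrt l) in *. set (b := sqrt (l - 1)).
    assert (Hb : 1 <= b) by (unfold b; rewrite <- sqrt_1 at 1; apply sqrt_le_1_alt; lra).
    assert (Hab : b <= a) by (unfold a, b; apply sqrt_le_1_alt; lra).
    assert (Ea : a * a = l) by (apply sqrt_sqrt; lra).
    assert (Eb : b * b = l - 1) by (apply sqrt_sqrt; lra).
    apply Rle_trans with (c * a / l ^ 2).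
    - unfold Rdiv; apply Rmult_le_compat_r; auto. left; apply Rinv_0_lt_compat, pow_lt; lra.
    - rewrite <- Ea. replace (c * a / (a * a) ^ 2) with (c * / (a * a * a)) by (field; lra).
      apply Rle_trans with (c * (2 * - (/ a - / b))); [|right; ring].
      apply Rmult_le_compat_l; auto.
      replace (2 * - (/ a - / b)) with (2 * (a - b) / (a * b)) by (field; lra).
      assert (E1 : (a - b) * (a + b) = 1) by lra.
      apply (Rmult_le_reg_r (a * a * a * b)); [repeat apply Rmult_lt_0_compat; lra|].
      replace (/ (a * a * a) * (a * a * a * b)) with b by (field; lra).
      replace (2 * (a - b) / (a * b) * (a * a * a * b)) with (a * (2 * a * (a - b))) by (field; lra).
      nra. }
  eapply Rle_trans; [apply B|].
  rewrite (sumR_ext n _ (fun i => (-1) * (f (S i) - f i))) by (intros; ring).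
  rewrite sumR_scal, sumR_telescope.
  assert (0 < f n).
  { unfold f. apply Rinv_0_lt_compat, sqrt_lt_R0. rewrite plus_INR; pose proof (pos_INR n); lra. }
  assert (f O <= / Q).
  { unfold f. apply Rinv_le_contravar; [lra|]. rewrite Nat.add_0_r.
    rewrite <- (sqrt_pow2 Q) by lra. apply sqrt_le_1_alt; lra. }
  replace (8 * sqrt eps / Q ^ 2) with (c * 2 * / Q) by (unfold c; field; lra).
  apply Rmult_le_compat_l; lra.
Qed.

Lemma alias_sum_bound N :
  sumR N (fun l => Rabs (alias_defect l) / INR l ^ 2) <= 200 * sqrt eps / Q ^ 2.
Proof.
  fold G.
  apply Rle_trans with (sumR ((q + 1) * q + N) G); [apply sumR_mono; [lia|apply G_pos]|].
  rewrite sumR_add. pose proof (alias_tail N) as T.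
  assert (B : sumR ((q + 1) * q) G <= 24 * eps / Q ^ 2 + 80 * eps / Q ^ 2).
  { rewrite sumR_mul, Nat.add_comm, sumR_add. cbn [sumR]. rewrite Rplus_0_l.
    apply Rplus_le_compat.
    - eapply Rle_trans; [|apply alias_block_0]. right; apply sumR_ext; intros; f_equal; lia.
    - eapply Rle_trans; [apply sumR_le_scal; intros i _; apply alias_block|].
      pose proof (harmonic_le_sqrt q) as H. fold Q in H.
      eapply Rle_trans; [apply Rmult_le_compat_l; [|apply H]|].
      + apply Rmult_le_pos; [apply Rdiv_le_0_compat; [lra|apply pow_lt; lra]|apply sqrt_pos].
      + right. replace (40 * eps / Q ^ 3 * sqrt Q * (2 * sqrt Q)) with (80 * eps / Q ^ 3 * (sqrt Q * sqrt Q)) by (field; lra).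
        rewrite sqrt_sqrt by lra. field; lra. }
  assert (eps <= sqrt eps).
  { rewrite <- (sqrt_sqrt eps) at 1 by lra. assert (0 <= sqrt eps) by apply sqrt_pos.
    assert (sqrt eps <= 1) by (rewrite <- sqrt_1; apply sqrt_le_1_alt; lra). nra. }
  assert (0 < / Q ^ 2) by (apply Rinv_0_lt_compat, pow_lt; lra).
  unfold Rdiv in *. assert (104 * eps * / Q ^ 2 <= 104 * sqrt eps * / Q ^ 2) by nra.
  nra.
Qed.
End AlmostEquidistributed.

(** * Cosine series *)

(* Equations between Coquelicot integrals live in the carrier of a normed module; [ring] and [field] must see [R]. *)
Ltac req := match goal with |- ?l = ?r => change (@eq R l r) end.

Lemma derive_plus (f g : R -> R) t l m :
  is_derive f t l -> is_derive g t m -> is_derive (fun z => f z + g z) t (l + m).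
Proof. apply (is_derive_plus (V:=R_NormedModule)). Qed.

Lemma derive_minus (f g : R -> R) t l m :
  is_derive f t l -> is_derive g t m -> is_derive (fun z => f z - g z) t (l - m).
Proof. apply (is_derive_minus (V:=R_NormedModule)). Qed.

Lemma derive_const (c t : R) : is_derive (fun _ : R => c) t 0.
Proof. apply (is_derive_const (V:=R_NormedModule)). Qed.

Lemma derive_id (t : R) : is_derive (fun z : R => z) t 1.
Proof. apply (is_derive_id (K:=R_AbsRing)). Qed.

Lemma ex_derive_cont (f : R -> R) t : ex_derive f t -> continuous f t.
Proof. apply (ex_derive_continuous (V:=R_NormedModule)). Qed.

Lemma ex_RInt_cont (f : R -> R) a b : (forall t, continuous f t) -> ex_RInt f a b.
Proof. intros H; apply (ex_RInt_continuous (V := R_CompleteNormedModule)); auto. Qed.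

Lemma RInt_plus_cont (f g : R -> R) a b :
  (forall t, continuous f t) -> (forall t, continuous g t) ->
  RInt (fun t => f t + g t) a b = RInt f a b + RInt g a b.
Proof. intros Hf Hg; apply (RInt_plus (V:=R_CompleteNormedModule)); now apply ex_RInt_cont. Qed.

Lemma RInt_minus_cont (f g : R -> R) a b :
  (forall t, continuous f t) -> (forall t, continuous g t) ->
  RInt (fun t => f t - g t) a b = RInt f a b - RInt g a b.
Proof. intros Hf Hg; apply (RInt_minus (V:=R_CompleteNormedModule)); now apply ex_RInt_cont. Qed.

Lemma RInt_scal_cont (f : R -> R) c a b :
  (forall t, continuous f t) -> RInt (fun t => c * f t) a b = c * RInt f a b.
Proof. intros Hf; apply (RInt_scal (V:=R_CompleteNormedModule)); now apply ex_RInt_cont. Qed.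

Lemma RInt_const_R (c a b : R) : RInt (fun _ => c) a b = (b - a) * c.
Proof. apply (RInt_const (V:=R_CompleteNormedModule)). Qed.

Lemma RInt_Chasles_cont (f : R -> R) a b c :
  (forall t, continuous f t) -> RInt f a b + RInt f b c = RInt f a c.
Proof. intros Hf; apply (RInt_Chasles (V:=R_CompleteNormedModule)); now apply ex_RInt_cont. Qed.

Lemma RInt_of_derive (f df : R -> R) a b :
  (forall t, is_derive f t (df t)) -> (forall t, continuous df t) -> RInt df a b = f b - f a.
Proof.
  intros H C; apply (is_RInt_unique (V:=R_CompleteNormedModule)).
  apply (is_RInt_derive (V:=R_CompleteNormedModule)); auto.
Qed.

Lemma cont_mult (f g : R -> R) t :
  continuous f t -> continuous g t -> continuous (fun t => f t * g t) t.
Proof. intros; now apply (continuous_mult (K:=R_AbsRing)). Qed.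

Lemma cont_plus (f g : R -> R) t :
  continuous f t -> continuous g t -> continuous (fun t => f t + g t) t.
Proof. intros; now apply (continuous_plus (V:=R_NormedModule)). Qed.

Lemma cont_minus (f g : R -> R) t :
  continuous f t -> continuous g t -> continuous (fun t => f t - g t) t.
Proof. intros; now apply (continuous_minus (V:=R_NormedModule)). Qed.

Lemma derive_cont (f : R -> R) t l : is_derive f t l -> continuous f t.
Proof. intros; apply ex_derive_cont; now exists l. Qed.

Ltac cder := apply ex_derive_cont; auto_derive; auto.

Lemma periodic_Z (f : R -> R) :
  (forall t, f (t + 1) = f t) -> forall (n : Z) t, f (t + IZR n) = f t.
Proof.
  intros H.
  assert (N : forall (n : nat) t, f (t + INR n) = f t).
  { induction n; intros t; [simpl; f_equal; ring|].
    rewrite S_INR, <- Rplus_assoc, H; auto. }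
  intros n t. destruct (Z_le_dec 0 n) as [L|L].
  - rewrite <- (Z2Nat.id n L), <- INR_IZR_INZ. apply N.
  - rewrite <- (N (Z.to_nat (- n)) (t + IZR n)). f_equal.
    rewrite INR_IZR_INZ, Z2Nat.id, opp_IZR by lia. ring.
Qed.

Lemma periodic_reduce (t : R) : exists (n : Z) (z : R), 0 <= z <= 1 /\ t = z + IZR n.
Proof.
  exists (Int_part t), (frac_part t). unfold frac_part.
  destruct (base_fp t) as [A B]. unfold frac_part in A, B. split; lra.
Qed.

Lemma periodic_bounded (f : R -> R) :
  (forall t, f (t + 1) = f t) -> (forall t, continuous f t) ->
  exists M, 0 <= M /\ forall t, Rabs (f t) <= M.
Proof.
  intros Hp Hc.
  destruct (continuity_ab_maj (fun t => Rabs (f t)) 0 1 ltac:(lra)) as [z [Hz _]].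
  - intros c _. apply continuity_pt_filterlim.
    apply (continuous_comp f Rabs); [apply Hc|apply continuous_Rabs].
  - exists (Rabs (f z)); split; [apply Rabs_pos|]. intros t.
    destruct (periodic_reduce t) as [n [w [Hw ->]]]. rewrite periodic_Z; auto.
Qed.

Lemma RInt_shift (f : R -> R) a b c :
  (forall t, continuous f t) -> RInt (fun t => f (t + c)) a b = RInt f (a + c) (b + c).
Proof.
  intros Hc.
  pose proof (RInt_comp_lin f 1 c a b (ex_RInt_cont f _ _ Hc)) as E.
  rewrite 2!Rmult_1_l in E. rewrite <- E.
  apply RInt_ext; intros t _. change (f (t + c) = 1 * f (1 * t + c)). now rewrite !Rmult_1_l.
Qed.

Lemma RInt_reflect (f : R -> R) a b c :
  (forall t, continuous f t) -> RInt (fun t => f (c - t)) a b = RInt f (c - b) (c - a).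
Proof.
  intros Hc.
  pose proof (RInt_comp_lin f (-1) c a b (ex_RInt_cont f _ _ Hc)) as E.
  replace (-1 * a + c) with (c - a) in E by ring. replace (-1 * b + c) with (c - b) in E by ring.
  rewrite <- (opp_RInt_swap f) by (now apply ex_RInt_cont).
  rewrite <- E, <- (RInt_opp (V := R_CompleteNormedModule)).
  - apply RInt_ext; intros t _. change (f (c - t) = - (-1 * f (-1 * t + c))).
    replace (-1 * t + c) with (c - t) by ring. ring.
  - apply ex_RInt_cont. intros t. apply (continuous_scal_r (V:=R_NormedModule)).
    apply (continuous_comp (fun t => -1 * t + c) f); [|apply Hc].
    apply ex_derive_cont. auto_derive; auto.
Qed.

Lemma RInt_periodic (f : R -> R) a :
  (forall t, continuous f t) -> (forall t, f (t + 1) = f t) -> RInt f a (a + 1) = RInt f 0 1.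
Proof.
  intros Hc Hp.
  rewrite <- (RInt_Chasles f a 0 (a + 1)) by (now apply ex_RInt_cont).
  rewrite <- (RInt_Chasles f 0 1 (a + 1)) by (now apply ex_RInt_cont).
  pose proof (RInt_shift f 0 a 1 Hc) as E. rewrite Rplus_0_l in E.
  rewrite <- E, (RInt_ext (fun t => f (t + 1)) f) by (intros; apply Hp).
  rewrite <- (opp_RInt_swap f) by (now apply ex_RInt_cont).
  change (- RInt f 0 a + (RInt f 0 1 + RInt f 0 a) = RInt f 0 1). ring.
Qed.

Lemma Rabs_diff_le_of_derive (f df : R -> R) (a b M : R) :
  (forall t, is_derive f t (df t)) ->
  (forall t, Rmin a b <= t <= Rmax a b -> Rabs (df t) <= M) ->
  Rabs (f b - f a) <= M * Rabs (b - a).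
Proof.
  intros Hd HM. destruct (MVT_gen f a b df) as [c [Hc E]].
  - intros; apply Hd.
  - intros t _. apply continuity_pt_filterlim, ex_derive_cont.
    eexists; apply Hd.
  - rewrite E, Rabs_mult. apply Rmult_le_compat_r; [apply Rabs_pos|now apply HM].
Qed.

Lemma periodic_derive (f df : R -> R) :
  (forall t, is_derive f t (df t)) -> (forall t, f (t + 1) = f t) ->
  forall t, df (t + 1) = df t.
Proof.
  intros Hd Hp t.
  rewrite <- (is_derive_unique f t (df t)) by apply Hd.
  rewrite <- (Derive_ext (fun z => f (z + 1)) f t) by apply Hp.
  symmetry; apply is_derive_unique.
  replace (df (t + 1)) with (scal 1 (df (t + 1))) by (change (1 * df (t + 1) = df (t + 1)); ring).
  apply (is_derive_comp f (fun z => z + 1)); [apply Hd|auto_derive; auto; ring].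
Qed.

Definition dirichlet (N : nat) (t : R) : R :=
  1 + 2 * sumR N (fun l => cos (2 * PI * INR (S l) * t)).

Lemma dirichlet_sin N t : dirichlet N t * sin (PI * t) = sin (INR (2 * N + 1) * PI * t).
Proof.
  unfold dirichlet. induction N as [|N IH].
  - simpl. rewrite Rmult_0_r, Rplus_0_r, !Rmult_1_l. reflexivity.
  - cbn [sumR].
    replace ((1 + 2 * (sumR N (fun l => cos (2 * PI * INR (S l) * t)) + cos (2 * PI * INR (S N) * t))) * sin (PI * t))
    with ((1 + 2 * sumR N (fun l => cos (2 * PI * INR (S l) * t))) * sin (PI * t)
           + 2 * cos (2 * PI * INR (S N) * t) * sin (PI * t)) by ring.
    rewrite IH.
    rewrite !plus_INR, !mult_INR, !S_INR. simpl INR.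
    set (z := 2 * PI * (INR N + 1) * t).
    replace (((0 + 1 + 1) * INR N + (0 + 1)) * PI * t) with (z - PI * t) by (unfold z; ring).
    replace (((0 + 1 + 1) * (INR N + 1) + (0 + 1)) * PI * t) with (z + PI * t) by (unfold z; ring).
    rewrite sin_plus, sin_minus. ring.
Qed.

Section FourierCosine.
Variables u u1 u2 : R -> R.
Hypothesis Du : forall t, is_derive u t (u1 t).
Hypothesis Du1 : forall t, is_derive u1 t (u2 t).
Hypothesis Cu2 : forall t, continuous u2 t.
Hypothesis Per : forall t, u (t + 1) = u t.
Hypothesis Even : forall t, u (- t) = u t.
Hypothesis Mean : RInt u 0 1 = 0.

Definition cos_coeff (l : nat) : R := 2 * RInt (fun t => u t * cos (2 * PI * INR l * t)) 0 1.

Let Cu t : continuous u t.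
Proof. apply ex_derive_cont; eexists; apply Du. Qed.

Let Exu t : ex_derive u t.
Proof. eexists; apply Du. Qed.
Let Exu1 t : ex_derive u1 t.
Proof. eexists; apply Du1. Qed.
Let Deu t : Derive u t = u1 t.
Proof. now apply is_derive_unique. Qed.
Let Deu1 t : Derive u1 t = u2 t.
Proof. now apply is_derive_unique. Qed.

Let Per1 := periodic_derive u u1 Du Per.
Let Per2 := periodic_derive u1 u2 Du1 Per1.

Lemma cos_coeff_decay : exists M, forall l, (1 <= l)%nat -> INR l ^ 2 * Rabs (cos_coeff l) <= M.
Proof.
  destruct (periodic_bounded u2 Per2 Cu2) as [M [HM0 HM]].
  exists M. intros l Hl.
  assert (L1 : 1 <= INR l) by (change 1 with (INR 1); now apply le_INR).
  assert (HP := PI_RGT_0). assert (HP2 := PI2_3_2).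
  set (w := 2 * PI * INR l). assert (Hw : 2 * INR l <= w) by (unfold w; nra).
  assert (C1 : forall t, continuous (fun t => u t * cos (w * t)) t) by (intros; cder).
  assert (C2 : forall t, continuous (fun t => / w ^ 2 * (u2 t * cos (w * t))) t).
  { intros t. apply cont_mult; [apply continuous_const|]. apply cont_mult; [apply Cu2|cder]. }
  assert (Ec : RInt (fun t => u t * cos (w * t)) 0 1 = - RInt (fun t => / w ^ 2 * (u2 t * cos (w * t))) 0 1).
  { cut (RInt (fun t => u t * cos (w * t) + / w ^ 2 * (u2 t * cos (w * t))) 0 1 = 0).
    - rewrite RInt_plus_cont by auto. lra.
    (* Two integrations by parts at once: this primitive takes equal values at 0 and 1 by
       periodicity. *)
    - rewrite (RInt_of_derive (fun t => u t * sin (w * t) / w + u1 t * cos (w * t) / w ^ 2)).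
      + replace (w * 1) with (0 + 2 * INR l * PI) by (unfold w; ring).
        rewrite sin_period, cos_period, Rmult_0_r.
        replace (u 1) with (u 0) by (rewrite <- (Per 0); f_equal; ring).
        replace (u1 1) with (u1 0) by (rewrite <- (Per1 0); f_equal; ring).
        req; field; lra.
      + intros t. auto_derive; [repeat split; auto|]. rewrite Deu, Deu1. field; lra.
      + intros t. now apply cont_plus. }
  unfold cos_coeff. fold w. rewrite Ec, Rabs_mult, Rabs_Ropp, (Rabs_right 2) by lra.
  assert (B : Rabs (RInt (fun t => / w ^ 2 * (u2 t * cos (w * t))) 0 1) <= (1 - 0) * (M / w ^ 2)).
  { apply abs_RInt_le_const; [lra|now apply ex_RInt_cont|].
    intros t _. rewrite 2!Rabs_mult.
    rewrite (Rabs_right (/ w ^ 2)) by (left; apply Rinv_0_lt_compat, pow_lt; lra).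
    unfold Rdiv; rewrite (Rmult_comm M).
    apply Rmult_le_compat_l; [left; apply Rinv_0_lt_compat, pow_lt; lra|].
    assert (Rabs (cos (w * t)) <= 1) by (apply Rabs_le, COS_bound).
    pose proof (Rabs_pos (u2 t)). pose proof (Rabs_pos (cos (w * t))). specialize (HM t). nra. }
  apply Rle_trans with (INR l ^ 2 * (2 * (M / w ^ 2))).
  - apply Rmult_le_compat_l; [apply pow_le; lra|lra].
  - apply (Rmult_le_reg_r (w ^ 2)); [apply pow_lt; lra|].
    replace (INR l ^ 2 * (2 * (M / w ^ 2)) * w ^ 2) with (2 * INR l ^ 2 * M) by (field; lra).
    assert (4 * INR l ^ 2 <= w ^ 2) by nra. nra.
Qed.

(** Evenness replaces [u (x - t)] by [u (- x + t)]. Shifting both integrals back by periodicity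
    produces the kernel [cos (w (t - x)) + cos (w (t + x))], which factors as
    [2 cos (w t) cos (w x)]. *)
Lemma cos_term_integral x l :
  cos_coeff l * cos (2 * PI * INR l * x) =
  RInt (fun t => (u (x + t) + u (x - t)) * cos (2 * PI * INR l * t)) 0 1.
Proof.
  set (w := 2 * PI * INR l).
  assert (Pc : forall t, cos (w * (t + 1)) = cos (w * t)).
  { intros t. replace (w * (t + 1)) with (w * t + 2 * INR l * PI) by (unfold w; ring). apply cos_period. }
  assert (Pc' : forall y t, cos (w * (t + 1 - y)) = cos (w * (t - y))).
  { intros y t. replace (t + 1 - y) with (t - y + 1) by ring. apply Pc. }
  assert (C1 : forall y t, continuous (fun t => u t * cos (w * (t - y))) t).
  { intros y t. apply ex_derive_cont; auto_derive; auto. }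
  assert (Sh : forall y, RInt (fun t => u (y + t) * cos (w * t)) 0 1
                         = RInt (fun t => u t * cos (w * (t - y))) 0 1).
  { intros y. rewrite <- (RInt_periodic (fun t => u t * cos (w * (t - y))) y).
    - pose proof (RInt_shift (fun t => u t * cos (w * (t - y))) 0 1 y (C1 y)) as E.
      rewrite Rplus_0_l, (Rplus_comm 1 y) in E. rewrite <- E.
      apply RInt_ext; intros t _. replace (t + y - y) with t by ring. now rewrite (Rplus_comm t).
    - auto.
    - intros t. now rewrite Per, Pc'. }
  rewrite (RInt_ext _ (fun t => u (x + t) * cos (w * t) + u (- x + t) * cos (w * t))).
  2:{ intros t _. rewrite <- (Even (x - t)). replace (- (x - t)) with (- x + t) by ring. req; ring. }
  rewrite RInt_plus_cont by (intros; cder).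
  rewrite !Sh, <- RInt_plus_cont by auto.
  unfold cos_coeff. fold w.
  replace (2 * RInt (fun t => u t * cos (w * t)) 0 1 * cos (w * x))
    with (2 * cos (w * x) * RInt (fun t => u t * cos (w * t)) 0 1) by ring.
  rewrite <- RInt_scal_cont by (intros; cder).
  apply RInt_ext; intros t _.
  replace (w * (t - x)) with (w * t - w * x) by ring.
  replace (w * (t - - x)) with (w * t + w * x) by ring.
  rewrite cos_plus, cos_minus. req; ring.
Qed.

(** The constant term of the kernel meets the mean of [u], which is zero, and every cosine
    integrates to zero against the constant [u x]. Subtracting [u x] inside the integral makes the
    factor of the kernel vanish at [t = 0]. *)
Lemma dirichlet_representation x N :
  sumR N (fun l => cos_coeff (S l) * cos (2 * PI * INR (S l) * x)) - u x =
  RInt (fun t => ((u (x + t) + u (x - t)) / 2 - u x) * dirichlet N t) 0 1.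
Proof.
  assert (M1 : forall y, RInt (fun t => u (y + t)) 0 1 = 0).
  { intros y. rewrite (RInt_ext _ (fun t => u (t + y))) by (intros; f_equal; ring).
    rewrite RInt_shift by auto. rewrite Rplus_0_l, (Rplus_comm 1), RInt_periodic; auto. }
  unfold dirichlet. induction N as [|N IH]; cbn [sumR].
  - rewrite (RInt_ext _ (fun t => / 2 * (u (x + t) + u (- x + t)) - u x)).
    2:{ intros t _. rewrite <- (Even (x - t)). replace (- (x - t)) with (- x + t) by ring. req; field. }
    rewrite RInt_minus_cont, RInt_scal_cont, RInt_plus_cont, !M1, RInt_const_R; try (intros; cder).
    ring.
  - set (w := 2 * PI * INR (S N)).
    assert (Cd : forall n t, ex_derive (fun t => sumR n (fun l => cos (2 * PI * INR (S l) * t))) t).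
    { induction n as [|n IHn]; intros t; cbn [sumR]; [apply ex_derive_const|].
      apply (ex_derive_plus (V:=R_NormedModule)); [apply IHn|auto_derive; auto]. }
    rewrite (RInt_ext _ (fun t => ((u (x + t) + u (x - t)) / 2 - u x) *
         (1 + 2 * sumR N (fun l => cos (2 * PI * INR (S l) * t))) +
         ((u (x + t) + u (x - t)) * cos (w * t) - 2 * u x * cos (w * t)))).
    2:{ intros t _. unfold w. req; field. }
    assert (Hw : w <> 0).
    { unfold w. pose proof PI_RGT_0. rewrite S_INR. pose proof (pos_INR N). nra. }
    assert (CK : forall t, continuous (fun t => ((u (x + t) + u (x - t)) / 2 - u x) *
         (1 + 2 * sumR N (fun l => cos (2 * PI * INR (S l) * t)))) t).
    { intros t. apply cont_mult; [cder|]. apply cont_plus; [apply continuous_const|].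
      apply cont_mult; [apply continuous_const|].
      apply ex_derive_cont, Cd. }
    assert (Ca : forall t, continuous (fun t => (u (x + t) + u (x - t)) * cos (w * t)) t)
      by (intros; cder).
    assert (Cb : forall t, continuous (fun t => cos (w * t)) t) by (intros; cder).
    assert (Cc : forall t, continuous (fun t => 2 * u x * cos (w * t)) t) by (intros; cder).
    rewrite RInt_plus_cont; [|exact CK|intros; now apply cont_minus].
    rewrite RInt_minus_cont by assumption.
    rewrite <- IH, RInt_scal_cont by assumption.
    unfold w; rewrite <- cos_term_integral; fold w.
    rewrite (RInt_of_derive (fun t => sin (w * t) / w) (fun t => cos (w * t))).
    + replace (w * 1) with (0 + 2 * INR (S N) * PI) by (unfold w; ring).
      rewrite sin_period, Rmult_0_r, sin_0. req; field; auto.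
    + intros t; auto_derive; auto. field; auto.
    + exact Cb.
Qed.

Definition cos_partial_sum (N : nat) (x : R) : R :=
  sumR N (fun l => cos_coeff (S l) * cos (2 * PI * INR (S l) * x)).

(** Next to 0 the kernel is bounded by its supremum; elsewhere it is [sin (w t) / sin (PI t)], and
    one integration by parts gains [/ w], of size [/ N]. A rate with some constant suffices here:
    [cos_partial_sum_error] improves the constant. *)
Lemma cos_partial_sum_converges :
  exists C, forall N x, (1 <= N)%nat -> Rabs (cos_partial_sum N x - u x) <= C / INR N.
Proof.
  destruct (periodic_bounded u2 Per2 Cu2) as [M [HM0 HM]].
  exists (100 * M + 2). intros N x HN.
  assert (N1 : 1 <= INR N) by (change 1 with (INR 1); now apply le_INR).
  assert (HP := PI_4). assert (HP2 := PI2_3_2).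
  unfold cos_partial_sum. rewrite dirichlet_representation.
  (* The symmetric second difference is [O(t ^ 2)], which beats the simple zero of [sin (PI t)] both
     in the quotient and in its derivative. *)
  set (f := fun t => (u (x + t) + u (x - t)) / 2 - u x).
  set (f1 := fun t => (u1 (x + t) - u1 (x - t)) / 2).
  assert (Df : forall t, is_derive f t (f1 t)).
  { intros t. unfold f, f1. auto_derive; [repeat split; auto|]. rewrite !Deu. unfold Rminus. field. }
  assert (Bf1 : forall t, 0 <= t -> Rabs (f1 t) <= M * t).
  { intros t Ht. unfold f1.
    pose proof (Rabs_diff_le_of_derive u1 u2 (x - t) (x + t) M Du1 (fun z _ => HM z)) as B.
    replace (x + t - (x - t)) with (2 * t) in B by ring. rewrite (Rabs_right (2 * t)) in B by lra.
    unfold Rdiv; rewrite Rabs_mult, (Rabs_right (/ 2)) by lra. lra. }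
  assert (Bf : forall t, 0 <= t -> Rabs (f t) <= M * t ^ 2).
  { intros t Ht.
    assert (f0 : f 0 = 0) by (unfold f; rewrite Rplus_0_r, Rminus_0_r; field).
    pose proof (Rabs_diff_le_of_derive f f1 0 t (M * t) Df) as B.
    rewrite f0, !Rminus_0_r, (Rabs_right t) in B by lra.
    replace (M * t ^ 2) with (M * t * t) by ring. apply B.
    intros z Hz. rewrite Rmin_left, Rmax_right in Hz by auto.
    eapply Rle_trans; [apply Bf1; lra|nra]. }
  assert (Cf : forall t, continuous f t) by (intros t; eapply derive_cont, Df).
  assert (Cd : forall n t, ex_derive (fun t => sumR n (fun l => cos (2 * PI * INR (S l) * t))) t).
  { induction n as [|n IHn]; intros t; cbn [sumR]; [apply ex_derive_const|].
    apply (ex_derive_plus (V:=R_NormedModule)); [apply IHn|auto_derive; auto]. }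
  set (F := fun t : R => f t * dirichlet N t).
  assert (CF : forall t, continuous F t).
  { intros t. unfold F. apply cont_mult; [apply Cf|]. apply cont_plus; [apply continuous_const|].
    apply cont_mult; [apply continuous_const|].
    apply ex_derive_cont, Cd. }
  (* Symmetry reduces the integral to half a period, on which [sin (PI t)] vanishes only at 0. *)
  assert (Sym : forall t, F (1 - t) = F t).
  { intros t. unfold F. f_equal.
    - unfold f. replace (x + (1 - t)) with (x - t + 1) by ring. rewrite Per.
      replace (x + t) with (x - (1 - t) + 1) by ring. rewrite Per. field.
    - unfold dirichlet. do 2 f_equal. apply sumR_ext. intros l _.
      replace (2 * PI * INR (S l) * (1 - t)) with (- (2 * PI * INR (S l) * t) + 2 * INR (S l) * PI) by ring.
      rewrite cos_period. apply cos_neg. }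
  assert (BD : forall t, Rabs (dirichlet N t) <= 1 + 2 * INR N).
  { intros t. unfold dirichlet. eapply Rle_trans; [apply Rabs_triang|].
    rewrite Rabs_R1, Rabs_mult, (Rabs_right 2) by lra.
    apply Rplus_le_compat_l, Rmult_le_compat_l; [lra|].
    eapply Rle_trans; [apply sumR_abs|]. rewrite <- (Rmult_1_r (INR N)), <- sumR_const.
    apply sumR_le. intros l _. apply Rabs_le, COS_bound. }
  change (Rabs (RInt F 0 1) <= (100 * M + 2) / INR N).
  rewrite <- (RInt_Chasles_cont F 0 (1/2) 1 CF).
  assert (Half : RInt F (1/2) 1 = RInt F 0 (1/2)).
  { pose proof (RInt_reflect F 0 (1/2) 1 CF) as E. replace (1 - 1/2) with (1/2) in E by field.
    rewrite Rminus_0_r in E. rewrite <- E. apply RInt_ext; intros t _; apply Sym. }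
  rewrite Half. clear Half.
  set (K := 1 + 2 * INR N) in *.
  (* Since [K] bounds the kernel, the piece [[0, eta]] costs at most [M / N]; it also keeps the
     quotient [g] away from its removable singularity. *)
  set (eta := / (INR N * K)).
  assert (HNK : 3 <= INR N * K) by (unfold K; nra).
  assert (He : 0 < eta <= 1/3).
  { unfold eta; split; [apply Rinv_0_lt_compat; lra|].
    replace (1/3) with (/3) by field. apply Rinv_le_contravar; lra. }
  rewrite <- (RInt_Chasles_cont F 0 eta (1/2) CF).
  set (I1 := RInt F 0 eta). set (I2 := RInt F eta (1/2)).
  assert (B1 : Rabs I1 <= M / INR N).
  { unfold I1. replace (M / INR N) with ((eta - 0) * (M * K)) by (unfold eta; field; unfold K; lra).
    apply abs_RInt_le_const; [lra|now apply ex_RInt_cont|].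
    intros t Ht. unfold F. rewrite Rabs_mult. apply Rmult_le_compat; try apply Rabs_pos; [|apply BD].
    eapply Rle_trans; [apply Bf; lra|]. assert (t ^ 2 <= 1) by nra. nra. }
  set (w := INR (2 * N + 1) * PI).
  assert (Hw : 2 * INR N <= w).
  { unfold w. rewrite plus_INR, mult_INR. simpl INR. nra. }
  set (s := fun t => sin (PI * t)).
  assert (Hs : forall t, eta <= t <= 1/2 -> t / 2 <= s t).
  { intros t Ht. unfold s. pose proof (sin_PI_lower t ltac:(lra)). nra. }
  set (g := fun t => f t / s t).
  set (g1 := fun t => (f1 t * s t - f t * (PI * cos (PI * t))) / (s t) ^ 2).
  assert (Dg : forall t, eta <= t <= 1/2 -> is_derive g t (g1 t)).
  { intros t Ht. pose proof (Hs t Ht) as Hst.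
    assert (Hs0 : s t <> 0) by lra.
    unfold g1. apply is_derive_div; [apply Df| |exact Hs0].
    unfold s. auto_derive; auto. ring. }
  assert (Bg : forall t, eta <= t <= 1/2 -> Rabs (g t) <= M).
  { intros t Ht. pose proof (Hs t Ht). unfold g, Rdiv. rewrite Rabs_mult, Rabs_inv, (Rabs_right (s t)) by lra.
    apply (Rmult_le_reg_r (s t)); [lra|]. rewrite Rmult_assoc, Rinv_l, Rmult_1_r by lra.
    eapply Rle_trans; [apply Bf; lra|]. apply Rle_trans with (M * (t / 2)); [|apply Rmult_le_compat_l; lra].
    apply Rmult_le_compat_l; auto. nra. }
  assert (Bg1 : forall t, eta <= t <= 1/2 -> Rabs (g1 t) <= 20 * M).
  { intros t Ht. pose proof (Hs t Ht).
    assert (Hst : 0 < s t) by lra. assert (Hs1 : s t <= 1) by apply SIN_bound.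
    unfold g1, Rdiv. rewrite Rabs_mult, Rabs_inv, (Rabs_right (s t ^ 2)) by (apply Rle_ge, pow_le; lra).
    apply (Rmult_le_reg_r (s t ^ 2)); [apply pow_lt; lra|].
    rewrite Rmult_assoc, Rinv_l, Rmult_1_r by (apply pow_nonzero; lra).
    replace (f1 t * s t - f t * (PI * cos (PI * t))) with (f1 t * s t + - (f t * (PI * cos (PI * t)))) by ring.
    eapply Rle_trans; [apply Rabs_triang|]. rewrite Rabs_Ropp, !Rabs_mult.
    rewrite (Rabs_right (s t)), (Rabs_right PI) by lra.
    assert (Rabs (cos (PI * t)) <= 1) by (apply Rabs_le, COS_bound).
    pose proof (Bf1 t ltac:(lra)). pose proof (Bf t ltac:(lra)).
    pose proof (Rabs_pos (cos (PI * t))). pose proof (Rabs_pos (f t)). pose proof (Rabs_pos (f1 t)).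
    assert (T1 : Rabs (f1 t) * s t <= M * (2 * s t) * s t).
    { apply Rmult_le_compat_r; [lra|]. nra. }
    assert (T2 : PI * Rabs (cos (PI * t)) <= 4) by nra.
    assert (T2' : 0 <= PI * Rabs (cos (PI * t))) by nra.
    assert (T3 : Rabs (f t) * (PI * Rabs (cos (PI * t))) <= M * (4 * s t ^ 2) * 4).
    { apply Rmult_le_compat; auto. eapply Rle_trans; [eassumption|]. apply Rmult_le_compat_l; auto. nra. }
    assert (0 <= M * s t ^ 2) by (apply Rmult_le_pos; [auto|apply pow_le; lra]).
    nra. }
  assert (Cg : forall t, eta <= t <= 1/2 -> continuous g t) by (intros t Ht; eapply derive_cont, Dg, Ht).
  assert (Cu1 : forall t, continuous u1 t) by (intros t; eapply derive_cont, Du1).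
  assert (Cg1 : forall t, eta <= t <= 1/2 -> continuous g1 t).
  { intros t Ht. pose proof (Hs t Ht).
    assert (D1 : ex_derive g1 t).
    { unfold g1, f1, s. auto_derive. repeat split; auto. eexists; apply Df.
      unfold s in H. apply Rmult_integral_contrapositive_currified; lra. }
    now apply ex_derive_cont. }
  assert (HR : Rmin eta (1/2) = eta /\ Rmax eta (1/2) = 1/2).
  { rewrite Rmin_left, Rmax_right by lra; auto. }
  assert (Csin : forall t, continuous (fun t => sin (w * t)) t) by (intros; cder).
  assert (Ccos : forall t, continuous (fun t => / w * cos (w * t)) t) by (intros; cder).
  assert (E1 : ex_RInt (fun t => g t * sin (w * t)) eta (1/2)).
  { apply (ex_RInt_continuous (V:=R_CompleteNormedModule)). rewrite (proj1 HR), (proj2 HR). intros t Ht. now apply cont_mult; auto. }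
  assert (E2 : ex_RInt (fun t => g1 t * (/ w * cos (w * t))) eta (1/2)).
  { apply (ex_RInt_continuous (V:=R_CompleteNormedModule)). rewrite (proj1 HR), (proj2 HR). intros t Ht. now apply cont_mult; auto. }
  assert (EI2 : I2 = RInt (fun t => g t * sin (w * t)) eta (1/2)).
  { unfold I2. apply RInt_ext. rewrite (proj1 HR), (proj2 HR). intros t Ht.
    unfold F, g, w. rewrite <- dirichlet_sin. fold (s t). pose proof (Hs t ltac:(lra)). req; field; lra. }
  assert (Parts : I2 - RInt (fun t => g1 t * (/ w * cos (w * t))) eta (1/2)
        = - g (1/2) * cos (w * (1/2)) / w + g eta * cos (w * eta) / w).
  { rewrite EI2. rewrite <- (RInt_minus (V:=R_CompleteNormedModule)) by auto.
    apply (is_RInt_unique (V:=R_CompleteNormedModule)).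
    replace (- g (1/2) * cos (w * (1/2)) / w + g eta * cos (w * eta) / w)
      with ((- g (1/2) * cos (w * (1/2)) / w) - (- g eta * cos (w * eta) / w)) by (field; lra).
    apply (is_RInt_derive (V:=R_CompleteNormedModule) (fun t => - g t * cos (w * t) / w)).
    - rewrite (proj1 HR), (proj2 HR). intros t Ht. pose proof (Dg t Ht) as D. auto_derive; [eexists; apply D|].
      replace (Derive _ t) with (g1 t) by (symmetry; now apply is_derive_unique).
      change (minus ?a ?b) with (a - b). field; lra.
    - rewrite (proj1 HR), (proj2 HR). intros t Ht. apply cont_minus; now apply cont_mult; auto. }
  assert (B2 : Rabs (RInt (fun t => g1 t * (/ w * cos (w * t))) eta (1/2)) <= (1/2 - eta) * (20 * M * / w)).
  { apply abs_RInt_le_const; [lra|auto|]. intros t Ht. rewrite !Rabs_mult, (Rabs_right (/ w)).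
    2:{ apply Rle_ge; left; apply Rinv_0_lt_compat; lra. }
    assert (Rabs (cos (w * t)) <= 1) by (apply Rabs_le, COS_bound).
    assert (0 < / w) by (apply Rinv_0_lt_compat; lra).
    apply Rmult_le_compat; [apply Rabs_pos| |now apply Bg1|].
    - apply Rmult_le_pos; [lra|apply Rabs_pos].
    - pose proof (Rabs_pos (cos (w * t))). nra. }
  assert (Hiw : 0 < / w <= / INR N).
  { split; [apply Rinv_0_lt_compat; lra|]. apply Rinv_le_contravar; lra. }
  assert (Bb : forall t, eta <= t <= 1/2 -> Rabs (g t * cos (w * t) / w) <= M * / w).
  { intros t Ht. unfold Rdiv. rewrite 2!Rabs_mult, (Rabs_right (/ w)) by lra.
    apply Rmult_le_compat_r; [lra|].
    assert (Rabs (cos (w * t)) <= 1) by (apply Rabs_le, COS_bound).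
    pose proof (Bg t Ht). pose proof (Rabs_pos (cos (w * t))). pose proof (Rabs_pos (g t)). nra. }
  assert (Bt1 := Bb (1/2) ltac:(lra)). assert (Bt2 := Bb eta ltac:(lra)).
  assert (BI2 : Rabs I2 <= 12 * M * / w).
  { replace I2 with (RInt (fun t => g1 t * (/ w * cos (w * t))) eta (1/2) +
      (- (g (1/2) * cos (w * (1/2)) / w) + g eta * cos (w * eta) / w)) by (unfold Rdiv in *; lra).
    eapply Rle_trans; [apply Rabs_triang|].
    eapply Rle_trans; [apply Rplus_le_compat; [apply B2|apply Rabs_triang]|].
    rewrite Rabs_Ropp. assert (0 <= M * / w) by (apply Rmult_le_pos; lra). nra. }
  assert (BI2' : Rabs I2 <= 12 * M * / INR N) by nra.
  apply Rle_trans with (2 * (Rabs I1 + Rabs I2)).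
  - eapply Rle_trans; [apply Rabs_triang|]. pose proof (Rabs_triang I1 I2). lra.
  - assert (0 <= M * / INR N) by (apply Rmult_le_pos; lra). unfold Rdiv in *. nra.
Qed.

(** The error must be proportional to [A] for the contraction. The qualitative constant [C] only
    identifies the limit: between [N] and [N + k] the partial sums differ by a tail of [A / l ^ 2],
    dominated by a telescoping sum, and [k] tends to infinity. *)
Lemma cos_partial_sum_error A N x :
  (forall l, (1 <= l)%nat -> INR l ^ 2 * Rabs (cos_coeff l) <= A) -> (1 <= N)%nat ->
  Rabs (cos_partial_sum N x - u x) <= A / INR N.
Proof.
  intros HA HN. destruct cos_partial_sum_converges as [C HC].
  assert (N1 : 1 <= INR N) by (change 1 with (INR 1); now apply le_INR).
  assert (A0 : 0 <= A).
  { eapply Rle_trans; [|apply (HA 1%nat); lia]. apply Rmult_le_pos; [apply pow2_ge_0|apply Rabs_pos]. }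
  assert (D : forall k, Rabs (cos_partial_sum (N + k) x - cos_partial_sum N x) <= A * (/ INR N - / INR (N + k))).
  { induction k as [|k IH].
    - rewrite Nat.add_0_r, !Rminus_diag, Rabs_R0. lra.
    - rewrite Nat.add_succ_r. unfold cos_partial_sum in *. cbn [sumR].
      set (s := sumR (N + k) _) in *. set (s0 := sumR N _) in *. set (tm := cos_coeff (S (N + k)) * _).
      replace (s + tm - s0) with ((s - s0) + tm) by ring.
      eapply Rle_trans; [apply Rabs_triang|].
      assert (T : Rabs tm <= A * (/ INR (N + k) - / INR (S (N + k)))).
      { unfold tm. rewrite Rabs_mult. pose proof (HA (S (N + k)) ltac:(lia)) as Hl.
        assert (1 <= INR (N + k)) by (rewrite plus_INR; pose proof (pos_INR k); lra).
        rewrite S_INR in *. set (n := INR (N + k)) in *.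
        assert (Rabs (cos (2 * PI * (n + 1) * x)) <= 1) by (apply Rabs_le, COS_bound).
        apply Rle_trans with (Rabs (cos_coeff (S (N + k)))).
        { pose proof (Rabs_pos (cos_coeff (S (N + k)))). nra. }
        replace (/ n - / (n + 1)) with (/ (n * (n + 1))) by (field; lra).
        apply (Rmult_le_reg_r (n * (n + 1))); [nra|].
        rewrite Rmult_assoc, Rinv_l, Rmult_1_r by nra.
        eapply Rle_trans; [|apply Hl]. rewrite Rmult_comm.
        apply Rmult_le_compat_r; [apply Rabs_pos|]. nra. }
      lra. }
  apply le_epsilon. intros e He.
  destruct (INR_unbounded (Rabs C / e)) as [k Hk].
  specialize (D k). specialize (HC (N + k)%nat x ltac:(lia)).
  assert (Nk : 1 <= INR (N + k)) by (rewrite plus_INR; pose proof (pos_INR k); lra).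
  assert (Hke : Rabs C < INR k * e).
  { apply (Rmult_lt_compat_r e) in Hk; auto. unfold Rdiv in Hk. rewrite Rmult_assoc, Rinv_l, Rmult_1_r in Hk; lra. }
  assert (C / INR (N + k) <= e).
  { apply (Rmult_le_reg_r (INR (N + k))); [lra|]. unfold Rdiv. rewrite Rmult_assoc, Rinv_l, Rmult_1_r by lra.
    pose proof (Rle_abs C). rewrite plus_INR. nra. }
  assert (0 <= A * / INR (N + k)) by (apply Rmult_le_pos; [auto|left; apply Rinv_0_lt_compat; lra]).
  replace (cos_partial_sum N x - u x) with
    (- (cos_partial_sum (N + k) x - cos_partial_sum N x) + (cos_partial_sum (N + k) x - u x)) by ring.
  eapply Rle_trans; [apply Rabs_triang|]. rewrite Rabs_Ropp. unfold Rdiv in *. lra.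
Qed.
End FourierCosine.

(** * Resonances and rigidity *)

Lemma character_sum_trivial (q m : nat) :
  (1 <= q)%nat -> sumR q (fun j => cos (2 * PI * INR (m * q) / INR q * INR j)) = INR q.
Proof.
  intros Hq. assert (0 < INR q) by (apply lt_0_INR; lia).
  rewrite (sumR_ext q _ (fun _ => 1)); [rewrite sumR_const; ring|].
  intros j _. rewrite mult_INR.
  replace (2 * PI * (INR m * INR q) / INR q * INR j) with (0 + 2 * INR (m * j) * PI)
    by (rewrite mult_INR; field; lra).
  rewrite cos_period. apply cos_0.
Qed.

Lemma character_sum_nontrivial (q m r : nat) :
  (1 <= r < q)%nat -> sumR q (fun j => cos (2 * PI * INR (m * q + r) / INR q * INR j)) = 0.
Proof.
  intros Hr. assert (Hq : 0 < INR q) by (apply lt_0_INR; lia).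
  set (alpha := 2 * PI * INR (m * q + r) / INR q).
  assert (Hs : sin (alpha / 2) <> 0).
  { intros E.
    assert (R1 : 1 <= INR r) by (change 1 with (INR 1); apply le_INR; lia).
    assert (R2 : INR r < INR q) by (apply lt_INR; lia).
    replace (alpha / 2) with (INR m * PI + PI * (INR r / INR q)) in E
      by (unfold alpha; rewrite plus_INR, mult_INR; field; lra).
    assert (0 < INR r / INR q < 1).
    { split; [apply Rdiv_lt_0_compat; lra|]. apply (Rmult_lt_reg_r (INR q)); auto.
      unfold Rdiv; rewrite Rmult_assoc, Rinv_l; lra. }
    pose proof (sin_PI_lower (INR r / INR q) ltac:(lra)).
    pose proof (Rabs_sin_shift m (PI * (INR r / INR q))) as E2.
    rewrite E, Rabs_R0 in E2. pose proof (Rle_abs (sin (PI * (INR r / INR q)))). nra. }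
  pose proof (char_sum_bound q alpha 0 0 (fun _ => 1) Hs) as B.
  rewrite (sumR_ext q _ (fun j => cos (alpha * INR j + 0) * 1)) by (intros; rewrite Rplus_0_r; ring).
  cut (Rabs (sumR q (fun j => cos (alpha * INR j + 0) * 1)) <= 0).
  { intros H. pose proof (Rabs_pos (sumR q (fun j => cos (alpha * INR j + 0) * 1))).
    destruct (Req_dec (sumR q (fun j => cos (alpha * INR j + 0) * 1)) 0) as [|N]; auto.
    apply Rabs_pos_lt in N. lra. }
  eapply Rle_trans; [apply B|].
  - exists (Z.of_nat (m * q + r)). rewrite <- INR_IZR_INZ. unfold alpha. field; lra.
  - auto.
  - intros. rewrite Rminus_diag, Rabs_R0; lra.
  - unfold Rdiv. rewrite Rmult_0_r, Rmult_0_l; lra.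
Qed.

(** The term [1 / 4] is split off before telescoping: comparing the whole sum with [1 / (m (m - 1))]
    would give 1, which is no contraction. *)
Lemma inv_square_tail_le n : sumR n (fun i => / INR (S (S i)) ^ 2) <= 3 / 4.
Proof.
  destruct n as [|n]; [simpl; lra|].
  change (S n) with (1 + n)%nat. rewrite sumR_add. cbn [sumR].
  assert (T : sumR n (fun i => / INR (S (S (1 + i))) ^ 2) <= / 2 - / INR (S (S n))).
  { induction n as [|n IH]; [simpl; lra|]. cbn [sumR].
    change (S (S (1 + n))) with (S (S (S n))). rewrite (S_INR (S (S n))).
    assert (2 <= INR (S (S n))) by (rewrite !S_INR; pose proof (pos_INR n); lra).
    set (a := INR (S (S n))) in *.
    assert (/ (a+1) ^ 2 <= / a - / (a + 1)).
    { replace (/ a - / (a+1)) with (/ (a * (a+1))) by (field; lra). apply Rinv_le_contravar; nra. }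
    lra. }
  assert (0 < / INR (S (S n))) by (apply Rinv_0_lt_compat, lt_0_INR; lia).
  replace (INR 2) with 2 by (simpl; ring). lra.
Qed.

Section Rigidity.
Variables u u1 u2 : R -> R.
Hypothesis Du : forall t, is_derive u t (u1 t).
Hypothesis Du1 : forall t, is_derive u1 t (u2 t).
Hypothesis Cu2 : forall t, continuous u2 t.
Hypothesis Per : forall t, u (t + 1) = u t.
Hypothesis Even : forall t, u (- t) = u t.
Hypothesis Mean : RInt u 0 1 = 0.

Let a := cos_coeff u.

(** Every error is kept proportional to [A], because [A] becomes the supremum of the left-hand
    sides: the nodes cost [200 sqrt eps], the weights [2 eps], and the truncation a term that
    vanishes as [n] grows. *)
Lemma coeff_resonance_bound (A eps : R) (q : nat) (x w : nat -> R) (n : nat) :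
  (forall l, (1 <= l)%nat -> INR l ^ 2 * Rabs (a l) <= A) ->
  0 <= eps <= 1 -> (1 <= q)%nat -> x O = 0 -> x q = 1 ->
  (forall j, (j < q)%nat -> Rabs (x (S j) - x j - / INR q) <= eps / INR q ^ 3) ->
  (forall j, (j < q)%nat -> Rabs (w j - 1) <= eps / INR q ^ 2) ->
  sumR q (fun j => u (x j) * w j) = 0 ->
  Rabs (a q) * INR q ^ 2 <= A * (3 / 4 + 202 * sqrt eps) + A * INR q / INR (S n).
Proof.
  intros HA Heps Hq Hx0 Hxq Hx Hw Hsum.
  set (Q := INR q). assert (HQ : 1 <= Q) by (unfold Q; change 1 with (INR 1); now apply le_INR).
  assert (A0 : 0 <= A).
  { eapply Rle_trans; [|apply (HA 1%nat); lia]. apply Rmult_le_pos; [apply pow2_ge_0|apply Rabs_pos]. }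
  (* Truncating at a multiple of [q] splits the frequencies into complete blocks, each with exactly
     one resonance. *)
  set (N := (S n * q)%nat).
  assert (HN : (1 <= N)%nat) by (unfold N; nia).
  assert (EN : INR N = INR (S n) * Q) by (unfold N; now rewrite mult_INR).
  assert (Hn : 1 <= INR (S n)) by (rewrite S_INR; pose proof (pos_INR n); lra).
  set (S_ := cos_partial_sum u N).
  assert (Herr : forall t, Rabs (S_ t - u t) <= A / INR N).
  { intros t. now apply (cos_partial_sum_error u u1 u2 Du Du1 Cu2 Per Even Mean). }
  (* The partial sum with a single term already gives this: [|a 1| <= A], and the error is at most
     [A]. *)
  assert (Hu : forall t, Rabs (u t) <= 2 * A).
  { intros t. pose proof (cos_partial_sum_error u u1 u2 Du Du1 Cu2 Per Even Mean A 1 t HA ltac:(lia)) as B.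
    unfold cos_partial_sum in B. cbn [sumR] in B. rewrite Rplus_0_l in B. fold a in B.
    pose proof (HA 1%nat ltac:(lia)) as H1. simpl INR in B, H1. rewrite pow1, Rmult_1_l in H1.
    unfold Rdiv in B; rewrite Rinv_1, Rmult_1_r in B.
    set (cc := cos _) in B. assert (Rabs cc <= 1) by (apply Rabs_le, COS_bound).
    replace (u t) with (a 1%nat * cc + - (a 1%nat * cc - u t)) by ring.
    eapply Rle_trans; [apply Rabs_triang|]. rewrite Rabs_Ropp, Rabs_mult.
    pose proof (Rabs_pos (a 1%nat)). pose proof (Rabs_pos cc). nra. }
  assert (Hu_avg : Rabs (sumR q (fun j => u (x j))) <= Q * (2 * A * (eps / Q ^ 2))).
  { replace (sumR q (fun j => u (x j))) with (sumR q (fun j => - (u (x j) * (w j - 1)))).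
    - eapply Rle_trans; [apply sumR_abs|]. unfold Q; rewrite <- sumR_const. fold Q. apply sumR_le.
      intros j Hj. rewrite Rabs_Ropp, Rabs_mult. apply Rmult_le_compat; try apply Rabs_pos; auto.
    - rewrite (sumR_ext q _ (fun j => u (x j) - u (x j) * w j)) by (intros; ring).
      rewrite sumR_minus, Hsum. ring. }
  assert (HS_avg : Rabs (sumR q (fun j => S_ (x j))) <= Q * (2 * A * (eps / Q ^ 2)) + Q * (A / INR N)).
  { rewrite (sumR_ext q _ (fun j => u (x j) + (S_ (x j) - u (x j)))) by (intros; ring).
    rewrite sumR_plus. eapply Rle_trans; [apply Rabs_triang|]. apply Rplus_le_compat; auto.
    eapply Rle_trans; [apply sumR_abs|]. unfold Q; rewrite <- sumR_const. apply sumR_le; auto. }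
  set (D := alias_defect q x).
  assert (Esum : sumR q (fun j => S_ (x j)) =
     Q * sumR (S n) (fun i => a (S i * q)%nat) + Q * sumR N (fun l => a (S l) * D (S l))).
  { unfold S_, cos_partial_sum. rewrite sumR_swap. fold a.
    rewrite (sumR_ext N _ (fun l => a (S l) * sumR q (fun j => cos (2 * PI * INR (S l) / Q * INR j))
                                  + Q * (a (S l) * D (S l)))).
    2:{ intros l _. rewrite sumR_scal. unfold D, alias_defect. fold Q.
        rewrite sumR_minus. field. lra. }
    rewrite sumR_plus, sumR_scal. f_equal.
    unfold N. rewrite sumR_mul, <- sumR_scal. apply sumR_ext. intros i _.
    assert (Eq : exists q', q = S q') by (exists (q - 1)%nat; lia). destruct Eq as [q' Eq].
    transitivity (sumR (S q') (fun r => a (S (i * q + r)) *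
       sumR q (fun j => cos (2 * PI * INR (S (i * q + r)) / Q * INR j)))); [now rewrite <- Eq|].
    (* The frequencies are [S (i * q + r)], so the multiple of [q] closes a block instead of opening
       it. *)
    cbn [sumR]. rewrite (sumR_0 q').
    - replace (S (i * q + q')) with (S i * q)%nat by nia.
      unfold Q at 1. rewrite character_sum_trivial by auto. fold Q. ring.
    - intros r Hr. replace (S (i * q + r)) with (i * q + S r)%nat by lia.
      unfold Q. rewrite character_sum_nontrivial by lia. ring. }
  assert (HD : Rabs (sumR N (fun l => a (S l) * D (S l))) <= A * (200 * sqrt eps / Q ^ 2)).
  { eapply Rle_trans; [apply sumR_abs|].
    pose proof (alias_sum_bound q eps x Hq Heps Hx0 Hxq Hx (1 + N)) as B.
    rewrite sumR_add in B. cbn [sumR] in B. fold D Q in B.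
    eapply Rle_trans; [apply sumR_le_scal with (c := A) (g := fun i => Rabs (D (1 + i)%nat) / INR (1 + i) ^ 2)|].
    - intros l _. rewrite Rabs_mult. change (1 + l)%nat with (S l).
      pose proof (HA (S l) ltac:(lia)) as Hl.
      assert (0 < INR (S l) ^ 2) by (apply pow_lt, lt_0_INR; lia).
      apply (Rmult_le_reg_r (INR (S l) ^ 2)); auto.
      replace (A * (Rabs (D (S l)) / INR (S l) ^ 2) * INR (S l) ^ 2) with (A * Rabs (D (S l))) by (field; apply not_0_INR; lia).
      pose proof (Rabs_pos (D (S l))). nra.
    - apply Rmult_le_compat_l; auto.
      assert (0 <= Rabs (D 0%nat) / INR 0 ^ 2).
      { unfold D, alias_defect. rewrite sumR_0; [unfold Rdiv; rewrite Rmult_0_l, Rabs_R0; lra|].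
        intros j _. simpl. unfold Rdiv. rewrite !Rmult_0_r, !Rmult_0_l. ring. }
      lra. }
  assert (Hmain : Rabs (sumR (S n) (fun i => a (S i * q)%nat)) <=
     2 * A * (eps / Q ^ 2) + A / INR N + A * (200 * sqrt eps / Q ^ 2)).
  { set (X := sumR (S n) _) in *. set (Y := sumR N (fun l => a (S l) * D (S l))) in *.
    assert (HXY : Rabs (X + Y) <= 2 * A * (eps / Q ^ 2) + A / INR N).
    { apply (Rmult_le_reg_l Q); [lra|]. rewrite <- (Rabs_right Q) at 1 by lra. rewrite <- Rabs_mult.
      rewrite Rmult_plus_distr_l, <- Esum. eapply Rle_trans; [apply HS_avg|]. right; ring. }
    replace X with (X + Y + - Y) by ring. eapply Rle_trans; [apply Rabs_triang|].
    rewrite Rabs_Ropp. lra. }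
  change (S n) with (1 + n)%nat in Hmain. rewrite sumR_add in Hmain. cbn [sumR] in Hmain.
  assert (HT : Rabs (sumR n (fun i => a (S (1 + i) * q)%nat)) <= A / Q ^ 2 * (3 / 4)).
  { eapply Rle_trans; [apply sumR_abs|].
    eapply Rle_trans; [apply sumR_le_scal with (c := A / Q ^ 2) (g := fun i => / INR (S (S i)) ^ 2)|].
    - intros i _. change (S (1 + i)) with (S (S i)).
      pose proof (HA (S (S i) * q)%nat ltac:(nia)) as Hl. rewrite mult_INR in Hl. fold Q in Hl.
      assert (0 < INR (S (S i))) by (apply lt_0_INR; lia).
      apply (Rmult_le_reg_l ((INR (S (S i)) * Q) ^ 2)); [apply pow_lt; nra|].
      eapply Rle_trans; [apply Hl|]. right; field; lra.
    - apply Rmult_le_compat_l; [apply Rdiv_le_0_compat; [auto|apply pow_lt; lra]|apply inv_square_tail_le]. }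
  replace (1 * q)%nat with q in Hmain by lia.
  replace (S 0 * q)%nat with q in Hmain by lia. rewrite Rplus_0_l in Hmain.
  set (T := sumR n _) in *.
  assert (Haq : Rabs (a q) <= 2 * A * (eps / Q ^ 2) + A / INR N + A * (200 * sqrt eps / Q ^ 2) + A / Q ^ 2 * (3 / 4)).
  { replace (a q) with (a q + T + - T) by ring. eapply Rle_trans; [apply Rabs_triang|].
    rewrite Rabs_Ropp. lra. }
  apply (Rmult_le_compat_r (Q ^ 2)) in Haq; [|apply pow_le; lra].
  rewrite EN in Haq.
  assert (eps <= sqrt eps).
  { rewrite <- (sqrt_sqrt eps) at 1 by lra. assert (0 <= sqrt eps) by apply sqrt_pos.
    assert (sqrt eps <= 1) by (rewrite <- sqrt_1; apply sqrt_le_1_alt; lra). nra. }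
  eapply Rle_trans; [apply Haq|].
  replace ((2 * A * (eps / Q ^ 2) + A / (INR (S n) * Q) + A * (200 * sqrt eps / Q ^ 2) + A / Q ^ 2 * (3 / 4)) * Q ^ 2)
    with (A * (2 * eps + 200 * sqrt eps + 3 / 4) + A * Q / INR (S n)) by (field; lra).
  apply Rplus_le_compat_r, Rmult_le_compat_l; auto. lra.
Qed.
End Rigidity.

Lemma almost_equidistributed_rigidity (eps : R) (u u1 u2 : R -> R) :
  0 <= eps <= / 4000000 ->
  (forall t, is_derive u t (u1 t)) -> (forall t, is_derive u1 t (u2 t)) ->
  (forall t, continuous u2 t) ->
  (forall t, u (t + 1) = u t) -> (forall t, u (- t) = u t) ->
  RInt u 0 1 = 0 -> u 0 = 0 ->
  (forall q, (2 <= q)%nat -> exists x w : nat -> R,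
     x O = 0 /\ x q = 1 /\
     (forall j, (j < q)%nat -> Rabs (x (S j) - x j - / INR q) <= eps / INR q ^ 3) /\
     (forall j, (j < q)%nat -> Rabs (w j - 1) <= eps / INR q ^ 2) /\
     sumR q (fun j => u (x j) * w j) = 0) ->
  forall t, u t = 0.
Proof.
  intros Heps Du Du1 Cu2 Per Even Mean H0 Hq t.
  destruct (cos_coeff_decay u u1 u2 Du Du1 Cu2 Per) as [M HM].
  set (a := cos_coeff u) in *.
  set (E := fun z => exists l, (1 <= l)%nat /\ z = INR l ^ 2 * Rabs (a l)).
  destruct (completeness E) as [A [HA1 HA2]].
  { exists M. intros z [l [Hl ->]]. now apply HM. }
  { exists (INR 1 ^ 2 * Rabs (a 1%nat)). exists 1%nat; split; [lia|reflexivity]. }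
  assert (HA : forall l, (1 <= l)%nat -> INR l ^ 2 * Rabs (a l) <= A).
  { intros l Hl. apply HA1. now exists l. }
  assert (A0 : 0 <= A).
  { eapply Rle_trans; [|apply (HA 1%nat); lia]. apply Rmult_le_pos; [apply pow2_ge_0|apply Rabs_pos]. }
  (* The threshold on [eps] is chosen for [3 / 4 + 202 / 2000 < 9 / 10]. *)
  assert (Hse : sqrt eps <= / 2000).
  { replace (/ 2000) with (sqrt (/ 4000000)); [apply sqrt_le_1_alt; lra|].
    replace (/ 4000000) with ((/2000) ^ 2) by lra. apply sqrt_pow2; lra. }
  assert (Hle : A <= 9 / 10 * A).
  { apply HA2. intros z [q [Hq1 ->]].
    assert (Hd : exists x w : nat -> R,
     x O = 0 /\ x q = 1 /\
     (forall j, (j < q)%nat -> Rabs (x (S j) - x j - / INR q) <= eps / INR q ^ 3) /\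
     (forall j, (j < q)%nat -> Rabs (w j - 1) <= eps / INR q ^ 2) /\
     sumR q (fun j => u (x j) * w j) = 0).
    (* For [q = 1] the nodes 0 and 1 are exactly equidistributed and the sum is [u 0]. *)
    { destruct (Nat.eq_dec q 1) as [->|]; [|apply Hq; lia].
      exists INR, (fun _ => 1). simpl INR. repeat split; auto.
      - intros j Hj. replace j with 0%nat by lia. simpl INR.
        replace (1 - 0 - / 1) with 0 by field. rewrite Rabs_R0, pow1. unfold Rdiv; rewrite Rinv_1; lra.
      - intros j Hj. rewrite Rminus_diag, Rabs_R0, pow1. unfold Rdiv; rewrite Rinv_1; lra.
      - simpl. rewrite H0. ring. }
    destruct Hd as (x & w & X0 & Xq & HX & HW & HS).
    apply le_epsilon. intros e He.
    assert (Q1 : 1 <= INR q) by (change 1 with (INR 1); now apply le_INR).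
    destruct (INR_unbounded (A * INR q / e)) as [n Hn].
    pose proof (coeff_resonance_bound u u1 u2 Du Du1 Cu2 Per Even Mean A eps q x w n HA
      ltac:(lra) Hq1 X0 Xq HX HW HS) as B. fold a in B.
    assert (Hs : 0 < INR (S n)) by (apply lt_0_INR; lia).
    assert (A * INR q / INR (S n) <= e).
    { apply (Rmult_le_reg_r (INR (S n))); auto. unfold Rdiv in *. rewrite Rmult_assoc, Rinv_l, Rmult_1_r by lra.
      apply (Rmult_lt_compat_r e) in Hn; auto. rewrite Rmult_assoc, Rinv_l, Rmult_1_r in Hn by lra.
      rewrite S_INR. nra. }
    rewrite Rmult_comm. nra. }
  assert (A = 0) by lra. subst A.
  assert (Ha : forall l, (1 <= l)%nat -> a l = 0).
  { intros l Hl. specialize (HA l Hl).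
    assert (0 < INR l ^ 2) by (apply pow_lt, lt_0_INR; lia).
    destruct (Req_dec (a l) 0) as [|Ne]; auto. apply Rabs_pos_lt in Ne. nra. }
  pose proof (cos_partial_sum_error u u1 u2 Du Du1 Cu2 Per Even Mean 0 1 t HA ltac:(lia)) as B.
  unfold cos_partial_sum in B. cbn [sumR] in B. fold a in B. rewrite Ha in B by lia.
  rewrite Rmult_0_l, Rplus_0_l, Rminus_0_l, Rabs_Ropp in B. unfold Rdiv in B. rewrite Rmult_0_l in B.
  destruct (Req_dec (u t) 0) as [|Ne]; auto. apply Rabs_pos_lt in Ne. lra.
Qed.

(** * Families of functions C^n-close to a model *)

Section Close.
Variables (I : Type) (dl : I -> R) (a : R).

(* The families [F] and [F0] have [n] derivatives on [|h| < a], bounded uniformly in the parameter [p], and those of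
   [F] are [O(dl p)]-close to those of [F0].  The constants are left existential, so that closure under the
   operations of analysis is proved by induction on [n] alone. *)
Fixpoint close (V : I -> Prop) (n : nat) (F F0 : I -> R -> R) : Prop :=
  (exists C, 0 <= C /\ forall p, V p -> forall h, Rabs h < a ->
     Rabs (F p h) <= C /\ Rabs (F0 p h) <= C /\ Rabs (F p h - F0 p h) <= C * dl p) /\
  match n with
  | O => True
  | S m => exists F' F0' : I -> R -> R,
      (forall p, V p -> forall h, Rabs h < a ->
         is_derive (F p) h (F' p h) /\ is_derive (F0 p) h (F0' p h)) /\
      close V m F' F0'
  end.

Variable V : I -> Prop.
Hypothesis dl01 : forall p, V p -> 0 <= dl p <= 1.

Lemma close_bound n F F0 : close V n F F0 ->
  exists C, 0 <= C /\ forall p, V p -> forall h, Rabs h < a ->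
     Rabs (F p h) <= C /\ Rabs (F0 p h) <= C /\ Rabs (F p h - F0 p h) <= C * dl p.
Proof. destruct n; intros [H _]; exact H. Qed.

Lemma close_pred n F F0 : close V (S n) F F0 -> close V n F F0.
Proof.
  revert F F0; induction n as [|n IH]; intros F F0 H.
  - destruct H as [H _]; split; auto; exact Logic.I.
  - destruct H as [H (F' & F0' & D & H')]. split; auto. exists F', F0'; split; auto.
Qed.

Lemma close_le m n F F0 : (m <= n)%nat -> close V n F F0 -> close V m F F0.
Proof. intros L; induction L; auto. intros H; apply IHL, close_pred, H. Qed.

Lemma close_shrink (W : I -> Prop) n F F0 :
  (forall p, W p -> V p) -> close V n F F0 -> close W n F F0.
Proof.
  intros HW; revert F F0; induction n as [|n IH]; intros F F0 [[C [HC H]] H'].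
  - split; auto. exists C; split; auto.
  - destruct H' as (F' & F0' & D & H'). split; [exists C; split; auto|].
    exists F', F0'; split; auto.
Qed.

Lemma locally_abs_lt h : Rabs h < a -> locally h (fun z => Rabs z < a).
Proof.
  intros Hh.
  assert (T : forall z : R, Rabs (z - h) < a - Rabs h -> Rabs z < a).
  { intros z Hz. pose proof (Rabs_triang (z - h) h).
    replace (z - h + h) with z in H by ring. lra. }
  exists (mkposreal (a - Rabs h) ltac:(lra)). intros z Hz. apply T, Hz.
Qed.

Lemma close_ext n F F0 G G0 :
  (forall p, V p -> forall h, Rabs h < a -> F p h = G p h /\ F0 p h = G0 p h) ->
  close V n F F0 -> close V n G G0.
Proof.
  intros E H. assert (B := close_bound _ _ _ H). destruct B as [C [HC B]].
  assert (B' : exists C, 0 <= C /\ forall p, V p -> forall h, Rabs h < a ->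
     Rabs (G p h) <= C /\ Rabs (G0 p h) <= C /\ Rabs (G p h - G0 p h) <= C * dl p).
  { exists C; split; auto. intros p Hp h Hh. destruct (E p Hp h Hh) as [<- <-]. auto. }
  destruct n as [|n]; [split; [exact B'|exact Logic.I]|].
  destruct H as [_ (F' & F0' & D & H')]. split; [exact B'|]. exists F', F0'; split; auto.
  intros p Hp h Hh. destruct (D p Hp h Hh) as [D1 D2].
  split; eapply is_derive_ext_loc; eauto; (eapply filter_imp; [|apply locally_abs_lt, Hh]);
    intros z Hz; apply (E p Hp z Hz).
Qed.

Lemma close_const n (c c0 : I -> R) C :
  (forall p, V p -> Rabs (c p) <= C /\ Rabs (c0 p) <= C /\ Rabs (c p - c0 p) <= C * dl p) ->
  close V n (fun p _ => c p) (fun p _ => c0 p).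
Proof.
  revert c c0 C; induction n as [|n IH]; intros c c0 C H;
    (split; [exists (Rabs C); split; [apply Rabs_pos|]; intros p Hp h _;
       destruct (H p Hp) as (A1 & A2 & A3); destruct (dl01 p Hp); pose proof (Rle_abs C);
       repeat split; nra|]); [exact Logic.I|].
  exists (fun _ _ => 0), (fun _ _ => 0). split.
  - intros; split; apply derive_const.
  - apply (IH (fun _ => 0) (fun _ => 0) 0). intros p _. rewrite Rminus_diag, Rabs_R0. lra.
Qed.

Lemma close_cst n (c : R) : close V n (fun _ _ => c) (fun _ _ => c).
Proof.
  apply (close_const n (fun _ => c) (fun _ => c) (Rabs c)). intros p Hp.
  rewrite Rminus_diag, Rabs_R0. destruct (dl01 p Hp). pose proof (Rabs_pos c).
  repeat split; try lra. nra.
Qed.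

Lemma close_plus n F F0 G G0 : close V n F F0 -> close V n G G0 ->
  close V n (fun p h => F p h + G p h) (fun p h => F0 p h + G0 p h).
Proof.
  revert F F0 G G0; induction n as [|n IH]; intros F F0 G G0 [[C [HC H]] H'] [[D [HD K]] K'];
  (split; [exists (C + D); split; [lra|]; intros p Hp h Hh;
     destruct (H p Hp h Hh) as (A1 & A2 & A3); destruct (K p Hp h Hh) as (B1 & B2 & B3);
     pose proof (Rabs_triang (F p h) (G p h)); pose proof (Rabs_triang (F0 p h) (G0 p h));
     pose proof (Rabs_triang (F p h - F0 p h) (G p h - G0 p h));
     replace (F p h + G p h - (F0 p h + G0 p h)) with (F p h - F0 p h + (G p h - G0 p h)) by ring;
     repeat split; lra|]); [exact Logic.I|].
  destruct H' as (F' & F0' & DF & H'). destruct K' as (G' & G0' & DG & K').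
  exists (fun p h => F' p h + G' p h), (fun p h => F0' p h + G0' p h). split; auto.
  intros p Hp h Hh. destruct (DF p Hp h Hh), (DG p Hp h Hh).
  split; now apply derive_plus.
Qed.

Lemma close_mult n F F0 G G0 : close V n F F0 -> close V n G G0 ->
  close V n (fun p h => F p h * G p h) (fun p h => F0 p h * G0 p h).
Proof.
  revert F F0 G G0; induction n as [|n IH]; intros F F0 G G0 HF HG;
  pose proof HF as [[C [HC H]] H']; pose proof HG as [[D [HD K]] K'];
  (split; [exists (2 * (C * D)); split; [nra|]; intros p Hp h Hh;
     destruct (H p Hp h Hh) as (A1 & A2 & A3); destruct (K p Hp h Hh) as (B1 & B2 & B3);
     destruct (dl01 p Hp);
     replace (F p h * G p h - F0 p h * G0 p h)
       with ((F p h - F0 p h) * G p h + F0 p h * (G p h - G0 p h)) by ring;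
     pose proof (Rabs_triang ((F p h - F0 p h) * G p h) (F0 p h * (G p h - G0 p h)));
     rewrite !Rabs_mult in *;
     pose proof (Rabs_pos (F p h)); pose proof (Rabs_pos (F0 p h));
     pose proof (Rabs_pos (G p h)); pose proof (Rabs_pos (G0 p h));
     pose proof (Rabs_pos (F p h - F0 p h)); pose proof (Rabs_pos (G p h - G0 p h));
     assert (Rabs (F p h - F0 p h) * Rabs (G p h) <= (C * dl p) * D) by (apply Rmult_le_compat; auto);
     assert (Rabs (F0 p h) * Rabs (G p h - G0 p h) <= C * (D * dl p)) by (apply Rmult_le_compat; auto);
     assert (Rabs (F p h) * Rabs (G p h) <= C * D) by (apply Rmult_le_compat; auto);
     assert (Rabs (F0 p h) * Rabs (G0 p h) <= C * D) by (apply Rmult_le_compat; auto);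
     assert (0 <= C * D) by nra;
     repeat split; lra|]); [exact Logic.I|].
  destruct H' as (F' & F0' & DF & H'). destruct K' as (G' & G0' & DG & K').
  exists (fun p h => F' p h * G p h + F p h * G' p h), (fun p h => F0' p h * G0 p h + F0 p h * G0' p h).
  split.
  - intros p Hp h Hh. destruct (DF p Hp h Hh), (DG p Hp h Hh).
    split; (apply (is_derive_mult (K:=R_AbsRing)); auto; intros; apply Rmult_comm).
  - apply close_plus; apply IH; auto; now apply close_pred.
Qed.

Lemma close_scal n c F F0 : close V n F F0 ->
  close V n (fun p h => c * F p h) (fun p h => c * F0 p h).
Proof. intros H. apply (close_mult n (fun _ _ => c) (fun _ _ => c)); [apply close_cst|exact H]. Qed.

Lemma close_minus n F F0 G G0 : close V n F F0 -> close V n G G0 ->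
  close V n (fun p h => F p h - G p h) (fun p h => F0 p h - G0 p h).
Proof.
  intros HF HG. eapply close_ext; [|apply close_plus; [exact HF|apply (close_scal n (-1)), HG]].
  intros; split; simpl; ring.
Qed.

Lemma close_inv n F F0 m : 0 < m ->
  (forall p, V p -> forall h, Rabs h < a -> m <= F p h /\ m <= F0 p h) ->
  close V n F F0 -> close V n (fun p h => / F p h) (fun p h => / F0 p h).
Proof.
  intros Hm HB. revert F F0 HB; induction n as [|n IH]; intros F F0 HB HF;
  pose proof HF as [[C [HC H]] H'];
  (split; [exists (/ m + C * / m * / m); split;
      [assert (0 < / m) by (now apply Rinv_0_lt_compat); apply Rplus_le_le_0_compat; [lra|]; apply Rmult_le_pos; [nra|lra]|];
     intros p Hp h Hh; destruct (H p Hp h Hh) as (A1 & A2 & A3); destruct (HB p Hp h Hh) as [M1 M2];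
     destruct (dl01 p Hp);
     assert (0 < / m) by (now apply Rinv_0_lt_compat);
     assert (0 < / F p h <= / m) by (split; [apply Rinv_0_lt_compat; lra|apply Rinv_le_contravar; lra]);
     assert (0 < / F0 p h <= / m) by (split; [apply Rinv_0_lt_compat; lra|apply Rinv_le_contravar; lra]);
     assert (0 <= C * / m * / m) by (apply Rmult_le_pos; [nra|lra]);
     replace (/ F p h - / F0 p h) with (- (F p h - F0 p h) * / F p h * / F0 p h) by (field; lra);
     rewrite !Rabs_mult, Rabs_Ropp, (Rabs_right (/ F p h)), (Rabs_right (/ F0 p h)) by lra;
     assert (Rabs (F p h - F0 p h) * / F p h * / F0 p h <= C * dl p * / m * / m)
       by (apply Rmult_le_compat; try lra; [apply Rmult_le_pos; [apply Rabs_pos|lra]|];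
           apply Rmult_le_compat; try lra; apply Rabs_pos);
     repeat split; nra|]); [exact Logic.I|].
  destruct H' as (F' & F0' & DF & H').
  exists (fun p h => (-1 * F' p h) * (/ F p h * / F p h)), (fun p h => (-1 * F0' p h) * (/ F0 p h * / F0 p h)).
  split.
  - intros p Hp h Hh. destruct (DF p Hp h Hh) as [D1 D2], (HB p Hp h Hh).
    split; [replace (-1 * F' p h * (/ F p h * / F p h)) with (- F' p h / F p h ^ 2) by (field; lra)
           |replace (-1 * F0' p h * (/ F0 p h * / F0 p h)) with (- F0' p h / F0 p h ^ 2) by (field; lra)];
      apply is_derive_inv; auto; lra.
  - pose proof (IH F F0 HB (close_pred _ _ _ HF)) as HI.
    apply close_mult; [now apply close_scal|now apply close_mult].
Qed.

Lemma close_sqrt n F F0 m : 0 < m ->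
  (forall p, V p -> forall h, Rabs h < a -> m <= F p h /\ m <= F0 p h) ->
  close V n F F0 -> close V n (fun p h => sqrt (F p h)) (fun p h => sqrt (F0 p h)).
Proof.
  intros Hm HB. assert (Hsm : 0 < sqrt m) by now apply sqrt_lt_R0.
  assert (HBs : forall p, V p -> forall h, Rabs h < a -> sqrt m <= sqrt (F p h) /\ sqrt m <= sqrt (F0 p h)).
  { intros p Hp h Hh. destruct (HB p Hp h Hh). split; apply sqrt_le_1_alt; auto. }
  assert (Base : close V 0 F F0 -> close V 0 (fun p h => sqrt (F p h)) (fun p h => sqrt (F0 p h))).
  { intros [[C [HC H]] _]. split; [|exact Logic.I].
    exists (1 + C + C * / sqrt m). assert (0 < / sqrt m) by (now apply Rinv_0_lt_compat).
    assert (0 <= C * / sqrt m) by nra.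
    split; [lra|]. intros p Hp h Hh.
    destruct (H p Hp h Hh) as (A1 & A2 & A3). destruct (HB p Hp h Hh) as [M1 M2].
    destruct (HBs p Hp h Hh) as [S1 S2]. destruct (dl01 p Hp).
    assert (Q1 : sqrt (F p h) * sqrt (F p h) = F p h) by (apply sqrt_sqrt; lra).
    assert (Q2 : sqrt (F0 p h) * sqrt (F0 p h) = F0 p h) by (apply sqrt_sqrt; lra).
    pose proof (Rle_abs (F p h)). pose proof (Rle_abs (F0 p h)).
    set (r := sqrt (F p h)) in *. set (r0 := sqrt (F0 p h)) in *.
    rewrite (Rabs_right r), (Rabs_right r0) by lra.
    assert (Rabs (r - r0) <= C * dl p * / sqrt m).
    { apply (Rmult_le_reg_r (sqrt m)); auto. rewrite Rmult_assoc, Rinv_l, Rmult_1_r by lra.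
      eapply Rle_trans; [|apply A3].
      replace (F p h - F0 p h) with ((r - r0) * (r + r0)) by lra.
      rewrite Rabs_mult, (Rabs_right (r + r0)) by lra.
      apply Rmult_le_compat_l; [apply Rabs_pos|lra]. }
    repeat split; nra. }
  induction n as [|n IH]; intros HF; [auto|].
  pose proof HF as [_ (F' & F0' & DF & H')].
  split; [exact (close_bound _ _ _ (Base (close_le 0 (S n) _ _ ltac:(lia) HF)))|].
  exists (fun p h => F' p h * (/ 2 * / sqrt (F p h))), (fun p h => F0' p h * (/ 2 * / sqrt (F0 p h))).
  split.
  - intros p Hp h Hh. destruct (DF p Hp h Hh) as [D1 D2], (HB p Hp h Hh), (HBs p Hp h Hh).
    split; [replace (F' p h * (/ 2 * / sqrt (F p h))) with (F' p h / (2 * sqrt (F p h))) by (field; lra)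
           |replace (F0' p h * (/ 2 * / sqrt (F0 p h))) with (F0' p h / (2 * sqrt (F0 p h))) by (field; lra)];
      apply is_derive_sqrt; auto; lra.
  - apply close_mult; auto. apply close_scal. apply (close_inv n _ _ (sqrt m)); auto.
    apply IH, close_pred, HF.
Qed.

Lemma close_sin_cos n F F0 : close V n F F0 ->
  close V n (fun p h => sin (F p h)) (fun p h => sin (F0 p h)) /\
  close V n (fun p h => cos (F p h)) (fun p h => cos (F0 p h)).
Proof.
  revert F F0; induction n as [|n IH]; intros F F0 HF; pose proof HF as [[C [HC H]] H'];
  (assert (B : (exists C, 0 <= C /\ forall p, V p -> forall h, Rabs h < a ->
     Rabs (sin (F p h)) <= C /\ Rabs (sin (F0 p h)) <= C /\ Rabs (sin (F p h) - sin (F0 p h)) <= C * dl p) /\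
     (exists C, 0 <= C /\ forall p, V p -> forall h, Rabs h < a ->
     Rabs (cos (F p h)) <= C /\ Rabs (cos (F0 p h)) <= C /\ Rabs (cos (F p h) - cos (F0 p h)) <= C * dl p));
   [split; exists (1 + C); (split; [lra|]); intros p Hp h Hh; destruct (H p Hp h Hh) as (A1 & A2 & A3);
    destruct (dl01 p Hp);
    [pose proof (Rabs_sin_diff (F p h) (F0 p h));
     assert (Rabs (sin (F p h)) <= 1) by (apply Rabs_le, SIN_bound);
     assert (Rabs (sin (F0 p h)) <= 1) by (apply Rabs_le, SIN_bound)
    |pose proof (Rabs_cos_diff (F p h) (F0 p h));
     assert (Rabs (cos (F p h)) <= 1) by (apply Rabs_le, COS_bound);
     assert (Rabs (cos (F0 p h)) <= 1) by (apply Rabs_le, COS_bound)]; repeat split; nra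
   |destruct B as [Bs Bc]]).
  - split; split; auto; exact Logic.I.
  - destruct H' as (F' & F0' & DF & H').
    destruct (IH F F0 (close_pred _ _ _ HF)) as [IS IC].
    split; (split; [assumption|]).
    + exists (fun p h => F' p h * cos (F p h)), (fun p h => F0' p h * cos (F0 p h)). split.
      * intros p Hp h Hh. destruct (DF p Hp h Hh) as [D1 D2].
        split; [apply (is_derive_comp sin (F p))|apply (is_derive_comp sin (F0 p))]; auto;
          apply is_derive_Reals, derivable_pt_lim_sin.
      * now apply close_mult.
    + exists (fun p h => F' p h * (-1 * sin (F p h))), (fun p h => F0' p h * (-1 * sin (F0 p h))). split.
      * intros p Hp h Hh. destruct (DF p Hp h Hh) as [D1 D2].
        assert (Dc : forall z, is_derive cos z (-1 * sin z)).
        { intros z. replace (-1 * sin z) with (- sin z) by ring.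
          apply is_derive_Reals, derivable_pt_lim_cos. }
        split; [apply (is_derive_comp cos (F p))|apply (is_derive_comp cos (F0 p))]; auto.
      * apply close_mult; auto. now apply close_scal.
Qed.

Lemma close_ln n F F0 m : 0 < m ->
  (forall p, V p -> forall h, Rabs h < a -> m <= F p h /\ m <= F0 p h) ->
  close V n F F0 -> close V n (fun p h => ln (F p h)) (fun p h => ln (F0 p h)).
Proof.
  intros Hm HB HF. pose proof (close_bound _ _ _ HF) as [C [HC H]].
  assert (B : exists C, 0 <= C /\ forall p, V p -> forall h, Rabs h < a ->
     Rabs (ln (F p h)) <= C /\ Rabs (ln (F0 p h)) <= C /\ Rabs (ln (F p h) - ln (F0 p h)) <= C * dl p).
  { assert (Him : 0 < / m) by (now apply Rinv_0_lt_compat).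
    assert (L : forall z w, m <= z -> m <= w -> Rabs (ln z - ln w) <= / m * Rabs (z - w)).
    { assert (L : forall z w, m <= z -> z <= w -> ln w - ln z <= / m * (w - z)).
      { intros z w Hz Hw.
        assert (ln (w / z) <= w / z - 1).
        { pose proof (exp_ineq1_le (ln (w / z))). rewrite exp_ln in H0; [lra|apply Rdiv_lt_0_compat; lra]. }
        unfold Rdiv in H0. rewrite ln_mult, ln_Rinv in H0 by (try apply Rinv_0_lt_compat; lra).
        assert (w * / z - 1 <= / m * (w - z)).
        { replace (w * / z - 1) with (/ z * (w - z)) by (field; lra).
          apply Rmult_le_compat_r; [lra|]. apply Rinv_le_contravar; lra. }
        lra. }
      intros z w Hz Hw. destruct (Rle_dec z w).
      - rewrite (Rabs_left1 (z - w)) by lra.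
        assert (ln z <= ln w) by (destruct (Req_dec z w) as [->|]; [lra|left; apply ln_increasing; lra]).
        rewrite Rabs_left1 by lra. specialize (L z w Hz r). lra.
      - rewrite (Rabs_right (z - w)) by lra.
        assert (ln w < ln z) by (apply ln_increasing; lra).
        rewrite Rabs_right by lra. apply L; lra. }
    assert (L1 : forall z, m <= z -> Rabs (ln z) <= Rabs (ln m) + / m * Rabs z + 1).
    { intros z Hz. specialize (L z m Hz ltac:(lra)).
      replace (ln z) with (ln z - ln m + ln m) by ring.
      eapply Rle_trans; [apply Rabs_triang|].
      assert (/ m * Rabs (z - m) <= / m * (Rabs z + m)).
      { apply Rmult_le_compat_l; [lra|]. pose proof (Rabs_triang z (- m)). rewrite Rabs_Ropp in H0.
        rewrite (Rabs_right m) in H0 by lra. exact H0. }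
      rewrite Rmult_plus_distr_l, Rinv_l in H0 by lra. lra. }
    exists (Rabs (ln m) + / m * C + 1). pose proof (Rabs_pos (ln m)).
    assert (0 <= / m * C) by nra. split; [lra|]. intros p Hp h Hh.
    destruct (H p Hp h Hh) as (A1 & A2 & A3). destruct (HB p Hp h Hh) as [M1 M2]. destruct (dl01 p Hp).
    repeat split.
    - eapply Rle_trans; [apply L1; auto|]. apply Rplus_le_compat_r, Rplus_le_compat_l. nra.
    - eapply Rle_trans; [apply L1; auto|]. apply Rplus_le_compat_r, Rplus_le_compat_l. nra.
    - eapply Rle_trans; [apply L; auto|]. assert (/ m * Rabs (F p h - F0 p h) <= / m * (C * dl p)) by nra. nra. }
  destruct n as [|n]; [split; [exact B|exact Logic.I]|].
  pose proof HF as [_ (F' & F0' & DF & H')].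
  split; [exact B|].
  exists (fun p h => F' p h * / F p h), (fun p h => F0' p h * / F0 p h). split.
  - intros p Hp h Hh. destruct (DF p Hp h Hh) as [D1 D2], (HB p Hp h Hh).
    split; [apply (is_derive_comp ln (F p))|apply (is_derive_comp ln (F0 p))]; auto;
      apply is_derive_Reals, derivable_pt_lim_ln; lra.
  - apply close_mult; auto. apply (close_inv n _ _ m); auto. now apply close_pred.
Qed.

Lemma close_exp n F F0 : close V n F F0 ->
  close V n (fun p h => exp (F p h)) (fun p h => exp (F0 p h)).
Proof.
  revert F F0; induction n as [|n IH]; intros F F0 HF; pose proof HF as [[C [HC H]] H'];
  (assert (B : exists C, 0 <= C /\ forall p, V p -> forall h, Rabs h < a ->
     Rabs (exp (F p h)) <= C /\ Rabs (exp (F0 p h)) <= C /\ Rabs (exp (F p h) - exp (F0 p h)) <= C * dl p);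
   [exists (exp C * (1 + C)); pose proof (exp_pos C); split; [nra|]; intros p Hp h Hh;
    destruct (H p Hp h Hh) as (A1 & A2 & A3); destruct (dl01 p Hp);
    assert (L : forall z, Rabs z <= C -> Rabs (exp z) <= exp C)
      by (intros z Hz; rewrite Rabs_right by (left; apply exp_pos);
          pose proof (Rle_abs z); destruct (Req_dec z C) as [->|]; [lra|left; apply exp_increasing; lra]);
    pose proof (L _ A1); pose proof (L _ A2);
    assert (Rabs (exp (F p h) - exp (F0 p h)) <= exp C * Rabs (F p h - F0 p h))
      by (apply (Rabs_diff_le_of_derive exp exp);
          [intros; apply is_derive_Reals, derivable_pt_lim_exp
          |intros t Ht; apply L; apply Rabs_le; apply Rabs_le_between in A1; apply Rabs_le_between in A2;
           unfold Rmin, Rmax in Ht; destruct (Rle_dec (F0 p h) (F p h)); lra]);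
    assert (exp C * Rabs (F p h - F0 p h) <= exp C * (C * dl p)) by (apply Rmult_le_compat_l; lra);
    repeat split; nra|]).
  - split; [exact B|exact Logic.I].
  - split; [exact B|]. destruct H' as (F' & F0' & DF & H').
    exists (fun p h => F' p h * exp (F p h)), (fun p h => F0' p h * exp (F0 p h)). split.
    + intros p Hp h Hh. destruct (DF p Hp h Hh) as [D1 D2].
      split; [apply (is_derive_comp exp (F p))|apply (is_derive_comp exp (F0 p))]; auto;
        apply is_derive_Reals, derivable_pt_lim_exp.
    + apply close_mult; auto. apply IH. now apply close_pred.
Qed.

(** The source of the lower bounds that [close_inv], [close_sqrt] and [close_ln] demand: positivity
    is checked on the model and survives for small [dl]. *)
Lemma close_lower_bound F F0 m : 0 < m -> close V 0 F F0 ->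
  (forall p, V p -> forall h, Rabs h < a -> 2 * m <= F0 p h) ->
  exists d, 0 < d /\ forall p, V p -> dl p <= d -> forall h, Rabs h < a -> m <= F p h /\ m <= F0 p h.
Proof.
  intros Hm [[C [HC H]] _] H0. exists (m / (C + 1)). split; [apply Rdiv_lt_0_compat; lra|].
  intros p Hp Hd h Hh. destruct (H p Hp h Hh) as (A1 & A2 & A3). specialize (H0 p Hp h Hh).
  assert (C * dl p <= m).
  { apply Rle_trans with ((C + 1) * (m / (C + 1))); [|right; field; lra].
    destruct (dl01 p Hp). apply Rmult_le_compat; lra. }
  apply Rabs_le_between in A3. lra.
Qed.

(** For [k = 0], [h] times this is the primitive of [F] from 0, so it is the difference quotient of
    the primitive, smooth through [h = 0]. The power [t ^ k] is present because each derivative in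
    [h] brings down a factor [t]. *)
Definition average (k : nat) (F : I -> R -> R) (p : I) (h : R) : R :=
  RInt (fun t => t ^ k * F p (t * h)) 0 1.

Lemma Rabs_mult_lt t h : 0 <= t <= 1 -> Rabs h < a -> Rabs (t * h) < a.
Proof.
  intros Ht Hh. rewrite Rabs_mult, (Rabs_right t) by lra. pose proof (Rabs_pos h). nra.
Qed.

Lemma average_continuous (f : R -> R) k h t :
  continuous f (t * h) -> continuous (fun t => t ^ k * f (t * h)) t.
Proof.
  intros Hc. apply cont_mult; [cder|].
  apply (continuous_comp (fun t => t * h) f); [cder|exact Hc].
Qed.

Lemma average_derive (f f' : R -> R) k h :
  Rabs h < a -> (forall z, Rabs z < a -> is_derive f z (f' z)) ->
  (forall z, Rabs z < a -> continuous f' z) ->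
  is_derive (fun h => RInt (fun t => t ^ k * f (t * h)) 0 1) h
            (RInt (fun t => t ^ S k * f' (t * h)) 0 1).
Proof.
  intros Hh Hd Hc.
  assert (H01 : Rmin 0 1 = 0 /\ Rmax 0 1 = 1) by (rewrite Rmin_left, Rmax_right by lra; auto).
  assert (Dt : forall t z, Rabs (t * z) < a ->
     is_derive (fun u => t ^ k * f (t * u)) z (t ^ S k * f' (t * z))).
  { intros t z Hz.
    replace (t ^ S k * f' (t * z)) with (t ^ k * (t * f' (t * z))) by (simpl; ring).
    apply is_derive_scal.
    apply (is_derive_comp f (fun u => t * u)); [now apply Hd|auto_derive; auto; ring]. }
  pose proof (is_derive_RInt_param (fun u t => t ^ k * f (t * u)) 0 1 h) as P.
  rewrite (proj1 H01), (proj2 H01) in P.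
  rewrite (RInt_ext _ (fun t => Derive (fun u => t ^ k * f (t * u)) h)).
  2:{ rewrite (proj1 H01), (proj2 H01). intros t Ht. symmetry. apply is_derive_unique, Dt.
      apply Rabs_mult_lt; auto; lra. }
  apply P.
  - eapply filter_imp; [|apply locally_abs_lt, Hh]. intros z Hz t Ht.
    eexists. apply Dt, Rabs_mult_lt; auto.
  - intros t Ht. pose proof (Rabs_mult_lt t h Ht Hh) as Hth.
    assert (C2 : continuity_2d_pt (fun u v => v * u) h t)
      by (apply continuity_2d_pt_mult; [apply continuity_2d_pt_id2|apply continuity_2d_pt_id1]).
    apply (continuity_2d_pt_ext_loc (fun u v => v ^ S k * f' (v * u))).
    (* Near [(h, t)] the product [v * u] stays inside the interval on which [f] is known to be
       differentiable. *)
    + destruct (C2 (mkposreal (a - Rabs (t * h)) ltac:(lra))) as [d Hdl].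
      exists d. intros u v Hu Hv. specialize (Hdl u v Hu Hv). simpl in Hdl.
      symmetry. apply is_derive_unique, Dt.
      pose proof (Rabs_triang (v * u - t * h) (t * h)) as T.
      replace (v * u - t * h + t * h) with (v * u) in T by ring. lra.
    + apply continuity_2d_pt_mult.
      * apply (continuity_1d_2d_pt_comp (fun v => v ^ S k) (fun u v => v)); [|apply continuity_2d_pt_id2].
        apply continuity_pt_filterlim. cder.
      * apply (continuity_1d_2d_pt_comp f' (fun u v => v * u)); [|exact C2].
        apply continuity_pt_filterlim, Hc, Hth.
  - eapply filter_imp; [|apply locally_abs_lt, Hh]. intros z Hz.
    apply (ex_RInt_continuous (V:=R_CompleteNormedModule)). rewrite (proj1 H01), (proj2 H01).
    intros t Ht. apply average_continuous.
    eapply derive_cont, Hd, Rabs_mult_lt; auto.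
Qed.

Lemma Rabs_average_le (f : R -> R) k M :
  (forall t, 0 <= t <= 1 -> continuous f t) -> (forall t, 0 <= t <= 1 -> Rabs (f t) <= M) ->
  Rabs (RInt (fun t => t ^ k * f t) 0 1) <= M.
Proof.
  intros Hc HM.
  assert (M0 : 0 <= M) by (eapply Rle_trans; [apply Rabs_pos|apply (HM 0); lra]).
  replace M with ((1 - 0) * M) by ring.
  apply abs_RInt_le_const; [lra| |].
  - apply (ex_RInt_continuous (V:=R_CompleteNormedModule)). rewrite Rmin_left, Rmax_right by lra.
    intros t Ht. apply cont_mult; [cder|auto].
  - intros t Ht. rewrite Rabs_mult, (Rabs_right (t ^ k)) by (apply Rle_ge, pow_le; lra).
    assert (t ^ k <= 1) by (rewrite <- (pow1 k); apply pow_incr; lra).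
    assert (0 <= t ^ k) by (apply pow_le; lra).
    specialize (HM t Ht). pose proof (Rabs_pos (f t)). nra.
Qed.

(** One order is spent because the continuity needed for integration is drawn from a derivative. *)
Lemma close_average n k F F0 : close V (S n) F F0 -> close V n (average k F) (average k F0).
Proof.
  assert (Base : forall n k F F0, close V (S n) F F0 ->
    exists C, 0 <= C /\ forall p, V p -> forall h, Rabs h < a ->
     Rabs (average k F p h) <= C /\ Rabs (average k F0 p h) <= C /\
     Rabs (average k F p h - average k F0 p h) <= C * dl p).
  { clear. intros n k F F0 [[C [HC H]] (F' & F0' & DF & H')].
    exists C; split; auto; intros p Hp h Hh.
    assert (CF : forall t, 0 <= t <= 1 -> continuous (fun t => F p (t * h)) t).
    { intros t Ht; apply (continuous_comp (fun t => t * h) (F p)); [cder|].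
      eapply derive_cont. apply (proj1 (DF p Hp (t * h) (Rabs_mult_lt t h Ht Hh))). }
    assert (CF0 : forall t, 0 <= t <= 1 -> continuous (fun t => F0 p (t * h)) t).
    { intros t Ht; apply (continuous_comp (fun t => t * h) (F0 p)); [cder|].
      eapply derive_cont. apply (proj2 (DF p Hp (t * h) (Rabs_mult_lt t h Ht Hh))). }
    assert (Ht' : forall t, 0 <= t <= 1 -> Rabs (t * h) < a) by (intros; now apply Rabs_mult_lt).
    unfold average. repeat split.
    - apply (Rabs_average_le (fun t => F p (t * h))); auto. intros t Ht. apply H; auto.
    - apply (Rabs_average_le (fun t => F0 p (t * h))); auto. intros t Ht. apply H; auto.
    - rewrite <- (RInt_minus (V:=R_CompleteNormedModule)).
      2,3: apply (ex_RInt_continuous (V:=R_CompleteNormedModule)); rewrite Rmin_left, Rmax_right by lra;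
           intros t Ht; apply cont_mult; [cder|auto].
      rewrite (RInt_ext _ (fun t => t ^ k * (F p (t * h) - F0 p (t * h)))).
      + apply (Rabs_average_le (fun t => F p (t * h) - F0 p (t * h))).
        * intros t Ht. apply cont_minus; auto.
        * intros t Ht. apply H; auto.
      + intros t _. change (minus ?x ?y) with (x - y). req; ring. }
  revert k F F0; induction n as [|n IH]; intros k F F0 HF;
    (split; [now apply (Base _ k F F0 HF)|]); [exact Logic.I|].
  destruct HF as [_ (F' & F0' & DF & H')].
  exists (average (S k) F'), (average (S k) F0'). split; [|now apply IH].
  destruct H' as [_ (F'' & F0'' & DF' & _)].
  intros p Hp h Hh. split; apply average_derive; auto; intros z Hz.
  - apply (DF p Hp z Hz).
  - eapply derive_cont, (proj1 (DF' p Hp z Hz)).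
  - apply (DF p Hp z Hz).
  - eapply derive_cont, (proj2 (DF' p Hp z Hz)).
Qed.
End Close.

(** * Reflection angles in the Lazutkin coordinate *)

(* A perturbed disk, given by the derivatives of its boundary curve, the unit tangent of the reference disk at
   parameter 0 and the distance to that disk, together with a base point [ps] of the boundary. *)
Record pert := Pert
  { pdx : nat -> R -> R; pdy : nat -> R -> R; pt1 : R; pt2 : R; pdl : R; ps : R }.

(** The [k]-th derivative of the unit tangent, hence the model for [pdx (S k)]: each derivative
    multiplies by [2 PI] and rotates by a quarter turn, which the phase [k PI / 2] records for all
    [k] at once. *)
Definition disk_dx (k : nat) (t1 t2 s : R) : R :=
  (2 * PI) ^ k * (cos (2 * PI * s + INR k * (PI / 2)) * t1 - sin (2 * PI * s + INR k * (PI / 2)) * t2).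
Definition disk_dy (k : nat) (t1 t2 s : R) : R :=
  (2 * PI) ^ k * (cos (2 * PI * s + INR k * (PI / 2)) * t2 + sin (2 * PI * s + INR k * (PI / 2)) * t1).

Definition near_disk (p : pert) : Prop :=
  0 <= pdl p <= 1 /\ pt1 p ^ 2 + pt2 p ^ 2 = 1 /\
  (forall k s, (k <= 7)%nat -> is_derive (pdx p (S k)) s (pdx p (S (S k)) s) /\
                               is_derive (pdy p (S k)) s (pdy p (S (S k)) s)) /\
  (forall k s, (k <= 8)%nat ->
     Rabs (pdx p (S k) s - disk_dx k (pt1 p) (pt2 p) s) <= pdl p /\
     Rabs (pdy p (S k) s - disk_dy k (pt1 p) (pt2 p) s) <= pdl p) /\
  (forall s, pdx p 1%nat s ^ 2 + pdy p 1%nat s ^ 2 = 1) /\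
  (forall s, pdx p 1%nat (s + 1) = pdx p 1%nat s /\ pdy p 1%nat (s + 1) = pdy p 1%nat s).

Definition near_disk_le (d : R) (p : pert) : Prop := near_disk p /\ pdl p <= d.

(** Since the base point belongs to the parameter, a bound at [h = 0] for all parameters becomes,
    through [at_pt], a bound at every point of the curve. *)
Definition at_pt (p : pert) (s : R) : pert :=
  Pert (pdx p) (pdy p) (pt1 p) (pt2 p) (pdl p) s.

Lemma near_disk_dl p : near_disk p -> 0 <= pdl p <= 1.
Proof. intros H; apply H. Qed.

(** The half-width 3/5 exceeds 1/2, so every pair of points is seen from one side or the other, and
    it stays below 1, so the chord divided by [h] has a positive lower bound. *)
Notation clo d := (close pert pdl (3/5) (near_disk_le d)).

Lemma nd_dl d p : near_disk_le d p -> 0 <= pdl p <= 1.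
Proof. intros H; apply H. Qed.

Lemma disk_dx_derive k t1 t2 s : is_derive (disk_dx k t1 t2) s (disk_dx (S k) t1 t2 s).
Proof.
  unfold disk_dx. auto_derive; auto. rewrite S_INR.
  replace (2 * PI * s + (INR k + 1) * (PI / 2)) with (2 * PI * s + INR k * (PI / 2) + PI / 2) by field.
  set (z := 2 * PI * s + INR k * (PI / 2)).
  rewrite cos_plus, sin_plus, cos_PI2, sin_PI2. simpl. ring.
Qed.

Lemma disk_dy_derive k t1 t2 s : is_derive (disk_dy k t1 t2) s (disk_dy (S k) t1 t2 s).
Proof.
  unfold disk_dy. auto_derive; auto. rewrite S_INR.
  replace (2 * PI * s + (INR k + 1) * (PI / 2)) with (2 * PI * s + INR k * (PI / 2) + PI / 2) by field.
  set (z := 2 * PI * s + INR k * (PI / 2)).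
  rewrite cos_plus, sin_plus, cos_PI2, sin_PI2. simpl. ring.
Qed.

Lemma unit_bound t1 t2 : t1 ^ 2 + t2 ^ 2 = 1 -> Rabs t1 <= 1 /\ Rabs t2 <= 1.
Proof. intros H; split; apply Rabs_le; split; nra. Qed.

Lemma disk_dx_bound k t1 t2 s : t1 ^ 2 + t2 ^ 2 = 1 ->
  Rabs (disk_dx k t1 t2 s) <= (2 * PI) ^ k * 2 /\ Rabs (disk_dy k t1 t2 s) <= (2 * PI) ^ k * 2.
Proof.
  intros H. destruct (unit_bound _ _ H) as [H1 H2]. pose proof PI_RGT_0.
  assert (HP : 0 <= (2 * PI) ^ k) by (apply pow_le; lra).
  unfold disk_dx, disk_dy. set (z := 2 * PI * s + INR k * (PI / 2)).
  assert (Rabs (cos z) <= 1) by (apply Rabs_le, COS_bound).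
  assert (Rabs (sin z) <= 1) by (apply Rabs_le, SIN_bound).
  assert (T : forall u v t w, Rabs u <= 1 -> Rabs v <= 1 -> Rabs t <= 1 -> Rabs w <= 1 ->
     Rabs (u * t + v * w) <= 2).
  { intros u v t w B1 B2 B3 B4. eapply Rle_trans; [apply Rabs_triang|]. rewrite !Rabs_mult.
    pose proof (Rabs_pos u). pose proof (Rabs_pos v). pose proof (Rabs_pos t). pose proof (Rabs_pos w). nra. }
  split; rewrite Rabs_mult, (Rabs_right ((2 * PI) ^ k)) by lra; apply Rmult_le_compat_l; auto.
  replace (cos z * t1 - sin z * t2) with (cos z * t1 + (- sin z) * t2) by ring.
  apply T; auto. now rewrite Rabs_Ropp.
Qed.

Section Families.
Variable d : R.
Let V := near_disk_le d.

Definition fx (k : nat) (p : pert) (h : R) := pdx p (S k) (ps p + h).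
Definition fy (k : nat) (p : pert) (h : R) := pdy p (S k) (ps p + h).
Definition fx0 (k : nat) (p : pert) (h : R) := disk_dx k (pt1 p) (pt2 p) (ps p + h).
Definition fy0 (k : nat) (p : pert) (h : R) := disk_dy k (pt1 p) (pt2 p) (ps p + h).

Lemma is_derive_shift (f : R -> R) c h l :
  is_derive f (c + h) l -> is_derive (fun z => f (c + z)) h l.
Proof.
  intros H. replace l with (1 * l) by ring.
  apply (is_derive_comp f (fun z => c + z)); auto. auto_derive; auto; ring.
Qed.

Lemma close_fxy n k : (k + n <= 8)%nat -> clo d n (fx k) (fx0 k) /\ clo d n (fy k) (fy0 k).
Proof.
  revert k; induction n as [|n IH]; intros k Hk;
  (assert (B : forall p, V p -> forall h,
     (Rabs (fx k p h) <= (2 * PI) ^ k * 2 + 1 /\ Rabs (fx0 k p h) <= (2 * PI) ^ k * 2 + 1 /\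
      Rabs (fx k p h - fx0 k p h) <= ((2 * PI) ^ k * 2 + 1) * pdl p) /\
     (Rabs (fy k p h) <= (2 * PI) ^ k * 2 + 1 /\ Rabs (fy0 k p h) <= (2 * PI) ^ k * 2 + 1 /\
      Rabs (fy k p h - fy0 k p h) <= ((2 * PI) ^ k * 2 + 1) * pdl p));
   [intros p [(Hd & Ht & _ & Hc & _) _] h; destruct (Hc k (ps p + h) ltac:(lia)) as [C1 C2];
    destruct (disk_dx_bound k _ _ (ps p + h) Ht) as [B1 B2];
    assert (HP : 0 <= (2 * PI) ^ k) by (apply pow_le; pose proof PI_RGT_0; lra);
    unfold fx, fy, fx0, fy0;
    pose proof (Rabs_triang_inv (pdx p (S k) (ps p + h)) (disk_dx k (pt1 p) (pt2 p) (ps p + h)));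
    pose proof (Rabs_triang_inv (pdy p (S k) (ps p + h)) (disk_dy k (pt1 p) (pt2 p) (ps p + h)));
    repeat split; nra|]);
  (assert (HP : 0 <= (2 * PI) ^ k * 2 + 1)
     by (assert (0 <= (2 * PI) ^ k) by (apply pow_le; pose proof PI_RGT_0; lra); lra)).
  - split; (split; [exists ((2 * PI) ^ k * 2 + 1); split; auto; intros p Hp h _; apply B; auto|exact Logic.I]).
  - destruct (IH (S k) ltac:(lia)) as [I1 I2].
    split; (split; [exists ((2 * PI) ^ k * 2 + 1); split; auto; intros p Hp h _; apply B; auto|]).
    + exists (fx (S k)), (fx0 (S k)). split; auto.
      intros p [(_ & _ & D & _) _] h _. split; apply is_derive_shift; [apply D; lia|apply disk_dx_derive].
    + exists (fy (S k)), (fy0 (S k)). split; auto.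
      intros p [(_ & _ & D & _) _] h _. split; apply is_derive_shift; [apply D; lia|apply disk_dy_derive].
Qed.

Lemma close_freeze n F F0 : clo d 0 F F0 -> clo d n (fun p _ => F p 0) (fun p _ => F0 p 0).
Proof.
  intros [[C [HC H]] _]. apply (close_const _ _ _ _ (nd_dl d) n _ _ C).
  intros p Hp. apply H; auto. rewrite Rabs_R0; lra.
Qed.

(** [alpha] and [beta] are the sine and cosine of the angle turned by the tangent from the base
    point. Being relative, they have the models [sin (2 PI h)] and [cos (2 PI h)], from which base
    point and reference tangent have disappeared. *)
Definition alpha (p : pert) (h : R) := fx 0 p 0 * fy 0 p h - fy 0 p 0 * fx 0 p h.
Definition beta (p : pert) (h : R) := fx 0 p 0 * fx 0 p h + fy 0 p 0 * fy 0 p h.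
Definition kap (p : pert) (h : R) := fx 0 p h * fy 1 p h - fy 0 p h * fx 1 p h.

Lemma close_alpha n : (n <= 8)%nat -> clo d n alpha (fun _ h => sin (2 * PI * h)).
Proof.
  intros Hn. destruct (close_fxy n 0 Hn) as [Cx Cy]. destruct (close_fxy 0 0 ltac:(lia)) as [Dx Dy].
  eapply close_ext; [|apply (close_minus _ _ _ _ (nd_dl d));
    [apply (close_mult _ _ _ _ (nd_dl d)); [apply close_freeze, Dx|apply Cy]
    |apply (close_mult _ _ _ _ (nd_dl d)); [apply close_freeze, Dy|apply Cx]]].
  intros p [(_ & Ht & _) _] h _. split; [reflexivity|].
  unfold fx0, fy0, disk_dx, disk_dy. simpl. rewrite !Rmult_0_l, !Rplus_0_r, !Rmult_1_l.
  replace (2 * PI * h) with (2 * PI * (ps p + h) - 2 * PI * ps p) by ring. rewrite sin_minus.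
  set (u := 2 * PI * ps p). set (v := 2 * PI * (ps p + h)).
  transitivity ((sin v * cos u - cos v * sin u) * (pt1 p ^ 2 + pt2 p ^ 2)); [ring|rewrite Ht; ring].
Qed.

Lemma close_beta n : (n <= 8)%nat -> clo d n beta (fun _ h => cos (2 * PI * h)).
Proof.
  intros Hn. destruct (close_fxy n 0 Hn) as [Cx Cy]. destruct (close_fxy 0 0 ltac:(lia)) as [Dx Dy].
  eapply close_ext; [|apply (close_plus _ _ _ _);
    [apply (close_mult _ _ _ _ (nd_dl d)); [apply close_freeze, Dx|apply Cx]
    |apply (close_mult _ _ _ _ (nd_dl d)); [apply close_freeze, Dy|apply Cy]]].
  intros p [(_ & Ht & _) _] h _. split; [reflexivity|].
  unfold fx0, fy0, disk_dx, disk_dy. simpl. rewrite !Rmult_0_l, !Rplus_0_r, !Rmult_1_l.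
  replace (2 * PI * h) with (2 * PI * (ps p + h) - 2 * PI * ps p) by ring. rewrite cos_minus.
  set (u := 2 * PI * ps p). set (v := 2 * PI * (ps p + h)).
  transitivity ((cos v * cos u + sin v * sin u) * (pt1 p ^ 2 + pt2 p ^ 2)); [ring|rewrite Ht; ring].
Qed.

Lemma close_kap n : (n <= 7)%nat -> clo d n kap (fun _ _ => 2 * PI).
Proof.
  intros Hn. destruct (close_fxy n 0 ltac:(lia)) as [Cx Cy]. destruct (close_fxy n 1 ltac:(lia)) as [Dx Dy].
  eapply close_ext; [|apply (close_minus _ _ _ _ (nd_dl d));
    [apply (close_mult _ _ _ _ (nd_dl d)); [apply Cx|apply Dy]
    |apply (close_mult _ _ _ _ (nd_dl d)); [apply Cy|apply Dx]]].
  intros p [(_ & Ht & _) _] h _. split; [reflexivity|].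
  unfold fx0, fy0, disk_dx, disk_dy. simpl. rewrite !Rmult_0_l, !Rplus_0_r, !Rmult_1_l, !Rmult_1_r.
  set (v := 2 * PI * (ps p + h)).
  rewrite cos_plus, sin_plus, cos_PI2, sin_PI2. rewrite !Rmult_0_r, !Rmult_1_r.
  transitivity (2 * PI * (cos v ^ 2 + sin v ^ 2) * (pt1 p ^ 2 + pt2 p ^ 2)); [ring|].
  rewrite Ht. replace (cos v ^ 2 + sin v ^ 2) with 1; [ring|].
  pose proof (sin2_cos2 v) as E. unfold Rsqr in E. nra.
Qed.
End Families.

Lemma close_smaller d d' n F F0 : d' <= d -> clo d n F F0 -> clo d' n F F0.
Proof. intros L. apply close_shrink. intros p [A B]; split; auto; lra. Qed.

(* [h * avgA p h] and [h * avgB p h] are the components of the chord from the base point to the point at arc length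
   [h], normal and tangential at the base point; dividing by [h] makes them smooth at [h = 0]. *)
Definition avgA := average pert 0 alpha.
Definition avgB := average pert 0 beta.
Definition avgA0 := average pert 0 (fun _ h => sin (2 * PI * h)).
Definition avgB0 := average pert 0 (fun _ h => cos (2 * PI * h)).

Lemma avg0_values p h : h <> 0 ->
  avgA0 p h = (1 - cos (2 * PI * h)) / (2 * PI * h) /\ avgB0 p h = sin (2 * PI * h) / (2 * PI * h).
Proof.
  intros Hh. pose proof PI_RGT_0. unfold avgA0, avgB0, average.
  assert (N : 2 * PI * h <> 0) by (apply Rmult_integral_contrapositive_currified; lra).
  split.
  - rewrite (RInt_ext _ (fun t => sin (2 * PI * (t * h)))) by (intros; simpl; req; ring).
    rewrite (RInt_of_derive (fun t => - cos (2 * PI * (t * h)) / (2 * PI * h))).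
    + cbv beta. replace (2 * PI * (0 * h)) with 0 by ring. rewrite Rmult_1_l, cos_0. req; field; lra.
    + intros t. auto_derive; auto. field; lra.
    + intros t. cder.
  - rewrite (RInt_ext _ (fun t => cos (2 * PI * (t * h)))) by (intros; simpl; req; ring).
    rewrite (RInt_of_derive (fun t => sin (2 * PI * (t * h)) / (2 * PI * h))).
    + cbv beta. replace (2 * PI * (0 * h)) with 0 by ring. rewrite Rmult_1_l, sin_0. req; field; lra.
    + intros t. auto_derive; auto. field; lra.
    + intros t. cder.
Qed.

Lemma avg0_at0 p : avgA0 p 0 = 0 /\ avgB0 p 0 = 1.
Proof.
  unfold avgA0, avgB0, average. split.
  - rewrite (RInt_ext _ (fun t => 0)) by (intros; rewrite !Rmult_0_r, sin_0; req; ring).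
    rewrite RInt_const_R. req; ring.
  - rewrite (RInt_ext _ (fun t => 1)) by (intros; rewrite !Rmult_0_r, cos_0; simpl; req; ring).
    rewrite RInt_const_R. req; ring.
Qed.

Definition chord_sq (p : pert) (h : R) := avgA p h * avgA p h + avgB p h * avgB p h.
Definition chord_sq0 (p : pert) (h : R) := avgA0 p h * avgA0 p h + avgB0 p h * avgB0 p h.

Lemma sin_ratio_pos h : h <> 0 -> Rabs h < 3/5 -> / 10 <= sin (PI * h) / (PI * h).
Proof.
  assert (L : forall z, 0 < z < 3/5 -> / 10 <= sin (PI * z) / (PI * z)).
  { intros z Hz. pose proof (sin_PI_lower z ltac:(lra)). pose proof PI_4. pose proof PI_RGT_0.
    apply (Rmult_le_reg_r (PI * z)); [nra|]. unfold Rdiv. rewrite Rmult_assoc, Rinv_l by nra. nra. }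
  intros H0 Hh. apply Rabs_def2 in Hh. destruct (Rlt_dec 0 h); [apply L; lra|].
  replace (sin (PI * h) / (PI * h)) with (sin (PI * - h) / (PI * - h)); [apply L; lra|].
  replace (PI * - h) with (- (PI * h)) by ring. rewrite sin_neg. pose proof PI_RGT_0. field. lra.
Qed.

(** Half-angle formulas: on the disk of perimeter 1 the chord over arc length [h] has length
    [sin (PI h) / PI]. *)
Lemma chord_sq0_value p h : h <> 0 -> chord_sq0 p h = (sin (PI * h) / (PI * h)) ^ 2.
Proof.
  intros Hh. unfold chord_sq0. destruct (avg0_values p h Hh) as [-> ->]. pose proof PI_RGT_0.
  replace (2 * PI * h) with (2 * (PI * h)) by ring. rewrite cos_2a, sin_2a.
  pose proof (sin2_cos2 (PI * h)) as E. unfold Rsqr in E.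
  set (z := PI * h) in *. assert (z <> 0) by (apply Rmult_integral_contrapositive_currified; lra).
  replace (cos z * cos z) with (1 - sin z * sin z) by lra.
  replace ((1 - (1 - sin z * sin z - sin z * sin z)) / (2 * z) * ((1 - (1 - sin z * sin z - sin z * sin z)) / (2 * z)) +
    2 * sin z * cos z / (2 * z) * (2 * sin z * cos z / (2 * z)))
  with ((sin z * sin z) * (sin z * sin z + cos z * cos z) / (z * z)) by (field; auto).
  rewrite E. field; auto.
Qed.

Lemma chord_sq0_lower p h : Rabs h < 3/5 -> 2 * / 200 <= chord_sq0 p h.
Proof.
  intros Hh. destruct (Req_dec h 0) as [->|N].
  - unfold chord_sq0. destruct (avg0_at0 p) as [-> ->]. lra.
  - rewrite chord_sq0_value by auto. pose proof (sin_ratio_pos h N Hh). nra.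
Qed.

Lemma sine0_value p h : Rabs h < 3/5 -> avgA0 p h * / sqrt (chord_sq0 p h) = sin (PI * h).
Proof.
  intros Hh. destruct (Req_dec h 0) as [->|N].
  - destruct (avg0_at0 p) as [-> _]. rewrite Rmult_0_r, sin_0; ring.
  - rewrite chord_sq0_value by auto. pose proof (sin_ratio_pos h N Hh) as B.
    rewrite sqrt_pow2 by lra. destruct (avg0_values p h N) as [-> _]. pose proof PI_RGT_0.
    replace (2 * PI * h) with (2 * (PI * h)) by ring. rewrite cos_2a_sin.
    set (z := PI * h) in *. assert (z <> 0) by (apply Rmult_integral_contrapositive_currified; lra).
    assert (sin z <> 0) by (intros E; rewrite E in B; unfold Rdiv in B; lra).
    field; auto.
Qed.

Lemma cosine0_value p h : Rabs h < 3/5 -> avgB0 p h * / sqrt (chord_sq0 p h) = cos (PI * h).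
Proof.
  intros Hh. destruct (Req_dec h 0) as [->|N].
  - unfold chord_sq0. destruct (avg0_at0 p) as [-> ->]. replace (PI * 0) with 0 by ring. rewrite cos_0.
    replace (0 * 0 + 1 * 1) with 1 by ring. rewrite sqrt_1. field.
  - rewrite chord_sq0_value by auto. pose proof (sin_ratio_pos h N Hh) as B.
    rewrite sqrt_pow2 by lra. destruct (avg0_values p h N) as [_ ->]. pose proof PI_RGT_0.
    replace (2 * PI * h) with (2 * (PI * h)) by ring. rewrite sin_2a.
    set (z := PI * h) in *. assert (z <> 0) by (apply Rmult_integral_contrapositive_currified; lra).
    assert (sin z <> 0) by (intros E; rewrite E in B; unfold Rdiv in B; lra).
    field; auto.
Qed.

(* The chord is divided by [h], not by [|h|]: for the disk these are [sin (PI h)] and [cos (PI h)] for both signs of [h]. *)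
Definition sine (p : pert) (h : R) := avgA p h * / sqrt (chord_sq p h).
Definition cosine (p : pert) (h : R) := avgB p h * / sqrt (chord_sq p h).

(** Division by the chord is harmless at every order because the chord over [h] stays bounded below
    through [h = 0]. The average spends one of the eight orders of closeness of the tangent, which
    leaves seven. *)
Lemma close_angle : exists d, 0 < d <= 1 /\
  (forall p, near_disk_le d p -> forall h, Rabs h < 3/5 -> / 200 <= chord_sq p h) /\
  forall n, (n <= 7)%nat -> clo d n sine (fun _ h => sin (PI * h)) /\
                            clo d n cosine (fun _ h => cos (PI * h)).
Proof.
  assert (CA : forall n, (n <= 7)%nat -> clo 1 n avgA avgA0).
  { intros n Hn. apply (close_average _ _ _ _ ), close_alpha; lia. }
  assert (CB : forall n, (n <= 7)%nat -> clo 1 n avgB avgB0).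
  { intros n Hn. apply (close_average _ _ _ _ ), close_beta; lia. }
  assert (CS : forall n, (n <= 7)%nat -> clo 1 n chord_sq chord_sq0).
  { intros n Hn. apply (close_plus _ _ _ _); apply (close_mult _ _ _ _ (nd_dl 1)); auto. }
  destruct (close_lower_bound _ _ _ _ (nd_dl 1) chord_sq chord_sq0 (/ 200) ltac:(lra) (CS 0%nat ltac:(lia)))
    as [d [Hd HL]].
  { intros p _ h Hh. now apply chord_sq0_lower. }
  assert (Hmin : 0 < Rmin d 1) by (apply Rmin_glb_lt; lra).
  assert (HL' : forall p, near_disk_le (Rmin d 1) p -> forall h, Rabs h < 3/5 ->
            / 200 <= chord_sq p h /\ / 200 <= chord_sq0 p h).
  { intros p [Hp Hp'] h Hh. pose proof (Rmin_l d 1). pose proof (Rmin_r d 1).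
    apply HL; auto; [split; auto; lra|lra]. }
  exists (Rmin d 1). split; [split; [auto|apply Rmin_r]|]. split; [intros p Hp h Hh; exact (proj1 (HL' p Hp h Hh))|].
  intros n Hn.
  assert (CI : clo (Rmin d 1) n (fun p h => / sqrt (chord_sq p h)) (fun p h => / sqrt (chord_sq0 p h))).
  { apply (close_inv _ _ _ _ (nd_dl _) n _ _ (sqrt (/ 200))).
    - apply sqrt_lt_R0; lra.
    - intros p Hp h Hh. destruct (HL' p Hp h Hh). split; apply sqrt_le_1_alt; auto.
    - apply (close_sqrt _ _ _ _ (nd_dl _) n _ _ (/ 200)); auto; [lra|].
      apply (close_smaller 1); [apply Rmin_r|auto]. }
  split.
  - eapply close_ext; [|apply (close_mult _ _ _ _ (nd_dl _) n); [|exact CI];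
      apply (close_smaller 1); [apply Rmin_r|apply CA, Hn]].
    intros p Hp h Hh. split; [reflexivity|now apply sine0_value].
  - eapply close_ext; [|apply (close_mult _ _ _ _ (nd_dl _) n); [|exact CI];
      apply (close_smaller 1); [apply Rmin_r|apply CB, Hn]].
    intros p Hp h Hh. split; [reflexivity|now apply cosine0_value].
Qed.

(* The Lazutkin coordinate [laz] has derivative [cbrt_curv ^ 2 / laz_total] and [laz 1 = 1]; [laz_angle] is
   [curvature / (2 laz')], the ratio of angle to Lazutkin step for infinitesimal chords. *)
Definition cbrt_curv (dx dy : nat -> R -> R) (s : R) : R := exp (/ 3 * ln (curvature dx dy s)).
Definition laz_density (dx dy : nat -> R -> R) (s : R) : R := cbrt_curv dx dy s * cbrt_curv dx dy s.
Definition laz_total (dx dy : nat -> R -> R) : R := RInt (laz_density dx dy) 0 1.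
Definition laz (dx dy : nat -> R -> R) (s : R) : R := / laz_total dx dy * RInt (laz_density dx dy) 0 s.
Definition laz_angle (dx dy : nat -> R -> R) (s : R) : R := cbrt_curv dx dy s * laz_total dx dy * / 2.

Lemma is_derive_unshift (f : R -> R) c h l :
  is_derive (fun z => f (c + z)) h l -> is_derive f (c + h) l.
Proof.
  intros H.
  assert (E : forall z : R, f (c + (z - c)) = f z) by (intros z; f_equal; ring).
  apply (is_derive_ext (fun z => f (c + (z - c)))); [exact E|].
  - replace l with (1 * l) by ring.
    apply (is_derive_comp (fun z => f (c + z)) (fun z => z - c)).
    + assert (E2 : c + h - c = h) by ring.
      change (is_derive (fun z => f (c + z)) (c + h - c) l). rewrite E2. exact H.
    + auto_derive; auto; ring.
Qed.

Definition gf (p : pert) (h : R) := cbrt_curv (pdx p) (pdy p) (ps p + h).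
Definition Tf (p : pert) := laz_total (pdx p) (pdy p).
Definition Yf (p : pert) (h : R) := laz (pdx p) (pdy p) (ps p + h) - laz (pdx p) (pdy p) (ps p).
Definition cf (p : pert) := laz_angle (pdx p) (pdy p) (ps p).
(** The cube root of [2 PI], the curvature of the disk of perimeter 1. *)
Definition g0 : R := exp (/ 3 * ln (2 * PI)).

Lemma g0_cube : g0 * g0 * g0 = 2 * PI.
Proof.
  unfold g0. rewrite <- !exp_plus. pose proof PI_RGT_0.
  rewrite <- (exp_ln (2 * PI)) at 4 by lra. f_equal. field.
Qed.

Lemma g0_pos : 0 < g0.
Proof. apply exp_pos. Qed.

Lemma cbrt_curv_cube dx dy s : 0 < curvature dx dy s ->
  cbrt_curv dx dy s * cbrt_curv dx dy s * cbrt_curv dx dy s = curvature dx dy s.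
Proof.
  intros H. unfold cbrt_curv. rewrite <- !exp_plus.
  rewrite <- (exp_ln (curvature dx dy s)) at 4 by auto. f_equal. field.
Qed.

(** Normalizing by the total makes the model coordinate the identity: the density and its total both
    have the model [g0 * g0]. For the same reason the model of [laz_angle] is [g0 ^ 3 / 2 = PI],
    independent of the base point. *)
Lemma close_lazutkin : exists d, 0 < d <= 1 /\
  (forall p, near_disk_le d p -> forall s, 1 <= curvature (pdx p) (pdy p) s) /\
  (forall p, near_disk_le d p -> forall s, 1 <= cbrt_curv (pdx p) (pdy p) s) /\
  (forall p, near_disk_le d p -> forall s, ex_derive (cbrt_curv (pdx p) (pdy p)) s) /\
  (forall p, near_disk_le d p -> 1 <= Tf p) /\
  (forall p, near_disk_le d p -> forall s,
      is_derive (laz (pdx p) (pdy p)) s (/ Tf p * laz_density (pdx p) (pdy p) s)) /\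
  (forall n, (n <= 7)%nat -> clo d n gf (fun _ _ => g0)) /\
  (forall n, (n <= 7)%nat -> clo d n (fun p h => / Tf p * laz_density (pdx p) (pdy p) (ps p + h)) (fun _ _ => 1)) /\
  (forall n, (n <= 8)%nat -> clo d n Yf (fun _ h => h)) /\
  (forall n, clo d n (fun p _ => cf p) (fun _ _ => PI)).
Proof.
  destruct (close_lower_bound _ _ _ _ (nd_dl 1) kap (fun _ _ => 2 * PI) 1 ltac:(lra) (close_kap 1 0 ltac:(lia)))
    as [d0 [Hd0 HL]].
  { intros. pose proof PI2_3_2. lra. }
  set (d := Rmin d0 1).
  assert (Hd : 0 < d <= 1) by (split; [apply Rmin_glb_lt; lra|apply Rmin_r]).
  assert (Hk : forall p, near_disk_le d p -> forall h, Rabs h < 3/5 -> 1 <= kap p h /\ 1 <= 2 * PI).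
  { intros p [Hp Hp'] h Hh. apply HL; auto; [split; auto; lra|].
    eapply Rle_trans; [apply Hp'|apply Rmin_l]. }
  assert (Hcurv : forall p, near_disk_le d p -> forall s, 1 <= curvature (pdx p) (pdy p) s).
  (* Moving the base point to [s] and reading the bound at [h = 0] removes the restriction to
     [|h| < 3/5]. *)
  { intros p Hp s. destruct (Hk (at_pt p s) Hp 0) as [H _]; [rewrite Rabs_R0; lra|].
    unfold kap, fx, fy in H. simpl in H. rewrite Rplus_0_r in H. exact H. }
  assert (Hg1 : forall p, near_disk_le d p -> forall s, 1 <= cbrt_curv (pdx p) (pdy p) s).
  { intros p Hp s. specialize (Hcurv p Hp s). unfold cbrt_curv.
    assert (0 <= ln (curvature (pdx p) (pdy p) s)).
    { rewrite <- ln_1. destruct (Req_dec 1 (curvature (pdx p) (pdy p) s)) as [<-|]; [lra|].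
      left; apply ln_increasing; lra. }
    pose proof (exp_ineq1_le (/ 3 * ln (curvature (pdx p) (pdy p) s))). lra. }
  assert (Cg : forall n, (n <= 7)%nat -> clo d n gf (fun _ _ => g0)).
  { intros n Hn. apply (close_exp _ _ _ _ (nd_dl d)), (close_scal _ _ _ _ (nd_dl d)).
    apply (close_ln _ _ _ _ (nd_dl d) n kap (fun _ _ => 2 * PI) 1); auto; [lra|].
    now apply close_kap. }
  assert (Dg : forall p, near_disk_le d p -> forall s, ex_derive (cbrt_curv (pdx p) (pdy p)) s).
  { intros p Hp s. destruct (Cg 1%nat ltac:(lia)) as [_ (G & Gz & D & _)].
    destruct (D (at_pt p s) Hp 0) as [D' _]; [rewrite Rabs_R0; lra|].
    exists (G (at_pt p s) 0). replace s with (s + 0) at 1 by ring.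
    apply is_derive_unshift. exact D'. }
  assert (Cr : forall p, near_disk_le d p -> forall s, continuous (laz_density (pdx p) (pdy p)) s).
  { intros p Hp s. apply ex_derive_cont.
    apply ex_derive_mult; now apply Dg. }
  assert (HT : forall p, near_disk_le d p -> 1 <= Tf p).
  { intros p Hp. unfold Tf, laz_total.
    replace 1 with (RInt (fun _ => 1) 0 1) at 1 by (rewrite RInt_const_R; req; ring).
    apply RInt_le; [lra| | |].
    - apply ex_RInt_cont; intros; apply continuous_const.
    - now apply ex_RInt_cont, Cr.
    - intros s _. unfold laz_density. specialize (Hg1 p Hp s). nra. }
  assert (Dlaz : forall p, near_disk_le d p -> forall s,
      is_derive (laz (pdx p) (pdy p)) s (/ Tf p * laz_density (pdx p) (pdy p) s)).
  { intros p Hp s. unfold laz. apply is_derive_scal.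
    apply (is_derive_RInt (V:=R_CompleteNormedModule) _ _ 0); [|now apply Cr].
    apply filter_forall. intros z. apply (RInt_correct (V:=R_CompleteNormedModule)).
    now apply ex_RInt_cont, Cr. }
  assert (Cgg : forall n, (n <= 7)%nat -> clo d n (fun p h => gf p h * gf p h) (fun _ _ => g0 * g0)).
  { intros n Hn. apply (close_mult _ _ _ _ (nd_dl d)); auto. }
  assert (CT : forall n, clo d n (fun p _ => Tf p) (fun _ _ => g0 * g0)).
  { intros n. destruct (Cgg 0%nat ltac:(lia)) as [[C [HC H]] _].
    apply (close_const _ _ _ _ (nd_dl d) n Tf (fun _ => g0 * g0) C). intros p Hp.
    assert (B : forall s, Rabs (laz_density (pdx p) (pdy p) s) <= C /\ Rabs (g0 * g0) <= C /\
                 Rabs (laz_density (pdx p) (pdy p) s - g0 * g0) <= C * pdl p).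
    { intros s. pose proof (H (at_pt p s) Hp 0 ltac:(rewrite Rabs_R0; lra)) as B.
      unfold gf in B. simpl in B. rewrite Rplus_0_r in B. exact B. }
    unfold Tf, laz_total. repeat split.
    - replace C with ((1 - 0) * C) by ring. apply abs_RInt_le_const; [lra|now apply ex_RInt_cont, Cr|].
      intros; apply B.
    - apply (B 0).
    - replace (g0 * g0) with (RInt (fun _ => g0 * g0) 0 1) by (rewrite RInt_const_R; req; ring).
      rewrite <- RInt_minus_cont; [|now apply Cr|intros; apply continuous_const].
      replace (C * pdl p) with ((1 - 0) * (C * pdl p)) by ring. apply abs_RInt_le_const; [lra| |].
      + apply ex_RInt_cont. intros t. apply cont_minus; [now apply Cr|apply continuous_const].
      + intros; apply B. }
  assert (G0 : 1 <= g0 * g0).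
  { pose proof g0_pos. pose proof g0_cube. pose proof PI2_3_2.
    destruct (Rle_dec 1 g0); [nra|]. exfalso.
    assert (g0 * g0 <= 1) by nra. assert (g0 * g0 * g0 <= 1) by nra. lra. }
  assert (CX : forall n, (n <= 7)%nat ->
     clo d n (fun p h => / Tf p * laz_density (pdx p) (pdy p) (ps p + h)) (fun _ _ => 1)).
  { intros n Hn. eapply close_ext; [|apply (close_mult _ _ _ _ (nd_dl d) n);
      [apply (close_inv _ _ _ _ (nd_dl d) n (fun p _ => Tf p) (fun _ _ => g0 * g0) 1); [lra| |apply (CT n)]|apply (Cgg n Hn)]].
    - intros p Hp h Hh. split; [reflexivity|]. cbv beta. rewrite Rinv_l; lra.
    - intros p Hp h Hh. split; [now apply HT|exact G0]. }
  assert (CY : forall n, (n <= 8)%nat -> clo d n Yf (fun _ h => h)).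
  (* Integration gains an order, so [Yf] is controlled one step beyond its derivative. *)
  { assert (CY1 : forall n, (n <= 7)%nat -> clo d (S n) Yf (fun _ h => h)).
    { intros n Hn.
      destruct (CX 0%nat ltac:(lia)) as [[C [HC H]] _].
      assert (DY : forall p, near_disk_le d p -> forall h,
          is_derive (Yf p) h (/ Tf p * laz_density (pdx p) (pdy p) (ps p + h))).
      { intros p Hp h. unfold Yf.
        replace (/ Tf p * laz_density (pdx p) (pdy p) (ps p + h))
          with (minus (/ Tf p * laz_density (pdx p) (pdy p) (ps p + h)) zero)
          by (change (/ Tf p * laz_density (pdx p) (pdy p) (ps p + h) - 0 =
                / Tf p * laz_density (pdx p) (pdy p) (ps p + h)); ring).
        apply derive_minus;
          [apply is_derive_shift, Dlaz, Hp|apply derive_const]. }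
      split.
      - exists (1 + C). split; [lra|]. intros p Hp h Hh.
        assert (Y0 : Yf p 0 = 0) by (unfold Yf; rewrite Rplus_0_r; ring).
        assert (B : Rabs (Yf p h - h) <= C * pdl p).
        { pose proof (Rabs_diff_le_of_derive (fun z => Yf p z - z)
            (fun z => / Tf p * laz_density (pdx p) (pdy p) (ps p + z) - 1) 0 h (C * pdl p)) as B.
          cbv beta in B; rewrite Y0, !Rminus_0_r in B.
          destruct (nd_dl d p Hp).
          eapply Rle_trans; [apply B|].
          - intros t. apply derive_minus; [now apply DY|].
            apply derive_id.
          - intros t Ht. apply (H p Hp t). apply Rabs_def2 in Hh. apply Rabs_def1;
            unfold Rmin, Rmax in Ht; destruct (Rle_dec 0 h); lra.
          - assert (0 <= C * pdl p) by nra. nra. }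
        destruct (nd_dl d p Hp). assert (C * pdl p <= C) by nra.
        pose proof (Rabs_triang (Yf p h - h) h). replace (Yf p h - h + h) with (Yf p h) in * by ring.
        repeat split; nra.
      - exists (fun p h => / Tf p * laz_density (pdx p) (pdy p) (ps p + h)), (fun _ _ => 1).
        split; [|now apply CX]. intros p Hp h Hh. split; [now apply DY|apply derive_id]. }
    intros n Hn. destruct n as [|n]; [apply close_pred, CY1; lia|apply CY1; lia]. }
  assert (Cc : forall n, clo d n (fun p _ => cf p) (fun _ _ => PI)).
  { intros n. eapply close_ext; [|apply (close_mult _ _ _ _ (nd_dl d) n);
      [apply (close_mult _ _ _ _ (nd_dl d) n);
        [apply (close_freeze d n), (Cg 0%nat); lia|apply (CT n)]|apply (close_cst _ _ _ _ (nd_dl d) n (/2))]].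
    intros p Hp h Hh. split.
    - unfold cf, laz_angle, gf, Tf. rewrite Rplus_0_r. reflexivity.
    - simpl. replace (g0 * (g0 * g0)) with (g0 * g0 * g0) by ring. rewrite g0_cube. field. }
  exists d. repeat match goal with |- _ /\ _ => split end; auto; try apply Hd.
Qed.

(* The conditions on [A2 0] and [Y2 0] are where the exponent 2/3 of the Lazutkin density is used: they make the
   angle and the Lazutkin step proportional up to third order in [h]. *)
Lemma sin_defect_derivatives (A A1 A2 E E1 E2 Y Y1 Y2 : R -> R) (c a : R) :
  0 < a ->
  (forall h, Rabs h < a -> is_derive A h (A1 h)) -> (forall h, Rabs h < a -> is_derive A1 h (A2 h)) ->
  (forall h, Rabs h < a -> is_derive E h (E1 h)) -> (forall h, Rabs h < a -> is_derive E1 h (E2 h)) ->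
  (forall h, Rabs h < a -> is_derive Y h (Y1 h)) -> (forall h, Rabs h < a -> is_derive Y1 h (Y2 h)) ->
  (forall h, Rabs h < a -> 0 < A h * A h + E h * E h) ->
  A 0 = 0 -> E 0 = 1 -> E1 0 = 0 -> Y 0 = 0 -> A1 0 = c * Y1 0 -> A2 0 = c * Y2 0 ->
  exists P1, (forall h, Rabs h < a ->
     is_derive (fun h => A h * / sqrt (A h * A h + E h * E h) - sin (c * Y h)) h (P1 h)) /\
     P1 0 = 0 /\ is_derive P1 0 0.
Proof.
  intros Ha DA DA1 DE DE1 DY DY1 Hpos HA HE HE1 HY HA1 HA2.
  set (N := fun h => sqrt (A h * A h + E h * E h)).
  exists (fun h => A1 h * / N h - A h * ((A h * A1 h + E h * E1 h) * / (N h * (N h * N h))) - cos (c * Y h) * (c * Y1 h)).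
  assert (HN : forall h, Rabs h < a -> 0 < N h) by (intros h Hh; apply sqrt_lt_R0; auto).
  assert (DN : forall h, Rabs h < a -> is_derive N h ((A h * A1 h + E h * E1 h) * / N h)).
  { intros h Hh. unfold N. specialize (HN h Hh). unfold N in HN.
    replace ((A h * A1 h + E h * E1 h) * / sqrt (A h * A h + E h * E h))
      with ((A1 h * A h + A h * A1 h + (E1 h * E h + E h * E1 h)) / (2 * sqrt (A h * A h + E h * E h))) by (field; lra).
    apply (is_derive_sqrt (fun h => A h * A h + E h * E h)); [|auto].
    apply derive_plus; apply (is_derive_mult (K:=R_AbsRing)); auto; intros; apply Rmult_comm. }
  assert (N0 : N 0 = 1).
  { unfold N. rewrite HA, HE. replace (0 * 0 + 1 * 1) with 1 by ring. apply sqrt_1. }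
  assert (H0 : Rabs 0 < a) by (rewrite Rabs_R0; lra).
  split; [|split].
  - intros h Hh. specialize (HN h Hh).
    change (is_derive (fun h => A h * / N h - sin (c * Y h)) h
     (A1 h * / N h - A h * ((A h * A1 h + E h * E1 h) * / (N h * (N h * N h))) - cos (c * Y h) * (c * Y1 h))).
    apply derive_minus.
    + replace (A1 h * / N h - A h * ((A h * A1 h + E h * E1 h) * / (N h * (N h * N h))))
        with (A1 h * / N h + A h * (- ((A h * A1 h + E h * E1 h) * / N h) / N h ^ 2)) by (field; lra).
      apply (is_derive_mult (K:=R_AbsRing) A (fun h => / N h)); [auto| |intros; apply Rmult_comm].
      apply (is_derive_inv N); [auto|lra].
    + replace (cos (c * Y h) * (c * Y1 h)) with ((c * Y1 h) * cos (c * Y h)) by ring.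
      apply (is_derive_comp sin (fun h => c * Y h)); [apply is_derive_Reals, derivable_pt_lim_sin|].
      apply is_derive_scal; auto.
  - rewrite HA, HY, N0, HA1. replace (c * 0) with 0 by ring. rewrite cos_0. req; field.
  - assert (XA := ex_intro (fun l => is_derive A 0 l) _ (DA 0 H0)).
    assert (XA1 := ex_intro (fun l => is_derive A1 0 l) _ (DA1 0 H0)).
    assert (XE := ex_intro (fun l => is_derive E 0 l) _ (DE 0 H0)).
    assert (XE1 := ex_intro (fun l => is_derive E1 0 l) _ (DE1 0 H0)).
    assert (XN := ex_intro (fun l => is_derive N 0 l) _ (DN 0 H0)).
    (* Only the existence of this derivative matters: its value is multiplied by [A 0 = 0]. *)
    assert (XW : ex_derive (fun h => (A h * A1 h + E h * E1 h) * / (N h * (N h * N h))) 0).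
    { auto_derive. repeat split; auto. rewrite N0. lra. }
    destruct XW as [w Hw].
    assert (Ev : (A2 0 * / N 0 + A1 0 * (- ((A 0 * A1 0 + E 0 * E1 0) * / N 0) / N 0 ^ 2))
      - (A1 0 * ((A 0 * A1 0 + E 0 * E1 0) * / (N 0 * (N 0 * N 0))) + A 0 * w)
      - ((c * Y1 0) * (- sin (c * Y 0)) * (c * Y1 0) + cos (c * Y 0) * (c * Y2 0)) = 0).
    { rewrite HA, HE, HE1, HY, N0, HA1, HA2. replace (c * 0) with 0 by ring. rewrite sin_0, cos_0.
      unfold Rdiv. rewrite pow1, Rinv_1. req; ring. }
    refine (eq_rect _ (fun l => is_derive _ 0 l) _ _ Ev).
    apply derive_minus; [apply derive_minus|].
      * apply (is_derive_mult (K:=R_AbsRing) A1 (fun h => / N h)); [auto| |intros; apply Rmult_comm].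
        apply (is_derive_inv N); [auto|rewrite N0; lra].
      * apply (is_derive_mult (K:=R_AbsRing) A (fun h => (A h * A1 h + E h * E1 h) * / (N h * (N h * N h)))); [auto|exact Hw|intros; apply Rmult_comm].
      * apply (is_derive_mult (K:=R_AbsRing) (fun h => cos (c * Y h)) (fun h => c * Y1 h)); [|apply is_derive_scal; auto|intros; apply Rmult_comm].
        apply (is_derive_comp cos (fun h => c * Y h)); [apply is_derive_Reals, derivable_pt_lim_cos|].
        apply is_derive_scal; auto.
Qed.

Lemma power_bound_of_derive (f f' : R -> R) (a M : R) (n : nat) (h : R) :
  0 <= M -> Rabs h < a -> (forall z, Rabs z < a -> is_derive f z (f' z)) -> f 0 = 0 ->
  (forall z, Rabs z < a -> Rabs (f' z) <= M * Rabs z ^ n) -> Rabs (f h) <= M * Rabs h ^ S n.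
Proof.
  intros HM Hh Hd H0 Hb.
  assert (In : forall z, Rmin 0 h <= z <= Rmax 0 h -> Rabs z <= Rabs h).
  { intros z. unfold Rmin, Rmax. destruct (Rle_dec 0 h); intros Hz.
    - rewrite !Rabs_right by lra. lra.
    - rewrite !Rabs_left1 by lra. lra. }
  destruct (MVT_gen f 0 h f') as [c [Hc E]].
  - intros z Hz. apply Hd. specialize (In z ltac:(lra)). lra.
  - intros z Hz. apply continuity_pt_filterlim. eapply derive_cont, Hd. specialize (In z Hz). lra.
  - rewrite H0, !Rminus_0_r in E. rewrite E, Rabs_mult. specialize (In c Hc).
    simpl. rewrite (Rmult_comm (Rabs h)), <- Rmult_assoc. apply Rmult_le_compat_r; [apply Rabs_pos|].
    eapply Rle_trans; [apply Hb; lra|]. apply Rmult_le_compat_l; auto.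
    apply pow_incr. split; [apply Rabs_pos|auto].
Qed.

Lemma average_at0 k F (p : pert) : average pert k F p 0 = F p 0 / INR (S k).
Proof.
  unfold average.
  rewrite (RInt_ext _ (fun t => F p 0 * t ^ k)) by (intros; rewrite Rmult_0_r; req; ring).
  assert (Hk : INR (S k) <> 0) by (apply not_0_INR; lia).
  rewrite (RInt_of_derive (fun t => F p 0 / INR (S k) * t ^ S k)).
  - rewrite pow1, pow_i by lia. req. field; auto.
  - intros t. auto_derive; auto. change (match k with 0%nat => 1 | S _ => INR k + 1 end) with (INR (S k)).
    simpl pred. field; auto.
  - intros t. cder.
Qed.

(** With [g ^ 3 = kappa], both conditions become identities: [A' 0 = kappa / 2] and
    [A'' 0 = kappa' / 3] for the normal component, while [c Y' 0 = g ^ 3 / 2] and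
    [c Y'' 0 = g ^ 2 g']. The tangential component has derivative 0 at 0 because the speed is
    constant. *)
Lemma angle_expansion_conditions : exists d, 0 < d <= 1 /\ forall p, near_disk_le d p ->
  exists P1, (forall h, Rabs h < 3/5 ->
     is_derive (fun h => sine p h - sin (cf p * Yf p h)) h (P1 h)) /\
     P1 0 = 0 /\ is_derive P1 0 0.
Proof.
  destruct close_angle as (d1 & Hd1 & Hchord & _).
  destruct close_lazutkin as (d2 & Hd2 & Hcurv & Hg & Dg & HT & Dlaz & _).
  exists (Rmin d1 d2). assert (Hm : 0 < Rmin d1 d2) by (apply Rmin_glb_lt; lra).
  split; [split; [auto|eapply Rle_trans; [apply Rmin_l|lra]]|].
  intros p [Hp Hpd].
  assert (P1 : near_disk_le d1 p) by (split; auto; eapply Rle_trans; [apply Hpd|apply Rmin_l]).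
  assert (P2 : near_disk_le d2 p) by (split; auto; eapply Rle_trans; [apply Hpd|apply Rmin_r]).
  destruct Hp as (_ & _ & D & _ & U & _).
  set (al1 := fun (p : pert) (h : R) => fx 0 p 0 * fy 1 p h - fy 0 p 0 * fx 1 p h).
  set (al2 := fun (p : pert) (h : R) => fx 0 p 0 * fy 2 p h - fy 0 p 0 * fx 2 p h).
  set (al3 := fun (p : pert) (h : R) => fx 0 p 0 * fy 3 p h - fy 0 p 0 * fx 3 p h).
  set (be1 := fun (p : pert) (h : R) => fx 0 p 0 * fx 1 p h + fy 0 p 0 * fy 1 p h).
  set (be2 := fun (p : pert) (h : R) => fx 0 p 0 * fx 2 p h + fy 0 p 0 * fy 2 p h).
  set (be3 := fun (p : pert) (h : R) => fx 0 p 0 * fx 3 p h + fy 0 p 0 * fy 3 p h).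
  assert (Dx : forall k h, (k <= 7)%nat -> is_derive (fx k p) h (fx (S k) p h)).
  { intros k h Hk. apply is_derive_shift, D, Hk. }
  assert (Dy : forall k h, (k <= 7)%nat -> is_derive (fy k p) h (fy (S k) p h)).
  { intros k h Hk. apply is_derive_shift, D, Hk. }
  assert (Da : forall k h, (k <= 7)%nat -> is_derive (fun h => fx 0 p 0 * fy k p h - fy 0 p 0 * fx k p h) h
     (fx 0 p 0 * fy (S k) p h - fy 0 p 0 * fx (S k) p h)).
  { intros k h Hk. apply derive_minus; apply is_derive_scal; auto. }
  assert (Db : forall k h, (k <= 7)%nat -> is_derive (fun h => fx 0 p 0 * fx k p h + fy 0 p 0 * fy k p h) h
     (fx 0 p 0 * fx (S k) p h + fy 0 p 0 * fy (S k) p h)).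
  { intros k h Hk. apply derive_plus; apply is_derive_scal; auto. }
  assert (U0 : forall h, fx 0 p h * fx 0 p h + fy 0 p h * fy 0 p h = 1).
  { intros h. unfold fx, fy. rewrite <- (U (ps p + h)). ring. }
  assert (U1 : forall h, fx 0 p h * fx 1 p h + fy 0 p h * fy 1 p h = 0).
  { intros h.
    assert (D1 : is_derive (fun h => fx 0 p h * fx 0 p h + fy 0 p h * fy 0 p h) h
       (fx 1 p h * fx 0 p h + fx 0 p h * fx 1 p h + (fy 1 p h * fy 0 p h + fy 0 p h * fy 1 p h))).
    { apply derive_plus; apply (is_derive_mult (K:=R_AbsRing));
        try (intros; apply Rmult_comm); try apply Dx; try apply Dy; lia. }
    assert (D0 : is_derive (fun h => fx 0 p h * fx 0 p h + fy 0 p h * fy 0 p h) h 0).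
    { apply (is_derive_ext (fun _ => 1)); [intros t; symmetry; apply U0|].
      apply derive_const. }
    pose proof (is_derive_unique _ _ _ D1) as E1. rewrite (is_derive_unique _ _ _ D0) in E1. lra. }
  destruct (Dg p P2 (ps p)) as [g' Hg'].
  set (g := cbrt_curv (pdx p) (pdy p)) in *.
  set (Yp := fun h => / Tf p * laz_density (pdx p) (pdy p) (ps p + h)).
  assert (Dg' : forall h, is_derive g (ps p + h) (Derive g (ps p + h))).
  { intros h. apply Derive_correct. apply Dg; auto. }
  set (Ypp := fun h => / Tf p * (Derive g (ps p + h) * g (ps p + h) + g (ps p + h) * Derive g (ps p + h))).
  apply (sin_defect_derivatives (avgA p) (average pert 1 al1 p) (average pert 2 al2 p)
           (avgB p) (average pert 1 be1 p) (average pert 2 be2 p) (Yf p) Yp Ypp (cf p) (3/5)); try lra.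
  - intros h Hh. apply average_derive with (a := 3/5); auto; intros z _.
    + apply (Da 0%nat); lia. + eapply derive_cont, (Da 1%nat); lia.
  - intros h Hh. apply average_derive with (a := 3/5); auto; intros z _.
    + apply (Da 1%nat); lia. + eapply derive_cont, (Da 2%nat); lia.
  - intros h Hh. apply average_derive with (a := 3/5); auto; intros z _.
    + apply (Db 0%nat); lia. + eapply derive_cont, (Db 1%nat); lia.
  - intros h Hh. apply average_derive with (a := 3/5); auto; intros z _.
    + apply (Db 1%nat); lia. + eapply derive_cont, (Db 2%nat); lia.
  - intros h _. unfold Yf, Yp. set (v := / Tf p * _).
    replace v with (minus v zero) by (change (v - 0 = v); ring).
    apply derive_minus;
      [apply is_derive_shift, Dlaz, P2|apply derive_const].
  - intros h _. unfold Yp, Ypp. apply is_derive_scal. unfold laz_density. fold g.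
    apply (is_derive_mult (K:=R_AbsRing) (fun h => g (ps p + h)) (fun h => g (ps p + h)));
      try (apply is_derive_shift, Dg'); intros; apply Rmult_comm.
  - intros h Hh. specialize (Hchord p P1 h Hh). unfold chord_sq in Hchord. lra.
  - unfold avgA. rewrite average_at0. unfold alpha. req. simpl INR. field.
  - unfold avgB. rewrite average_at0. unfold beta. rewrite U0. simpl INR. field.
  - rewrite average_at0. unfold be1. rewrite U1. unfold Rdiv; ring.
  - unfold Yf. rewrite Rplus_0_r. ring.
  - rewrite average_at0. unfold al1, Yp, cf, laz_angle. rewrite Rplus_0_r. unfold laz_density. fold g.
    change (laz_total (pdx p) (pdy p)) with (Tf p). specialize (HT p P2).
    replace (g (ps p) * Tf p * / 2 * (/ Tf p * (g (ps p) * g (ps p)))) with (g (ps p) * g (ps p) * g (ps p) / 2) by (field; lra).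
    unfold g. rewrite cbrt_curv_cube by (specialize (Hcurv p P2 (ps p)); lra).
    unfold curvature, fx, fy. rewrite Rplus_0_r. simpl INR. field.
  - rewrite average_at0. unfold al2, Ypp, cf, laz_angle. rewrite Rplus_0_r. fold g.
    change (laz_total (pdx p) (pdy p)) with (Tf p). specialize (HT p P2).
    (* The derivative of the curvature is computed twice, as a determinant and as the derivative of
       [g ^ 3]; uniqueness gives the relation wanted. *)
    assert (K1 : is_derive (fun h => fx 0 p h * fy 1 p h - fy 0 p h * fx 1 p h) 0
      ((fx 1 p 0 * fy 1 p 0 + fx 0 p 0 * fy 2 p 0) - (fy 1 p 0 * fx 1 p 0 + fy 0 p 0 * fx 2 p 0))).
    { apply derive_minus; apply (is_derive_mult (K:=R_AbsRing));
        try (intros; apply Rmult_comm); try apply Dx; try apply Dy; lia. }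
    pose proof (Dg' 0) as G1. rewrite Rplus_0_r in G1. set (dg := Derive g (ps p)) in *.
    assert (K2 : is_derive (fun h => fx 0 p h * fy 1 p h - fy 0 p h * fx 1 p h) 0
       ((dg * g (ps p + 0) + g (ps p + 0) * dg) * g (ps p + 0) + g (ps p + 0) * g (ps p + 0) * dg)).
    { apply (is_derive_ext (fun h => g (ps p + h) * g (ps p + h) * g (ps p + h))).
      - intros t. unfold g. rewrite cbrt_curv_cube; [reflexivity|].
        specialize (Hcurv p P2 (ps p + t)). lra.
      - assert (G2 : is_derive (fun h => g (ps p + h)) 0 dg) by (apply is_derive_shift; rewrite Rplus_0_r; exact G1).
        apply (is_derive_mult (K:=R_AbsRing) (fun h => g (ps p + h) * g (ps p + h)) (fun h => g (ps p + h)));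
          [|exact G2|intros; apply Rmult_comm].
        apply (is_derive_mult (K:=R_AbsRing) (fun h => g (ps p + h)) (fun h => g (ps p + h)));
          [exact G2|exact G2|intros; apply Rmult_comm]. }
    pose proof (is_derive_unique _ _ _ K1) as E1. rewrite (is_derive_unique _ _ _ K2), Rplus_0_r in E1.
    replace (g (ps p) * Tf p * / 2 * (/ Tf p * (dg * g (ps p) + g (ps p) * dg)))
      with (g (ps p) * g (ps p) * dg) by (field; lra).
    simpl INR. field_simplify. field_simplify in E1. lra.
Qed.

(** On the disk the defect is identically 0, so closeness alone puts the factor [pdl] on its third
    and fourth derivatives; the lower ones vanish exactly at 0. The cubic coefficient stays explicit
    because it is meant to cancel between the two steps at a collision point. *)
Lemma sine_taylor : exists C d, 0 <= C /\ 0 < d <= 1 /\ forall p, near_disk_le d p ->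
  exists p3, Rabs p3 <= C * pdl p /\ forall h, Rabs h < 3/5 ->
    Rabs (sine p h - sin (cf p * Yf p h) - p3 * h ^ 3) <= C * pdl p * h ^ 4.
Proof.
  destruct close_angle as (d1 & Hd1 & Hchord & Cang).
  destruct close_lazutkin as (d2 & Hd2 & _ & _ & _ & _ & _ & _ & _ & CY & Cc).
  destruct angle_expansion_conditions as (d3 & Hd3 & HP).
  set (d := Rmin d1 (Rmin d2 d3)).
  assert (L1 : d <= d1) by apply Rmin_l.
  assert (L2 : d <= d2) by (eapply Rle_trans; [apply Rmin_r|apply Rmin_l]).
  assert (L3 : d <= d3) by (eapply Rle_trans; [apply Rmin_r|apply Rmin_r]).
  assert (Hd : 0 < d) by (apply Rmin_glb_lt; [lra|apply Rmin_glb_lt; lra]).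
  assert (CP : clo d 4 (fun p h => sine p h - sin (cf p * Yf p h)) (fun _ _ => 0)).
  { eapply close_ext; [|apply (close_minus _ _ _ _ (nd_dl d) 4);
      [apply (close_smaller d1); [auto|apply (proj1 (Cang 4%nat ltac:(lia)))]
      |apply (proj1 (close_sin_cos _ _ _ _ (nd_dl d) 4 (fun p h => cf p * Yf p h) (fun p h => PI * h)
         (close_mult _ _ _ _ (nd_dl d) 4 _ _ _ _ (close_smaller d2 d _ _ _ L2 (Cc 4%nat))
            (close_smaller d2 d _ _ _ L2 (CY 4%nat ltac:(lia))))))]].
    intros p Hp h Hh. split; [reflexivity|]. simpl. ring. }
  destruct CP as [_ (F1 & G1 & D1 & _ & F2 & G2 & D2 & _ & F3 & G3 & D3 & [C3 [HC3 B3]] &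
                     F4 & G4 & D4 & [C4 [HC4 B4]] & _)].
  exists (C3 + C4), d. split; [lra|]. split; [lra|]. intros p Hp.
  (* [close] gives the derivatives of the model only existentially; as derivatives of the zero
     function they vanish on the interval. *)
  assert (Z : forall G G' : R -> R, (forall h, Rabs h < 3/5 -> G h = 0) ->
     (forall h, Rabs h < 3/5 -> is_derive G h (G' h)) -> forall h, Rabs h < 3/5 -> G' h = 0).
  { intros G G' H0 HD h Hh. rewrite <- (is_derive_unique _ _ _ (HD h Hh)).
    apply is_derive_unique. apply (is_derive_ext_loc (fun _ => 0)).
    - eapply filter_imp; [|apply (locally_abs_lt (3/5) h Hh)]. intros z Hz. symmetry; auto.
    - apply derive_const. }
  assert (Z1 := Z _ (G1 p) (fun _ _ => eq_refl) (fun h Hh => proj2 (D1 p Hp h Hh))).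
  assert (Z2 := Z _ _ Z1 (fun h Hh => proj2 (D2 p Hp h Hh))).
  assert (Z3 := Z _ _ Z2 (fun h Hh => proj2 (D3 p Hp h Hh))).
  assert (Z4 := Z _ _ Z3 (fun h Hh => proj2 (D4 p Hp h Hh))).
  assert (I0 : Rabs 0 < 3/5) by (rewrite Rabs_R0; lra).
  assert (Hdl := nd_dl d p Hp).
  destruct (HP p) as (P1 & DP1 & P10 & DP10); [destruct Hp; split; auto; lra|].
  assert (E1 : forall h, Rabs h < 3/5 -> F1 p h = P1 h).
  { intros h Hh. rewrite <- (is_derive_unique _ _ _ (proj1 (D1 p Hp h Hh))).
    apply is_derive_unique. auto. }
  assert (F20 : F2 p 0 = 0).
  { rewrite <- (is_derive_unique _ _ _ (proj1 (D2 p Hp 0 I0))). apply is_derive_unique.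
    apply (is_derive_ext_loc P1); auto.
    eapply filter_imp; [|apply (locally_abs_lt (3/5) 0 I0)]. intros z Hz. symmetry; auto. }
  assert (F10 : F1 p 0 = 0) by (rewrite E1; auto).
  set (t := F3 p 0). set (M := (C3 + C4) * pdl p).
  assert (HM : 0 <= M) by (apply Rmult_le_pos; lra).
  assert (HM4 : forall z, Rabs z < 3/5 -> Rabs (F4 p z) <= M).
  { intros z Hz. destruct (B4 p Hp z Hz) as (_ & _ & B). rewrite Z4, Rminus_0_r in B by auto.
    unfold M. nra. }
  assert (Ht : Rabs t <= M).
  { destruct (B3 p Hp 0 I0) as (_ & _ & B). rewrite Z3, Rminus_0_r in B by auto. unfold M, t. nra. }
  exists (t / 6). split.
  { unfold Rdiv. rewrite Rabs_mult, (Rabs_right (/ 6)) by lra. fold M. lra. }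
  intros h Hh. fold M.
  assert (T3 : forall z, Rabs z < 3/5 -> Rabs (F3 p z - t) <= M * Rabs z ^ 1).
  { intros z Hz. apply (power_bound_of_derive (fun z => F3 p z - t) (F4 p) (3/5) M 0 z); auto.
    - intros w Hw. pose proof (proj1 (D4 p Hp w Hw)) as D. rewrite <- (Rminus_0_r (F4 p w)).
      apply derive_minus; [exact D|apply derive_const].
    - unfold t; apply Rminus_diag.
    - intros w Hw. simpl. rewrite Rmult_1_r. auto. }
  assert (T2 : forall z, Rabs z < 3/5 -> Rabs (F2 p z - t * z) <= M * Rabs z ^ 2).
  { intros z Hz. apply (power_bound_of_derive (fun z => F2 p z - t * z) (fun z => F3 p z - t) (3/5) M 1 z); auto.
    - intros w Hw. apply derive_minus; [apply (proj1 (D3 p Hp w Hw))|].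
      auto_derive; auto; ring.
    - rewrite F20. ring. }
  assert (T1 : forall z, Rabs z < 3/5 -> Rabs (F1 p z - t * z ^ 2 / 2) <= M * Rabs z ^ 3).
  { intros z Hz. apply (power_bound_of_derive (fun z => F1 p z - t * z ^ 2 / 2) (fun z => F2 p z - t * z) (3/5) M 2 z); auto.
    - intros w Hw. apply derive_minus; [apply (proj1 (D2 p Hp w Hw))|].
      auto_derive; auto; field.
    - rewrite F10. field. }
  pose proof (power_bound_of_derive (fun z => sine p z - sin (cf p * Yf p z) - t * z ^ 3 / 6)
     (fun z => F1 p z - t * z ^ 2 / 2) (3/5) M 3 h) as T0.
  replace (t / 6 * h ^ 3) with (t * h ^ 3 / 6) by field.
  replace (h ^ 4) with (Rabs h ^ 4).
  - apply T0; auto.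
    + intros w Hw. apply derive_minus; [apply (proj1 (D1 p Hp w Hw))|].
      auto_derive; auto; field.
    + unfold sine, avgA, Yf. rewrite average_at0, Rplus_0_r, Rminus_diag, Rmult_0_r, sin_0.
      unfold alpha. replace (fx 0 p 0 * fy 0 p 0 - fy 0 p 0 * fx 0 p 0) with 0 by ring. field.
      split; [|simpl; lra]. apply Rgt_not_eq, sqrt_lt_R0. destruct Hp as [Hp Hp']. specialize (Hchord p (conj Hp (Rle_trans _ _ _ Hp' L1)) 0 I0). lra.
  - replace (Rabs h ^ 4) with ((Rabs h ^ 2) ^ 2) by ring. rewrite pow2_abs. ring.
Qed.

(** Two precisions are needed. The quadratic estimate carries no factor [pdl], since it is used only
    after multiplication by the cubic coefficient, which already has one. *)
Lemma laz_taylor : exists C d, 0 <= C /\ 0 < d <= 1 /\ forall p, near_disk_le d p ->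
  Rabs (cf p - PI) <= C * pdl p /\
  exists D, Rabs (D - 1) <= C * pdl p /\ forall h, Rabs h < 3/5 ->
    Rabs (Yf p h - h) <= C * pdl p * Rabs h /\ Rabs (Yf p h - D * h) <= C * Rabs h ^ 2.
Proof.
  destruct close_lazutkin as (d & Hd & _ & _ & _ & _ & _ & _ & _ & CY & Cc).
  destruct (Cc 0%nat) as [[C0 [HC0 B0]] _].
  destruct (CY 2%nat ltac:(lia)) as [_ (F1 & G1 & D1 & [C1 [HC1 B1]] & F2 & G2 & D2 & [C2 [HC2 B2]] & _)].
  exists (C0 + C1 + C2), d. split; [lra|]. split; [lra|]. intros p Hp.
  assert (Hdl := nd_dl d p Hp). assert (I0 : Rabs 0 < 3/5) by (rewrite Rabs_R0; lra).
  assert (EG : forall h, Rabs h < 3/5 -> G1 p h = 1).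
  { intros h Hh. rewrite <- (is_derive_unique _ _ _ (proj2 (D1 p Hp h Hh))).
    apply is_derive_unique, (is_derive_id (K:=R_AbsRing)). }
  assert (Y0 : Yf p 0 = 0) by (unfold Yf; rewrite Rplus_0_r; ring).
  split.
  { destruct (B0 p Hp 0 I0) as (_ & _ & B). nra. }
  exists (F1 p 0). split.
  { destruct (B1 p Hp 0 I0) as (_ & _ & B). rewrite EG in B by auto. nra. }
  intros h Hh. split.
  - pose proof (power_bound_of_derive (fun z => Yf p z - z) (fun z => F1 p z - 1) (3/5) (C1 * pdl p) 0 h) as B.
    apply Rle_trans with (C1 * pdl p * Rabs h ^ 1).
    + apply B; auto; [nra| | |].
      * intros z Hz. apply derive_minus; [apply (D1 p Hp z Hz)|apply derive_id].
      * rewrite Y0; ring.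
      * intros z Hz. rewrite pow_O, Rmult_1_r. destruct (B1 p Hp z Hz) as (_ & _ & B'). now rewrite EG in B'.
    + rewrite pow_1. apply Rmult_le_compat_r; [apply Rabs_pos|nra].
  - assert (Q1 : forall z, Rabs z < 3/5 -> Rabs (F1 p z - F1 p 0) <= C2 * Rabs z ^ 1).
    { intros z Hz. apply (power_bound_of_derive (fun z => F1 p z - F1 p 0) (F2 p) (3/5) C2 0 z); auto.
      - intros w Hw. rewrite <- (Rminus_0_r (F2 p w)).
        apply derive_minus; [apply (D2 p Hp w Hw)|apply derive_const].
      - apply Rminus_diag.
      - intros w Hw. rewrite pow_O, Rmult_1_r. apply (B2 p Hp w Hw). }
    apply Rle_trans with (C2 * Rabs h ^ 2).
    + apply (power_bound_of_derive (fun z => Yf p z - F1 p 0 * z) (fun z => F1 p z - F1 p 0) (3/5) C2 1 h); auto.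
      * intros z Hz. apply derive_minus; [apply (D1 p Hp z Hz)|].
        auto_derive; auto; ring.
      * rewrite Y0; ring.
    + apply Rmult_le_compat_r; [apply pow_le, Rabs_pos|lra].
Qed.

(** * Geometry of the boundary curve *)

Lemma interior_max_derive (f : R -> R) (a b c l : R) :
  is_derive f c l -> a < c < b -> (forall t, a < t < b -> f t <= f c) -> l = 0.
Proof.
  intros D Hc Hm. apply is_derive_Reals in D.
  pose (pr := exist (fun l => derivable_pt_abs f c l) l D : derivable_pt f c).
  rewrite <- (derive_pt_eq_0 f c l pr D).
  apply (deriv_maximum f a b c pr); [lra|lra|]. intros; apply Hm; lra.
Qed.

Lemma right_end_max_derive (f : R -> R) (a b l : R) :
  is_derive f b l -> a < b -> (forall t, a < t < b -> f t <= f b) -> 0 <= l.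
Proof.
  intros D Hab Hm. apply is_derive_Reals in D.
  destruct (Rle_dec 0 l) as [|N]; auto. exfalso.
  destruct (D (- l / 2) ltac:(lra)) as [d Hd]. pose proof (cond_pos d).
  set (h := - Rmin (d / 2) ((b - a) / 2)).
  assert (Hh : 0 < - h) by (unfold h; rewrite Ropp_involutive; apply Rmin_glb_lt; lra).
  assert (H1 : - h <= d / 2) by (unfold h; rewrite Ropp_involutive; apply Rmin_l).
  assert (H2 : - h <= (b - a) / 2) by (unfold h; rewrite Ropp_involutive; apply Rmin_r).
  specialize (Hd h ltac:(lra)). rewrite Rabs_left in Hd by lra. specialize (Hd ltac:(lra)).
  specialize (Hm (b + h) ltac:(lra)).
  apply Rabs_def2 in Hd. destruct Hd as [Hd _].
  assert (0 <= (f (b + h) - f b) / h).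
  { replace ((f (b + h) - f b) / h) with ((f b - f (b + h)) / (- h)) by (field; lra).
    apply Rdiv_le_0_compat; lra. }
  lra.
Qed.

Lemma sum_sq_zero (u v : R) : u ^ 2 + v ^ 2 <= 0 -> u = 0 /\ v = 0.
Proof.
  intros H. pose proof (pow2_ge_0 u). pose proof (pow2_ge_0 v).
  split; apply Rsqr_0_uniq; unfold Rsqr; nra.
Qed.

(** Equality in Cauchy-Schwarz would make [u] and [v] positive multiples of one another, and then
    their cross products with [n] would have the same sign. *)
Lemma norm_triangle_strict (n1 n2 u1 u2 v1 v2 : R) :
  n1 * u2 - n2 * u1 < 0 -> 0 < n1 * v2 - n2 * v1 ->
  sqrt ((u1 + v1) ^ 2 + (u2 + v2) ^ 2) < sqrt (u1 ^ 2 + u2 ^ 2) + sqrt (v1 ^ 2 + v2 ^ 2).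
Proof.
  intros Hu Hv.
  set (p := sqrt (u1 ^ 2 + u2 ^ 2)). set (r := sqrt (v1 ^ 2 + v2 ^ 2)).
  assert (Ep : p * p = u1 ^ 2 + u2 ^ 2) by (apply sqrt_sqrt; nra).
  assert (Er : r * r = v1 ^ 2 + v2 ^ 2) by (apply sqrt_sqrt; nra).
  assert (Hp : 0 <= p) by apply sqrt_pos. assert (Hr : 0 <= r) by apply sqrt_pos.
  assert (Hp' : 0 < p).
  { destruct Hp as [|E]; auto. exfalso. rewrite <- E in Ep.
    destruct (sum_sq_zero u1 u2 ltac:(lra)). subst. lra. }
  assert (Hr' : 0 < r).
  { destruct Hr as [|E]; auto. exfalso. rewrite <- E in Er.
    destruct (sum_sq_zero v1 v2 ltac:(lra)). subst. lra. }
  assert (K : u1 * v1 + u2 * v2 < p * r).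
  { destruct (Rlt_dec (u1 * v1 + u2 * v2) (p * r)) as [|N]; auto. exfalso.
    assert (Z : (p * v1 - r * u1) ^ 2 + (p * v2 - r * u2) ^ 2 <= 0).
    { replace ((p * v1 - r * u1) ^ 2 + (p * v2 - r * u2) ^ 2)
        with ((p * p) * (v1 ^ 2 + v2 ^ 2) + (r * r) * (u1 ^ 2 + u2 ^ 2) - 2 * (p * r) * (u1 * v1 + u2 * v2)) by ring.
      rewrite <- Ep, <- Er. assert (0 < p * r) by nra. nra. }
    destruct (sum_sq_zero _ _ Z) as [Z1' Z2'].
    assert (Z1 : p * v1 = r * u1) by lra. assert (Z2 : p * v2 = r * u2) by lra.
    assert (p * (n1 * v2 - n2 * v1) = r * (n1 * u2 - n2 * u1)).
    { replace (p * (n1 * v2 - n2 * v1)) with (n1 * (p * v2) - n2 * (p * v1)) by ring.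
      rewrite Z1, Z2. ring. }
    nra. }
  rewrite <- (sqrt_pow2 (p + r)) by lra. apply sqrt_lt_1_alt. split; [apply Rplus_le_le_0_compat; apply pow2_ge_0|nra].
Qed.

Lemma norm_triangle (u1 u2 v1 v2 : R) :
  sqrt ((u1 + v1) ^ 2 + (u2 + v2) ^ 2) <= sqrt (u1 ^ 2 + u2 ^ 2) + sqrt (v1 ^ 2 + v2 ^ 2).
Proof.
  set (p := sqrt (u1 ^ 2 + u2 ^ 2)). set (r := sqrt (v1 ^ 2 + v2 ^ 2)).
  assert (Ep : p * p = u1 ^ 2 + u2 ^ 2) by (apply sqrt_sqrt; nra).
  assert (Er : r * r = v1 ^ 2 + v2 ^ 2) by (apply sqrt_sqrt; nra).
  assert (Hp : 0 <= p) by apply sqrt_pos. assert (Hr : 0 <= r) by apply sqrt_pos.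
  rewrite <- (sqrt_pow2 (p + r)) by lra. apply sqrt_le_1_alt.
  assert (u1 * v1 + u2 * v2 <= p * r).
  { apply Rsqr_incr_0_var; [|nra]. unfold Rsqr.
    replace (p * r * (p * r)) with ((p * p) * (r * r)) by ring. rewrite Ep, Er.
    pose proof (pow2_ge_0 (u1 * v2 - u2 * v1)). nra. }
  nra.
Qed.

Section Curve.
Variables (x y : R -> R) (dx dy : nat -> R -> R).
Hypothesis BC : boundary_curve x y dx dy.
Hypothesis SM : symmetric_marked x y.

Lemma curve_derive k s : (k <= 8)%nat ->
  is_derive (dx k) s (dx (S k) s) /\ is_derive (dy k) s (dy (S k) s).
Proof.
  intros Hk. destruct BC as ((_ & Dx & _) & (_ & Dy & _) & _).
  split; apply is_derive_Reals; [apply Dx|apply Dy]; unfold r_reg; lia.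
Qed.

Lemma curve_derive0 s : is_derive x s (dx 1%nat s) /\ is_derive y s (dy 1%nat s).
Proof.
  destruct (curve_derive 0 s ltac:(lia)) as [A B].
  destruct BC as ((Ex & _) & (Ey & _) & _).
  split; [apply (is_derive_ext (dx 0%nat))|apply (is_derive_ext (dy 0%nat))]; auto.
Qed.

Lemma Derive_x s : Derive x s = dx 1%nat s.
Proof. apply is_derive_unique, curve_derive0. Qed.

Lemma Derive_y s : Derive y s = dy 1%nat s.
Proof. apply is_derive_unique, curve_derive0. Qed.

Lemma curve_periodic k s : (k <= 9)%nat -> dx k (s + 1) = dx k s /\ dy k (s + 1) = dy k s.
Proof.
  intros Hk. assert (L : (forall s, dx k (s + 1) = dx k s) /\ (forall s, dy k (s + 1) = dy k s)).
  { induction k as [|k IH].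
    - destruct BC as ((Ex & _) & (Ey & _) & P & _). split; intros; rewrite ?Ex, ?Ey; apply P.
    - destruct (IH ltac:(lia)) as [I1 I2].
      split; [apply (periodic_derive (dx k))|apply (periodic_derive (dy k))]; auto;
        intros t; apply curve_derive; lia. }
  split; apply L.
Qed.

Lemma point_periodic s : x (s + 1) = x s /\ y (s + 1) = y s.
Proof. destruct BC as (_ & _ & P & _). apply P. Qed.

Lemma point_periodic_minus s : x (s - 1) = x s /\ y (s - 1) = y s.
Proof.
  destruct (point_periodic (s - 1)) as [A B]. replace (s - 1 + 1) with s in * by ring. now rewrite A, B.
Qed.

Lemma tangent_periodic_minus s : dx 1%nat (s - 1) = dx 1%nat s /\ dy 1%nat (s - 1) = dy 1%nat s.
Proof.
  destruct (curve_periodic 1 (s - 1) ltac:(lia)) as [A B].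
  replace (s - 1 + 1) with s in * by ring. now rewrite A, B.
Qed.

Lemma unit_speed s : dx 1%nat s ^ 2 + dy 1%nat s ^ 2 = 1.
Proof. destruct BC as (_ & _ & _ & U & _). apply U. Qed.

Lemma convex_cross s t : 0 < Rabs (t - s) < 1 ->
  0 < cross (dx 1%nat s) (dy 1%nat s) (x t - x s) (y t - y s).
Proof.
  intros Ht. destruct BC as (_ & _ & _ & _ & Cv). apply Rgt_lt, Cv. intros n E.
  rewrite E in Ht. rewrite <- abs_IZR in Ht. destruct Ht as [H1 H2].
  apply lt_IZR in H1. apply lt_IZR in H2. lia.
Qed.

(** Up to sign, these cosines are the derivatives of the chord length with respect to its two ends;
    stationarity of the length therefore appears directly as an equality of cosines. *)
Definition cos_depart (a b : R) : R :=
  (dx 1%nat a * (x b - x a) + dy 1%nat a * (y b - y a)) / chord x y a b.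
Definition cos_arrive (a b : R) : R :=
  (dx 1%nat b * (x b - x a) + dy 1%nat b * (y b - y a)) / chord x y a b.

Lemma chord_sym a b : chord x y a b = chord x y b a.
Proof. unfold chord. f_equal. ring. Qed.

Lemma chord_refl a : chord x y a a = 0.
Proof. unfold chord. rewrite !Rminus_diag. rewrite pow_i by lia. rewrite Rplus_0_r. apply sqrt_0. Qed.

Lemma chord_nonneg a b : 0 <= chord x y a b.
Proof. apply sqrt_pos. Qed.

Lemma chord_sq_pos a b : 0 < Rabs (b - a) < 1 -> 0 < (x b - x a) ^ 2 + (y b - y a) ^ 2.
Proof.
  intros H. pose proof (convex_cross a b H) as C. unfold cross in C.
  destruct (Rlt_dec 0 ((x b - x a) ^ 2 + (y b - y a) ^ 2)) as [|N]; auto.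
  destruct (sum_sq_zero (x b - x a) (y b - y a) ltac:(lra)) as [E1 E2].
  rewrite E1, E2 in C. lra.
Qed.

Lemma chord_pos a b : 0 < Rabs (b - a) < 1 -> 0 < chord x y a b.
Proof. intros H. apply sqrt_lt_R0. now apply chord_sq_pos. Qed.

Lemma chord_triangle a b c : chord x y a c <= chord x y a b + chord x y b c.
Proof.
  unfold chord.
  replace (x c - x a) with ((x b - x a) + (x c - x b)) by ring.
  replace (y c - y a) with ((y b - y a) + (y c - y b)) by ring. apply norm_triangle.
Qed.

(** Both ends lie strictly to the left of the tangent at [t], which is the separating direction for
    [norm_triangle_strict]. *)
Lemma chord_triangle_strict a t b : a < t < b -> b - a < 1 ->
  chord x y a b < chord x y a t + chord x y t b.
Proof.
  intros Ht Hab. unfold chord.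
  replace (x b - x a) with ((x t - x a) + (x b - x t)) by ring.
  replace (y b - y a) with ((y t - y a) + (y b - y t)) by ring.
  apply (norm_triangle_strict (dx 1%nat t) (dy 1%nat t)).
  - pose proof (convex_cross t a) as C. rewrite Rabs_left in C by lra. specialize (C ltac:(lra)).
    unfold cross in C. lra.
  - pose proof (convex_cross t b) as C. rewrite Rabs_right in C by lra. specialize (C ltac:(lra)).
    unfold cross in C. lra.
Qed.

Lemma chord_derive_r a t : 0 < Rabs (t - a) < 1 -> is_derive (fun t => chord x y a t) t (cos_arrive a t).
Proof.
  intros H. pose proof (chord_sq_pos a t H) as P. pose proof (chord_pos a t H) as P'.
  unfold chord. destruct (curve_derive0 t) as [D1 D2].
  replace (cos_arrive a t) with ((2 * (x t - x a) * dx 1%nat t + 2 * (y t - y a) * dy 1%nat t)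
     / (2 * sqrt ((x t - x a) ^ 2 + (y t - y a) ^ 2)))
    by (unfold cos_arrive; fold (chord x y a t); field; lra).
  apply (is_derive_sqrt (fun t => (x t - x a) ^ 2 + (y t - y a) ^ 2)); auto.
  auto_derive; [repeat split; eexists; eauto|].
  rewrite !Derive_x, !Derive_y. ring.
Qed.

Lemma chord_derive_l b t : 0 < Rabs (t - b) < 1 -> is_derive (fun t => chord x y t b) t (- cos_depart t b).
Proof.
  intros H. apply (is_derive_ext (fun t => chord x y b t)); [intros; apply chord_sym|].
  replace (- cos_depart t b) with (cos_arrive b t); [now apply chord_derive_r|].
  unfold cos_arrive, cos_depart. rewrite (chord_sym t b). unfold Rdiv. ring.
Qed.

Lemma chord_shift_l a b : chord x y (a - 1) b = chord x y a b.
Proof. unfold chord. destruct (point_periodic_minus a) as [-> ->]. reflexivity. Qed.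

Lemma chord_shift_r a b : chord x y a (b - 1) = chord x y a b.
Proof. unfold chord. destruct (point_periodic_minus b) as [-> ->]. reflexivity. Qed.

Lemma cos_depart_shift_r a b : cos_depart a (b - 1) = cos_depart a b.
Proof. unfold cos_depart. rewrite chord_shift_r. destruct (point_periodic_minus b) as [-> ->]. reflexivity. Qed.

Lemma cos_arrive_shift_l a b : cos_arrive (a - 1) b = cos_arrive a b.
Proof. unfold cos_arrive. rewrite chord_shift_l. destruct (point_periodic_minus a) as [-> ->]. reflexivity. Qed.

(** One and the same axis is carried through two derivatives, so that chords, angles and curvature
    inherit the symmetry together; the parameter reversal gives the first derivative an extra
    sign. *)
Lemma reflection : exists px py ux uy, ux ^ 2 + uy ^ 2 = 1 /\
  (forall s, x (- s) = px + 2 * ((x s - px) * ux + (y s - py) * uy) * ux - (x s - px) /\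
             y (- s) = py + 2 * ((x s - px) * ux + (y s - py) * uy) * uy - (y s - py)) /\
  (forall s, dx 1%nat (- s) = - (2 * (dx 1%nat s * ux + dy 1%nat s * uy) * ux - dx 1%nat s) /\
             dy 1%nat (- s) = - (2 * (dx 1%nat s * ux + dy 1%nat s * uy) * uy - dy 1%nat s)) /\
  (forall s, dx 2%nat (- s) = 2 * (dx 2%nat s * ux + dy 2%nat s * uy) * ux - dx 2%nat s /\
             dy 2%nat (- s) = 2 * (dx 2%nat s * ux + dy 2%nat s * uy) * uy - dy 2%nat s).
Proof.
  destruct SM as (px & py & ux & uy & Hu & Hr). exists px, py, ux, uy.
  assert (Opp : forall (f : R -> R) s l, is_derive f (- s) l -> is_derive (fun z => f (- z)) s (- l)).
  { intros f s l D. replace (- l) with (-1 * l) by ring.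
    apply (is_derive_comp f (fun z => - z)); auto. auto_derive; auto. }
  assert (R1 : forall s, x (- s) = px + 2 * ((x s - px) * ux + (y s - py) * uy) * ux - (x s - px) /\
             y (- s) = py + 2 * ((x s - px) * ux + (y s - py) * uy) * uy - (y s - py)) by (intros s; apply Hr).
  assert (Ex1 : forall s, ex_derive x s) by (intros s; exact (ex_intro _ _ (proj1 (curve_derive0 s)))).
  assert (Ey1 : forall s, ex_derive y s) by (intros s; exact (ex_intro _ _ (proj2 (curve_derive0 s)))).
  assert (Dx1 := Derive_x). assert (Dy1 := Derive_y).
  assert (R2 : forall s, dx 1%nat (- s) = - (2 * (dx 1%nat s * ux + dy 1%nat s * uy) * ux - dx 1%nat s) /\
             dy 1%nat (- s) = - (2 * (dx 1%nat s * ux + dy 1%nat s * uy) * uy - dy 1%nat s)).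
  { intros s. split; apply Ropp_eq_reg; rewrite Ropp_involutive.
    - transitivity (Derive (fun z => x (- z)) s).
      + symmetry. apply is_derive_unique, Opp, curve_derive0.
      + apply is_derive_unique.
        apply (is_derive_ext (fun s => px + 2 * ((x s - px) * ux + (y s - py) * uy) * ux - (x s - px)));
          [intros t; symmetry; apply R1|].
        auto_derive; [repeat split; auto|]. rewrite Dx1, Dy1. ring.
    - transitivity (Derive (fun z => y (- z)) s).
      + symmetry. apply is_derive_unique, Opp, curve_derive0.
      + apply is_derive_unique.
        apply (is_derive_ext (fun s => py + 2 * ((x s - px) * ux + (y s - py) * uy) * uy - (y s - py)));
          [intros t; symmetry; apply R1|].
        auto_derive; [repeat split; auto|]. rewrite Dx1, Dy1. ring. }
  split; auto. split; auto. split; auto.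
  assert (E2 : forall s, ex_derive (dx 1%nat) s /\ ex_derive (dy 1%nat) s).
  { intros s; destruct (curve_derive 1 s ltac:(lia)); split; eexists; eauto. }
  assert (D2x : forall s, Derive (dx 1%nat) s = dx 2%nat s)
    by (intros s; destruct (curve_derive 1 s ltac:(lia)); apply is_derive_unique; auto).
  assert (D2y : forall s, Derive (dy 1%nat) s = dy 2%nat s)
    by (intros s; destruct (curve_derive 1 s ltac:(lia)); apply is_derive_unique; auto).
  intros s. destruct (E2 s) as [E2x E2y]. split; apply Ropp_eq_reg.
  - transitivity (Derive (fun z => dx 1%nat (- z)) s).
    + symmetry. apply is_derive_unique, Opp, curve_derive; lia.
    + apply is_derive_unique.
      apply (is_derive_ext (fun s => - (2 * (dx 1%nat s * ux + dy 1%nat s * uy) * ux - dx 1%nat s)));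
        [intros t; symmetry; apply R2|].
      auto_derive; [repeat split; auto|]. rewrite D2x, D2y. ring.
  - transitivity (Derive (fun z => dy 1%nat (- z)) s).
    + symmetry. apply is_derive_unique, Opp, curve_derive; lia.
    + apply is_derive_unique.
      apply (is_derive_ext (fun s => - (2 * (dx 1%nat s * ux + dy 1%nat s * uy) * uy - dy 1%nat s)));
        [intros t; symmetry; apply R2|].
      auto_derive; [repeat split; auto|]. rewrite D2x, D2y. ring.
Qed.

Lemma chord_opp a b : chord x y (- a) (- b) = chord x y a b.
Proof.
  destruct reflection as (px & py & ux & uy & Hu & Hr & _). unfold chord.
  destruct (Hr a) as [-> ->]. destruct (Hr b) as [-> ->]. f_equal.
  set (A := x a). set (B := y a). set (C := x b). set (E := y b).
  transitivity ((C - A) ^ 2 + (E - B) ^ 2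
     + 4 * ((C - A) * ux + (E - B) * uy) ^ 2 * ((ux ^ 2 + uy ^ 2) - 1)); [ring|]. rewrite Hu. ring.
Qed.

Lemma dot_opp a b :
  dx 1%nat (- a) * (x (- b) - x (- a)) + dy 1%nat (- a) * (y (- b) - y (- a)) =
  - (dx 1%nat a * (x b - x a) + dy 1%nat a * (y b - y a)).
Proof.
  destruct reflection as (px & py & ux & uy & Hu & Hr & Hr' & _).
  destruct (Hr a) as [-> ->]. destruct (Hr b) as [-> ->]. destruct (Hr' a) as [-> ->].
  set (A := x a). set (B := y a). set (C := x b). set (E := y b).
  set (P := dx 1%nat a). set (Q := dy 1%nat a).
  transitivity (- (P * (C - A) + Q * (E - B))
     - 4 * ((C - A) * ux + (E - B) * uy) * (P * ux + Q * uy) * ((ux ^ 2 + uy ^ 2) - 1)); [ring|].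
  rewrite Hu. ring.
Qed.

Lemma curvature_even s : curvature dx dy (- s) = curvature dx dy s.
Proof.
  destruct reflection as (px & py & ux & uy & Hu & _ & Hr' & Hr''). unfold curvature.
  destruct (Hr' s) as [-> ->]. destruct (Hr'' s) as [-> ->].
  set (P := dx 1%nat s). set (Q := dy 1%nat s). set (A := dx 2%nat s). set (B := dy 2%nat s).
  transitivity ((P * B - Q * A) * (2 * (ux ^ 2 + uy ^ 2) - 1)); [ring|]. rewrite Hu. ring.
Qed.

Lemma cos_depart_opp a b : cos_depart (- a) (- b) = cos_arrive b a.
Proof.
  unfold cos_depart, cos_arrive. rewrite dot_opp, chord_opp, (chord_sym b a). unfold Rdiv. ring.
Qed.

Lemma cos_depart_mirror a b : cos_depart (1 - a) (1 - b) = cos_arrive b a.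
Proof.
  rewrite <- cos_depart_opp. unfold cos_depart.
  destruct (tangent_periodic_minus (1 - a)) as [T1 T2]. rewrite <- T1, <- T2.
  rewrite <- (chord_shift_l (1 - a) (1 - b)), <- (chord_shift_r _ (1 - b)).
  destruct (point_periodic_minus (1 - a)) as [<- <-]. destruct (point_periodic_minus (1 - b)) as [<- <-].
  replace (1 - a - 1) with (- a) by ring. replace (1 - b - 1) with (- b) by ring. reflexivity.
Qed.

Lemma cos_arrive_mirror a b : cos_arrive (1 - a) (1 - b) = cos_depart b a.
Proof.
  rewrite <- (cos_depart_mirror (1 - b) (1 - a)). f_equal; ring.
Qed.

Lemma chord_mirror a b : chord x y (1 - a) (1 - b) = chord x y a b.
Proof.
  rewrite <- chord_shift_l, <- chord_shift_r, <- (chord_opp a b). f_equal; ring.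
Qed.

(** Both ends of the self-chord move symmetrically, so the derivative is twice that of one end. This
    2 matches the double weight of the other chords in [Lq], and stationarity is again the
    reflection law. *)
Lemma chord_self_derive t : 0 < t < 1 / 2 -> is_derive (fun t => chord x y t (- t)) t (- 2 * cos_depart t (1 - t)).
Proof.
  intros Ht.
  assert (HT : 0 < Rabs (1 - t - t) < 1) by (rewrite Rabs_right; lra).
  pose proof (chord_sq_pos t (1 - t) HT) as P. pose proof (chord_pos t (1 - t) HT) as P'.
  rewrite <- cos_depart_shift_r. replace (1 - t - 1) with (- t) by ring.
  rewrite <- chord_shift_r in P'. replace (1 - t - 1) with (- t) in P' by ring.
  destruct (point_periodic_minus (1 - t)) as [E1 E2]. rewrite <- E1, <- E2 in P.
  replace (1 - t - 1) with (- t) in P by ring. clear E1 E2.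
  unfold chord. destruct (curve_derive0 t) as [D1 D2]. destruct (curve_derive0 (- t)) as [D3 D4].
  pose proof (dot_opp t (- t)) as S. rewrite Ropp_involutive in S.
  replace (-2 * cos_depart t (- t)) with ((- 2 * (x (- t) - x t) * (dx 1%nat (- t) + dx 1%nat t)
      - 2 * (y (- t) - y t) * (dy 1%nat (- t) + dy 1%nat t))
     / (2 * sqrt ((x (- t) - x t) ^ 2 + (y (- t) - y t) ^ 2))).
  2:{ unfold cos_depart. fold (chord x y t (- t)).
      replace (-2 * (x (- t) - x t) * (dx 1%nat (- t) + dx 1%nat t) - 2 * (y (- t) - y t) * (dy 1%nat (- t) + dy 1%nat t))
        with (2 * (dx 1%nat (- t) * (x t - x (- t)) + dy 1%nat (- t) * (y t - y (- t)))
              - 2 * (dx 1%nat t * (x (- t) - x t) + dy 1%nat t * (y (- t) - y t))) by ring.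
      rewrite S. field. lra. }
  apply (is_derive_sqrt (fun t => (x (- t) - x t) ^ 2 + (y (- t) - y t) ^ 2)); auto.
  auto_derive; [repeat split; eexists; eauto|]. rewrite !Derive_x, !Derive_y. ring.
Qed.

Lemma cos_arrive_lt_1 a b : 0 < Rabs (b - a) < 1 -> cos_arrive a b < 1.
Proof.
  intros H. pose proof (chord_pos a b H) as P.
  unfold cos_arrive. apply (Rmult_lt_reg_r (chord x y a b)); auto.
  unfold Rdiv. rewrite Rmult_assoc, Rinv_l, Rmult_1_r, Rmult_1_l by lra.
  rewrite Rabs_minus_sym in H. pose proof (convex_cross b a H) as C. unfold cross in C.
  pose proof (unit_speed b) as U.
  assert (E : chord x y a b * chord x y a b = (x b - x a) ^ 2 + (y b - y a) ^ 2).
  { apply sqrt_sqrt, Rplus_le_le_0_compat; apply pow2_ge_0. }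
  set (l := chord x y a b) in *. set (X := x b - x a) in *. set (Y := y b - y a) in *.
  replace (x a - x b) with (- X) in C by (unfold X; ring).
  replace (y a - y b) with (- Y) in C by (unfold Y; ring).
  set (P1 := dx 1%nat b) in *. set (Q1 := dy 1%nat b) in *.
  assert (F : (P1 * X + Q1 * Y) ^ 2 + (P1 * Y - Q1 * X) ^ 2 = l * l).
  { rewrite E. transitivity ((P1 ^ 2 + Q1 ^ 2) * (X ^ 2 + Y ^ 2)); [ring|rewrite U; ring]. }
  nra.
Qed.

(* For odd [q] a collision at the auxiliary point is excluded to first order: moving the last point by [e] towards the
   origin gains [2 e] on the self-chord and costs [2 e cos], where [cos < 1] is the cosine of the angle of the last
   chord with the tangent. *)
Lemma self_chord_not_max_at_half a : 0 <= a < 1 / 2 ->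
  ~ (forall t, a <= t <= 1 / 2 ->
      2 * chord x y a t + chord x y t (- t) <= 2 * chord x y a (1 / 2) + chord x y (1 / 2) (- (1 / 2))).
Proof.
  intros Ha Hm.
  destruct reflection as (px & py & ux & uy & Hu & Hr & Hr' & _).
  (* The signed distance to the axis. The self-chord is [2 |d|], which has a corner at 1/2, whereas
     [d] is differentiable there. *)
  set (d := fun t => - (x t - px) * uy + (y t - py) * ux).
  assert (Ed : forall t, chord x y t (- t) = 2 * Rabs (d t)).
  { intros t. unfold chord. destruct (Hr t) as [-> ->].
    replace (2 * Rabs (d t)) with (sqrt ((2 * d t) ^ 2)).
    - f_equal. unfold d. set (A := x t - px). set (B := y t - py).
      replace (px + 2 * (A * ux + B * uy) * ux - A - x t) with (2 * (A * ux + B * uy) * ux - 2 * A) by (unfold A; ring).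
      replace (py + 2 * (A * ux + B * uy) * uy - B - y t) with (2 * (A * ux + B * uy) * uy - 2 * B) by (unfold B; ring).
      transitivity (4 * ((A * ux + B * uy) ^ 2 * (ux ^ 2 + uy ^ 2) - 2 * (A * ux + B * uy) ^ 2 + A ^ 2 + B ^ 2)); [ring|].
      rewrite Hu. transitivity (4 * (A ^ 2 + B ^ 2) * (ux ^ 2 + uy ^ 2) - 4 * (A * ux + B * uy) ^ 2); [rewrite Hu; ring|ring].
    - rewrite <- Rsqr_pow2, sqrt_Rsqr_abs, Rabs_mult, (Rabs_right 2) by lra. reflexivity. }
  set (d1 := - dx 1%nat (1/2) * uy + dy 1%nat (1/2) * ux).
  assert (Dd : is_derive d (1/2) d1).
  { destruct (curve_derive0 (1/2)) as [D1 D2].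
    unfold d. auto_derive; [repeat split; eexists; eauto|]. rewrite !Derive_x, !Derive_y. unfold d1; ring. }
  assert (Hper : dx 1%nat (- (1/2)) = dx 1%nat (1/2) /\ dy 1%nat (- (1/2)) = dy 1%nat (1/2)).
  { replace (- (1/2)) with (1/2 - 1) by field. apply tangent_periodic_minus. }
  assert (Hd0 : d (1/2) = 0).
  { assert (E : chord x y (1/2) (- (1/2)) = 0).
    { replace (- (1/2)) with (1/2 - 1) by field. rewrite chord_shift_r. apply chord_refl. }
    rewrite Ed in E. destruct (Req_dec (d (1/2)) 0) as [|N]; auto. apply Rabs_pos_lt in N. lra. }
  (* At 1/2 the reflection reverses the tangent, which is therefore orthogonal to the axis. *)
  assert (Hd1 : d1 ^ 2 = 1).
  { destruct (Hr' (1/2)) as [R1 R2]. destruct Hper as [P1 P2]. rewrite P1 in R1. rewrite P2 in R2.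
    pose proof (unit_speed (1/2)) as U. unfold d1.
    set (P := dx 1%nat (1/2)) in *. set (Q := dy 1%nat (1/2)) in *.
    assert (T1 : (P * ux + Q * uy) * ux = 0) by lra. assert (T2 : (P * ux + Q * uy) * uy = 0) by lra.
    assert (T : (P * ux + Q * uy) ^ 2 = 0).
    { transitivity (((P * ux + Q * uy) * ux) * P + ((P * ux + Q * uy) * uy) * Q); [ring|rewrite T1, T2; ring]. }
    transitivity ((P ^ 2 + Q ^ 2) * (ux ^ 2 + uy ^ 2) - (P * ux + Q * uy) ^ 2); [ring|rewrite U, Hu, T; ring]. }
  assert (Hab : 0 < Rabs (1/2 - a) < 1) by (rewrite Rabs_right; lra).
  pose proof (cos_arrive_lt_1 a (1/2) Hab) as Hc.
  pose proof (chord_derive_r a (1/2) Hab) as Dc.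
  (* The smooth function with [- d1 * d] in place of [|d|] lies below the original one and agrees
     with it at 1/2, so it inherits the maximum; its one-sided derivative there contradicts
     [cos_arrive < 1]. *)
  assert (0 <= 2 * cos_arrive a (1/2) + 2 * (- d1 * d1)).
  { apply (right_end_max_derive (fun t => 2 * chord x y a t + 2 * (- d1 * d t)) a (1/2)); [|lra|].
    - apply derive_plus; apply is_derive_scal; [exact Dc|].
      apply is_derive_scal; exact Dd.
    - intros t Ht. specialize (Hm t ltac:(lra)). rewrite Hd0.
      rewrite !Ed, Hd0, Rabs_R0 in Hm.
      assert (- d1 * d t <= Rabs (d t)).
      { eapply Rle_trans; [apply Rle_abs|]. rewrite Rabs_mult, Rabs_Ropp.
        assert (Rabs d1 = 1).
        { rewrite <- sqrt_Rsqr_abs, Rsqr_pow2, Hd1. apply sqrt_1. }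
        rewrite H. lra. }
      lra. }
  nra.
Qed.
End Curve.

(** * Maximal symmetric orbits *)

Definition update (s : nat -> R) (i : nat) (t : R) (n : nat) : R := if (n =? i)%nat then t else s n.

Lemma update_eq s i t : update s i t i = t.
Proof. unfold update. now rewrite Nat.eqb_refl. Qed.

Lemma update_neq s i t n : n <> i -> update s i t n = s n.
Proof. intros H. unfold update. now rewrite (proj2 (Nat.eqb_neq n i) H). Qed.

Lemma sumR_update_interior (F : R -> R -> R) s i m t :
  sumR (i + (2 + m)) (fun j => F (update s (S i) t j) (update s (S i) t (S j))) =
  sumR (i + (2 + m)) (fun j => F (s j) (s (S j)))
  - (F (s i) (s (S i)) + F (s (S i)) (s (S (S i)))) + (F (s i) t + F t (s (S (S i)))).
Proof.
  rewrite !sumR_add. cbn [sumR].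
  rewrite !Nat.add_0_r, !Nat.add_1_r.
  rewrite (sumR_ext i (fun j => F (update s (S i) t j) (update s (S i) t (S j))) (fun j => F (s j) (s (S j)))).
  2:{ intros j Hj. rewrite !update_neq by lia. reflexivity. }
  rewrite (sumR_ext m (fun k => F (update s (S i) t (i + (2 + k))%nat) (update s (S i) t (S (i + (2 + k)))))
     (fun k => F (s (i + (2 + k))%nat) (s (S (i + (2 + k)))))).
  2:{ intros j Hj. rewrite !update_neq by lia. reflexivity. }
  rewrite update_eq, (update_neq s (S i) t i), (update_neq s (S i) t (S (S i))) by lia. ring.
Qed.

Lemma sumR_update_last (F : R -> R -> R) s i t :
  sumR (S i) (fun j => F (update s (S i) t j) (update s (S i) t (S j))) =
  sumR (S i) (fun j => F (s j) (s (S j))) - F (s i) (s (S i)) + F (s i) t.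
Proof.
  cbn [sumR].
  rewrite (sumR_ext i (fun j => F (update s (S i) t j) (update s (S i) t (S j))) (fun j => F (s j) (s (S j)))).
  2:{ intros j Hj. rewrite !update_neq by lia. reflexivity. }
  rewrite update_eq, (update_neq s (S i) t i) by lia. ring.
Qed.

Section Maximizer.
Variables (x y : R -> R) (dx dy : nat -> R -> R).
Hypothesis BC : boundary_curve x y dx dy.
Hypothesis SM : symmetric_marked x y.
Variables (q : nat) (s : nat -> R).
Hypothesis Hq : (2 <= q)%nat.
Hypothesis HM : maximizer x y q s.

Let k := half q.

Lemma half_spec : (1 <= k)%nat /\ (if Nat.even q then q = (2 * k)%nat else q = (2 * k + 1)%nat).
Proof.
  unfold k, half. pose proof (Nat.div2_odd q) as E. rewrite <- Nat.negb_even in E.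
  destruct (Nat.even q); simpl Nat.b2n in E; simpl negb in E; simpl in E; lia.
Qed.

Lemma adm_le i j : (i <= j)%nat -> (j <= k)%nat -> s i <= s j.
Proof.
  destruct HM as [(_ & Mon & _) _]. fold k in Mon. intros Hij. induction Hij; intros Hk; [lra|].
  eapply Rle_trans; [apply IHHij; lia|apply Mon; lia].
Qed.

Lemma adm_range i : (i <= k)%nat -> 0 <= s i <= 1 / 2.
Proof.
  intros Hi. destruct HM as [(H0 & _ & HL) _]. split.
  - rewrite <- H0. apply adm_le; lia.
  - eapply Rle_trans; [apply (adm_le i k); lia|]. fold k in HL. destruct (Nat.even q); lra.
Qed.

Lemma interior_max i t : (S i < k)%nat -> s i <= t <= s (S (S i)) ->
  chord x y (s i) t + chord x y t (s (S (S i))) <=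
  chord x y (s i) (s (S i)) + chord x y (s (S i)) (s (S (S i))).
Proof.
  intros Hi Ht. destruct HM as [(H0 & Mon & HL) Max]. fold k in Mon, HL.
  assert (Ek : exists m, k = (i + (2 + m))%nat) by (exists (k - i - 2)%nat; lia). destruct Ek as [m Ek].
  specialize (Max (update s (S i) t)). unfold Lq in Max. fold k in Max.
  assert (A : admissible q (update s (S i) t)).
  { split; [rewrite update_neq by lia; auto|]. fold k. split.
    - intros j Hj. destruct (Nat.eq_dec j (S i)) as [->|N1].
      + rewrite update_eq, update_neq by lia. lra.
      + rewrite (update_neq s (S i) t j) by lia.
        destruct (Nat.eq_dec (S j) (S i)) as [E|N2].
        * rewrite E, update_eq. injection E as ->. lra.
        * rewrite update_neq by lia. now apply Mon.
    - rewrite update_neq by lia. exact HL. }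
  specialize (Max A). rewrite (update_neq s (S i) t k) in Max by lia.
  set (Z := if Nat.even q then 0 else _) in Max.
  rewrite Ek in Max. rewrite sumR_update_interior in Max. lra.
Qed.

Lemma last_max t : Nat.even q = false -> s (k - 1)%nat <= t <= 1 / 2 ->
  2 * chord x y (s (k - 1)%nat) t + chord x y t (- t) <=
  2 * chord x y (s (k - 1)%nat) (s k) + chord x y (s k) (- s k).
Proof.
  intros Hodd Ht. destruct HM as [(H0 & Mon & HL) Max]. fold k in Mon, HL.
  destruct half_spec as [K1 _].
  assert (Ek : exists i, k = S i) by (exists (k - 1)%nat; lia). destruct Ek as [i Ek].
  specialize (Max (update s (S i) t)). unfold Lq in Max. fold k in Max.
  replace (k - 1)%nat with i in * by lia.
  assert (A : admissible q (update s (S i) t)).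
  { split; [rewrite update_neq by lia; auto|]. fold k. rewrite Hodd. split.
    - intros j Hj. rewrite (update_neq s (S i) t j) by lia.
      destruct (Nat.eq_dec j i) as [->|N1].
      + rewrite update_eq. lra.
      + rewrite update_neq by lia. now apply Mon.
    - rewrite Ek, update_eq. lra. }
  specialize (Max A). rewrite Hodd in Max. rewrite Ek in Max at 1 2 3 4 5 6. rewrite Ek.
  rewrite update_eq in Max.
  rewrite sumR_update_last in Max. lra.
Qed.

(** A middle point equal to a neighbour leaves only the direct chord, which strict convexity makes
    shorter than a detour through a point in between. The maximum is then interior and stationary,
    which is the reflection law. *)
Lemma interior_strict i : (S i < k)%nat -> s i < s (S (S i)) ->
  s i < s (S i) < s (S (S i)) /\
  cos_arrive x y dx dy (s i) (s (S i)) = cos_depart x y dx dy (s (S i)) (s (S (S i))).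
Proof.
  intros Hi Hlt. pose proof (adm_range i ltac:(lia)). pose proof (adm_range (S (S i)) ltac:(lia)).
  pose proof (adm_le i (S i) ltac:(lia) ltac:(lia)). pose proof (adm_le (S i) (S (S i)) ltac:(lia) ltac:(lia)).
  set (a := s i) in *. set (c := s (S i)) in *. set (b := s (S (S i))) in *.
  pose proof (chord_triangle_strict x y dx dy BC a ((a + b) / 2) b ltac:(lra) ltac:(lra)) as T.
  pose proof (interior_max i ((a + b) / 2) Hi ltac:(fold a b; lra)) as M. fold a b c in M.
  assert (Hac : a <> c) by (intros E; rewrite <- E, chord_refl in M; lra).
  assert (Hcb : c <> b) by (intros E; rewrite E, chord_refl in M; lra).
  assert (Hacb : a < c < b) by lra. split; auto.
  cut (cos_arrive x y dx dy a c + - cos_depart x y dx dy c b = 0); [lra|].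
  apply (interior_max_derive (fun t => chord x y a t + chord x y t b) a b c); auto.
  - apply derive_plus.
    + apply (chord_derive_r x y dx dy BC). rewrite Rabs_right; lra.
    + apply (chord_derive_l x y dx dy BC). rewrite Rabs_left; lra.
  - intros t Ht. apply (interior_max i t Hi). fold a b. lra.
Qed.

(** For odd [q] the last point is free up to the auxiliary point, so the maximum must be kept away
    from both ends of its range before stationarity applies. *)
Lemma last_strict : Nat.even q = false -> s (k - 1)%nat < 1 / 2 ->
  s (k - 1)%nat < s k < 1 / 2 /\
  cos_arrive x y dx dy (s (k - 1)%nat) (s k) = cos_depart x y dx dy (s k) (1 - s k).
Proof.
  intros Hodd Hlt. destruct half_spec as [K1 _].
  pose proof (adm_range (k - 1) ltac:(lia)). pose proof (adm_range k ltac:(lia)).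
  pose proof (adm_le (k - 1) k ltac:(lia) ltac:(lia)).
  pose proof (fun t => last_max t Hodd) as M.
  set (a := s (k - 1)%nat) in *. set (c := s k) in *.
  assert (Hac : a <> c).
  (* If the last two points coincided, the midpoint [t] of [a] and 1/2 would do better: the path
     [a], [t], [1 - t], [1 - a] is longer than the chord from [a] to [1 - a]. *)
  { intros E. specialize (M ((a + 1/2) / 2) ltac:(lra)). rewrite <- E, chord_refl in M.
    set (t := (a + 1/2) / 2) in *.
    assert (Hat : 0 < chord x y a t) by (apply (chord_pos x y dx dy BC); rewrite Rabs_right; unfold t; lra).
    pose proof (chord_nonneg x y t (- t)) as N.
    replace (- a) with (1 - a - 1) in M by ring. replace (- t) with (1 - t - 1) in M by ring.
    rewrite !(chord_shift_r x y dx dy BC) in M.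
    (* At [a = 0] the points [a] and [1 - a] coincide: the strict triangle inequality does not
       apply, but the self-chord is 0. *)
    destruct (Req_dec a 0) as [E0|N0].
    - assert (E1 : chord x y a (1 - a) = 0).
      { rewrite E0. replace (1 - 0) with 1 by ring. replace 0 with (1 - 1) at 1 by ring.
        rewrite (chord_shift_l x y dx dy BC). apply chord_refl. }
      pose proof (chord_nonneg x y t (1 - t)). rewrite E1 in M. lra.
    - pose proof (chord_triangle_strict x y dx dy BC a t (1 - a) ltac:(unfold t; lra) ltac:(lra)) as T1.
      pose proof (chord_triangle x y t (1 - t) (1 - a)) as T2.
      rewrite (chord_mirror x y dx dy BC SM), (chord_sym x y t a) in T2. lra. }
  assert (Hc2 : c <> 1 / 2).
  { intros E. apply (self_chord_not_max_at_half x y dx dy BC SM a); [lra|]. rewrite E in M. exact M. }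
  assert (Hacb : a < c < 1/2) by lra. split; auto.
  cut (2 * cos_arrive x y dx dy a c + - 2 * cos_depart x y dx dy c (1 - c) = 0); [lra|].
  apply (interior_max_derive (fun t => 2 * chord x y a t + chord x y t (- t)) a (1/2) c); auto.
  - apply derive_plus.
    + apply is_derive_scal, (chord_derive_r x y dx dy BC). rewrite Rabs_right; lra.
    + apply (chord_self_derive x y dx dy BC SM). lra.
  - intros t Ht. apply M. lra.
Qed.

(** By [interior_strict] a positive gap forces the gaps next to it to be positive. If the first gap
    were zero, all points would therefore lie at 0, against [s k = 1 / 2] for even [q] and against
    [last_strict] for odd [q]. *)
Lemma adm_strict i : (i < k)%nat -> s i < s (S i).
Proof.
  destruct half_spec as [K1 K2].
  assert (Up : forall i, (S i < k)%nat -> s i < s (S i) -> s (S i) < s (S (S i))).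
  { intros j Hj Hlt. pose proof (adm_le (S j) (S (S j)) ltac:(lia) ltac:(lia)).
    apply (interior_strict j Hj). lra. }
  assert (Down : forall i, (S i < k)%nat -> s (S i) < s (S (S i)) -> s i < s (S i)).
  { intros j Hj Hlt. pose proof (adm_le j (S j) ltac:(lia) ltac:(lia)).
    apply (interior_strict j Hj). lra. }
  assert (All : s 0%nat < s 1%nat -> forall j, (j < k)%nat -> s j < s (S j)).
  { intros H0 j. induction j as [|j IH]; intros Hj; auto. apply Up; auto. apply IH; lia. }
  assert (Down0 : forall j, (j < k)%nat -> s j < s (S j) -> s 0%nat < s 1%nat).
  { induction j as [|j IH]; intros Hj Hlt; auto. apply IH; [lia|]. apply Down; auto. }
  revert i. apply All.
  destruct (Rlt_dec (s 0%nat) (s 1%nat)) as [|N]; auto. exfalso.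
  assert (Eq : forall j, (j <= k)%nat -> s j = s 0%nat).
  { induction j as [|j IH]; intros Hj; auto. rewrite <- IH by lia.
    pose proof (adm_le j (S j) ltac:(lia) ltac:(lia)).
    destruct (Rlt_dec (s j) (s (S j))) as [L|L]; [|lra]. exfalso. apply N, (Down0 j); auto. }
  destruct HM as [(H0 & _ & HL) _]. fold k in HL.
  destruct (Nat.even q) eqn:Ev.
  - rewrite (Eq k) in HL by lia. lra.
  - destruct (last_strict Ev) as [A _].
    + rewrite Eq by lia. lra.
    + rewrite (Eq (k - 1)%nat), (Eq k) in A by lia. lra.
Qed.

(* The collision points in increasing order on [0, 1]: unlike [collision], without jump at the middle of the orbit. *)
Definition lift_orbit (j : nat) : R := if (j <=? k)%nat then s j else 1 - s (q - j)%nat.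

Lemma lift_low j : (j <= k)%nat -> lift_orbit j = s j.
Proof. intros H. unfold lift_orbit. now rewrite (proj2 (Nat.leb_le j k) H). Qed.

Lemma lift_mirror j : (j <= q)%nat -> lift_orbit (q - j) = 1 - lift_orbit j.
Proof.
  intros Hj. destruct half_spec as [K1 K2].
  destruct (le_lt_dec j k) as [L|L].
  - rewrite (lift_low j L). destruct (le_lt_dec (q - j) k) as [L2|L2].
    (* Both indices lie in the first half only at the middle of an even orbit, which is its own
       mirror image because [s k = 1 / 2]. *)
    + rewrite lift_low by auto. destruct (Nat.even q) eqn:Ev.
      * assert (j = k) by lia. subst j. replace (q - k)%nat with k by lia.
        destruct HM as [(_ & _ & HL) _]. fold k in HL. rewrite Ev in HL. lra.
      * lia.
    + unfold lift_orbit. rewrite (proj2 (Nat.leb_gt _ _) L2). do 2 f_equal. lia.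
  - unfold lift_orbit at 2. rewrite (proj2 (Nat.leb_gt _ _) L). rewrite lift_low.
    + ring.
    + destruct (Nat.even q); lia.
Qed.

Lemma lift_0 : lift_orbit 0 = 0.
Proof. rewrite lift_low by lia. apply HM. Qed.

Lemma lift_q : lift_orbit q = 1.
Proof.
  pose proof (lift_mirror 0 ltac:(lia)) as E. rewrite Nat.sub_0_r, lift_0 in E. lra.
Qed.

Lemma lift_middle_gap : Nat.even q = false -> s k < 1 - s k.
Proof.
  intros Ev. destruct half_spec as [K1 K2].
  destruct (last_strict Ev) as [A _]; [|lra].
  pose proof (adm_strict (k - 1) ltac:(lia)). replace (S (k - 1)) with k in H by lia.
  pose proof (adm_range k ltac:(lia)). lra.
Qed.

Lemma lift_strict j : (j < q)%nat -> lift_orbit j < lift_orbit (S j).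
Proof.
  intros Hj. destruct half_spec as [K1 K2].
  assert (Low : forall i, (i < k)%nat -> lift_orbit i < lift_orbit (S i)).
  { intros i Hi. rewrite !lift_low by lia. now apply adm_strict. }
  destruct (le_lt_dec k j) as [L|L]; [|auto].
  destruct (Nat.eq_dec j k) as [->|N].
  - destruct (Nat.even q) eqn:Ev.
    + pose proof (lift_mirror k ltac:(lia)) as E1. replace (q - k)%nat with k in E1 by lia.
      pose proof (lift_mirror (k - 1) ltac:(lia)) as E2. replace (q - (k - 1))%nat with (S k) in E2 by lia.
      specialize (Low (k - 1)%nat ltac:(lia)). replace (S (k - 1)) with k in Low by lia. lra.
    + pose proof (lift_mirror k ltac:(lia)) as E1. replace (q - k)%nat with (S k) in E1 by lia.
      rewrite E1, lift_low by lia. now apply lift_middle_gap.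
  - specialize (Low (q - S j)%nat ltac:(destruct (Nat.even q); lia)).
    replace (S (q - S j)) with (q - j)%nat in Low by lia.
    rewrite !lift_mirror in Low by lia. lra.
Qed.

(** Stationarity covers the first half and the mirror carries it to the second. For even [q] the
    middle point is fixed at 1/2, and the law holds there by symmetry rather than by maximality. *)
Lemma lift_reflection j : (1 <= j)%nat -> (j < q)%nat ->
  cos_arrive x y dx dy (lift_orbit (j - 1)) (lift_orbit j) = cos_depart x y dx dy (lift_orbit j) (lift_orbit (S j)).
Proof.
  intros Hj1 Hj. destruct half_spec as [K1 K2].
  assert (Low : forall i, (1 <= i)%nat -> (i < k)%nat ->
     cos_arrive x y dx dy (lift_orbit (i - 1)) (lift_orbit i) = cos_depart x y dx dy (lift_orbit i) (lift_orbit (S i))).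
  { intros i Hi1 Hi. rewrite !lift_low by lia.
    replace i with (S (i - 1)) at 2 3 4 by lia. apply interior_strict; [lia|].
    pose proof (adm_strict (i - 1) ltac:(lia)). pose proof (adm_strict (S (i - 1)) ltac:(lia)). lra. }
  assert (Mid : cos_arrive x y dx dy (lift_orbit (k - 1)) (lift_orbit k) = cos_depart x y dx dy (lift_orbit k) (lift_orbit (S k))).
  { destruct (Nat.even q) eqn:Ev.
    - pose proof (lift_mirror k ltac:(lia)) as E1. replace (q - k)%nat with k in E1 by lia.
      pose proof (lift_mirror (k - 1) ltac:(lia)) as E2. replace (q - (k - 1))%nat with (S k) in E2 by lia.
      rewrite E2. rewrite <- (cos_depart_mirror x y dx dy BC SM). now rewrite <- E1.
    - pose proof (lift_mirror k ltac:(lia)) as E1. replace (q - k)%nat with (S k) in E1 by lia.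
      rewrite E1, !lift_low by lia. apply last_strict; auto.
      pose proof (adm_strict (k - 1) ltac:(lia)) as A. replace (S (k - 1)) with k in A by lia.
      pose proof (adm_range k ltac:(lia)). lra. }
  assert (Low' : forall i, (1 <= i)%nat -> (i <= k)%nat ->
     cos_arrive x y dx dy (lift_orbit (i - 1)) (lift_orbit i) = cos_depart x y dx dy (lift_orbit i) (lift_orbit (S i))).
  { intros i Hi1 Hi. destruct (Nat.eq_dec i k) as [->|]; [exact Mid|apply Low; lia]. }
  destruct (le_lt_dec j k) as [L|L]; [auto|].
  pose proof (Low' (q - j)%nat ltac:(lia) ltac:(destruct (Nat.even q); lia)) as E.
  replace (q - j - 1)%nat with (q - S j)%nat in E by lia.
  replace (S (q - j)) with (q - (j - 1))%nat in E by lia.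
  rewrite !lift_mirror in E by lia.
  rewrite (cos_arrive_mirror x y dx dy BC SM), (cos_depart_mirror x y dx dy BC SM) in E. auto.
Qed.

Lemma ell_q_lift (nu : R -> R) : (forall t, nu (t + 1) = nu t) ->
  ell_q x y dx dy q s nu =
  sumR q (fun j => nu (lift_orbit j) * sin_angle x y dx dy (lift_orbit j) (lift_orbit (S j))).
Proof.
  intros Hnu.
  assert (Hnu' : forall t, nu (t - 1) = nu t).
  { intros t. rewrite <- (Hnu (t - 1)). f_equal; ring. }
  assert (Sl : forall a b, sin_angle x y dx dy (a - 1) b = sin_angle x y dx dy a b).
  { intros a b. unfold sin_angle. rewrite (chord_shift_l x y dx dy BC).
    destruct (point_periodic_minus x y dx dy BC a) as [-> ->].
    destruct (tangent_periodic_minus x y dx dy BC a) as [-> ->]. reflexivity. }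
  assert (Sr : forall a b, sin_angle x y dx dy a (b - 1) = sin_angle x y dx dy a b).
  { intros a b. unfold sin_angle. rewrite (chord_shift_r x y dx dy BC).
    destruct (point_periodic_minus x y dx dy BC b) as [-> ->]. reflexivity. }
  assert (Ec : forall j, collision q s j = lift_orbit j \/ collision q s j = lift_orbit j - 1).
  { intros j. unfold collision, lift_orbit. fold k. destruct (j <=? k)%nat; [left; auto|right; ring]. }
  unfold ell_q. apply sumR_ext. intros j Hj.
  assert (Ec2 : collision q s ((j + 1) mod q) = lift_orbit (S j) \/ collision q s ((j + 1) mod q) = lift_orbit (S j) - 1).
  (* The successor of the last collision is collision 0, the lift of index [q] moved back by one
     period. *)
  { rewrite Nat.add_1_r. destruct (Nat.eq_dec (S j) q) as [E|N].
    - rewrite E, Nat.Div0.mod_same, lift_q. right. unfold collision. simpl. destruct HM as [(H0 & _) _]. lra.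
    - rewrite Nat.mod_small by lia. apply Ec. }
  destruct (Ec j) as [-> | ->]; destruct Ec2 as [-> | ->]; rewrite ?Hnu', ?Sl, ?Sr; reflexivity.
Qed.
End Maximizer.

(* The cubic terms of the two Taylor expansions cancel up to [h^2 |hp - hm|], and [|hp - hm|] is itself controlled by
   the left-hand side up to [h^2]. *)
Lemma turning_step : exists C d, 0 <= C /\ 0 < d <= 1 /\ forall p, near_disk_le d p ->
  forall hp hm, 0 < hp <= 2/5 -> 0 < hm <= 2/5 -> sine p hp + sine p (- hm) = 0 ->
  Rabs (Yf p hp + Yf p (- hm)) <= C * pdl p * Rmax hp hm ^ 4.
Proof.
  destruct sine_taylor as (C1 & d1 & HC1 & Hd1 & T1).
  destruct laz_taylor as (C2 & d2 & HC2 & Hd2 & T2).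
  (* Makes both [C1 * pdl] and [C2 * pdl] at most 1/1000, so that the numerical margins below are
     fixed. *)
  set (d3 := / (1000 * (C1 + C2 + 1))).
  assert (Hd3 : 0 < d3) by (apply Rinv_0_lt_compat; lra).
  set (d := Rmin d3 (Rmin d1 d2)).
  assert (L3 : d <= d3) by apply Rmin_l.
  assert (L1 : d <= d1) by (eapply Rle_trans; [apply Rmin_r|apply Rmin_l]).
  assert (L2 : d <= d2) by (eapply Rle_trans; [apply Rmin_r|apply Rmin_r]).
  assert (Hd : 0 < d) by (apply Rmin_glb_lt; [lra|apply Rmin_glb_lt; lra]).
  (* The difference of sines is at least [2.9 / 25 * Delta], of which [6 / 1000 * Delta] is
     absorbed; more than [Delta / 17] remains. *)
  exists (17 * (12 * C1 * C2 + 2 * C1)), d.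
  split; [nra|]. split; [lra|]. intros p [Hp Hpd] hp hm Hhp Hhm HS.
  assert (Hdl := near_disk_dl p Hp).
  destruct (T1 p) as (p3 & Hp3 & HT); [split; auto; lra|].
  destruct (T2 p) as (Hc & D & HD & HY); [split; auto; lra|].
  set (dd := pdl p) in *.
  assert (Hsm1 : C1 * dd <= / 1000).
  { assert (dd <= d3) by lra. apply Rle_trans with ((C1 + C2 + 1) * d3).
    - apply Rmult_le_compat; lra.
    - unfold d3. right. field. lra. }
  assert (Hsm2 : C2 * dd <= / 1000).
  { assert (dd <= d3) by lra. apply Rle_trans with ((C1 + C2 + 1) * d3).
    - apply Rmult_le_compat; lra.
    - unfold d3. right. field. lra. }
  set (M := Rmax hp hm).
  assert (HM : hp <= M /\ hm <= M /\ M <= 2/5).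
  { split; [apply Rmax_l|split; [apply Rmax_r|]]. apply Rmax_lub; lra. }
  assert (A1 : Rabs hp < 3/5) by (rewrite Rabs_right; lra).
  assert (A2 : Rabs (- hm) < 3/5) by (rewrite Rabs_Ropp, Rabs_right; lra).
  destruct (HY hp A1) as [Y1 Y1']. destruct (HY (- hm) A2) as [Y2 Y2'].
  rewrite (Rabs_right hp) in Y1, Y1' by lra. rewrite (Rabs_Ropp hm), (Rabs_right hm) in Y2, Y2' by lra.
  specialize (HT hp A1) as S1. specialize (HT (- hm) A2) as S2.
  set (yp := Yf p hp) in *. set (z := Yf p (- hm)) in *.
  set (ym := - z). assert (Ez : z = - ym) by (unfold ym; ring).
  set (c := cf p) in *.
  replace (sin (c * z)) with (- sin (c * ym)) in S2
    by (rewrite Ez; replace (c * - ym) with (- (c * ym)) by ring; rewrite sin_neg; ring).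
  replace ((- hm) ^ 3) with (- hm ^ 3) in S2 by ring. replace ((- hm) ^ 4) with (hm ^ 4) in S2 by ring.
  replace (z - - hm) with (- (ym - hm)) in Y2 by (unfold ym; ring). rewrite Rabs_Ropp in Y2.
  replace (z - D * - hm) with (- (ym - D * hm)) in Y2' by (unfold ym; ring). rewrite Rabs_Ropp in Y2'.
  assert (HPI := PI2_3_2). assert (HPI4 := PI_4).
  assert (Bc : 2.9 <= c <= PI + / 1000) by (apply Rabs_le_between in Hc; lra).
  assert (Byp : 0 <= yp <= 0.401) by (apply Rabs_le_between in Y1; nra).
  assert (Bym : 0 <= ym <= 0.401) by (apply Rabs_le_between in Y2; nra).
  assert (BD : / 2 <= D) by (apply Rabs_le_between in HD; lra).
  set (Delta := Rabs (yp - ym)).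
  (* Steps of at most 2/5 keep the angles below [0.45 PI], short of the critical point of the sine;
     there the cosine is at least 1/25. *)
  assert (Lsin : / 25 * (c * Delta) <= Rabs (sin (c * yp) - sin (c * ym))).
  { destruct (MVT_gen sin (c * ym) (c * yp) cos) as [xi [Hxi E]].
    - intros t _. apply is_derive_Reals, derivable_pt_lim_sin.
    - intros t _. apply continuity_pt_filterlim, continuous_sin.
    - rewrite E. replace (c * yp - c * ym) with (c * (yp - ym)) by ring.
      rewrite !Rabs_mult, (Rabs_right c) by lra. fold Delta.
      assert (Bxi : 0 <= xi <= 0.45 * PI).
      { assert (c * yp <= 0.45 * PI) by nra. assert (c * ym <= 0.45 * PI) by nra.
        assert (0 <= c * yp) by nra. assert (0 <= c * ym) by nra.
        unfold Rmin, Rmax in Hxi. destruct (Rle_dec (c * ym) (c * yp)); lra. }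
      assert (/ 25 <= cos xi).
      { rewrite <- sin_shift. set (w := 1/2 - xi / PI).
        replace (PI / 2 - xi) with (PI * w) by (unfold w; field; lra).
        assert (0 <= xi / PI <= 0.45).
        { split; [apply Rdiv_le_0_compat; lra|]. apply (Rmult_le_reg_r PI); [lra|].
          unfold Rdiv; rewrite Rmult_assoc, Rinv_l; lra. }
        eapply Rle_trans; [|apply sin_PI_lower; unfold w; lra]. unfold w. nra. }
      rewrite (Rabs_right (cos xi)) by lra.
      apply Rmult_le_compat_r; [|lra]. apply Rmult_le_pos; [lra|apply Rabs_pos]. }
  assert (Hh : Rabs (hp - hm) <= 2 * Delta + 4 * C2 * M ^ 2).
  { assert (E : D * (hp - hm) = (yp - ym) - (yp - D * hp) + (ym - D * hm)) by ring.
    assert (B : Rabs (D * (hp - hm)) <= Delta + C2 * hp ^ 2 + C2 * hm ^ 2).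
    { rewrite E. eapply Rle_trans; [apply Rabs_triang|]. apply Rplus_le_compat; auto.
      unfold Rminus at 1. eapply Rle_trans; [apply Rabs_triang|]. rewrite Rabs_Ropp.
      apply Rplus_le_compat; auto. unfold Delta; lra. }
    rewrite Rabs_mult, (Rabs_right D) in B by lra.
    assert (hp ^ 2 <= M ^ 2) by (apply pow_incr; lra). assert (hm ^ 2 <= M ^ 2) by (apply pow_incr; lra).
    pose proof (Rabs_pos (hp - hm)).
    assert (C2 * hp ^ 2 <= C2 * M ^ 2) by (apply Rmult_le_compat_l; lra).
    assert (C2 * hm ^ 2 <= C2 * M ^ 2) by (apply Rmult_le_compat_l; lra).
    nra. }
  assert (Hcube : Rabs (hp ^ 3 - hm ^ 3) <= 3 * M ^ 2 * Rabs (hp - hm)).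
  { replace (hp ^ 3 - hm ^ 3) with ((hp ^ 2 + hp * hm + hm ^ 2) * (hp - hm)) by ring.
    rewrite Rabs_mult. apply Rmult_le_compat_r; [apply Rabs_pos|].
    rewrite Rabs_right by nra.
    assert (hp ^ 2 <= M ^ 2) by (apply pow_incr; lra). assert (hm ^ 2 <= M ^ 2) by (apply pow_incr; lra).
    assert (hp * hm <= M ^ 2) by (simpl; rewrite Rmult_1_r; apply Rmult_le_compat; lra). lra. }
  assert (M4 : hp ^ 4 <= M ^ 4 /\ hm ^ 4 <= M ^ 4) by (split; apply pow_incr; lra).
  assert (Up : Rabs (sin (c * yp) - sin (c * ym)) <= C1 * dd * (3 * M ^ 2 * Rabs (hp - hm)) + 2 * (C1 * dd) * M ^ 4).
  { replace (sin (c * yp) - sin (c * ym)) with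
      (- (sine p hp - sin (c * yp) - p3 * hp ^ 3) + - (sine p (- hm) - - sin (c * ym) - p3 * - hm ^ 3)
       + - (p3 * (hp ^ 3 - hm ^ 3))) by (replace (sine p hp) with (- sine p (- hm)) by lra; ring).
    eapply Rle_trans; [apply Rabs_triang|]. rewrite (Rabs_Ropp (p3 * _)), (Rabs_mult p3).
    assert (Rabs p3 * Rabs (hp ^ 3 - hm ^ 3) <= C1 * dd * (3 * M ^ 2 * Rabs (hp - hm))).
    { apply Rmult_le_compat; auto; apply Rabs_pos. }
    pose proof (Rabs_triang (- (sine p hp - sin (c * yp) - p3 * hp ^ 3)) (- (sine p (- hm) - - sin (c * ym) - p3 * - hm ^ 3))) as T.
    rewrite !Rabs_Ropp in T.
    assert (0 <= C1 * dd) by nra.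
    assert (C1 * dd * hp ^ 4 <= C1 * dd * M ^ 4) by (apply Rmult_le_compat_l; lra).
    assert (C1 * dd * hm ^ 4 <= C1 * dd * M ^ 4) by (apply Rmult_le_compat_l; lra).
    lra. }
  replace (yp + z) with (yp - ym) by (unfold ym; ring). fold Delta.
  assert (HD0 : 0 <= Delta) by apply Rabs_pos.
  assert (Hk : 0 <= C1 * dd) by nra.
  assert (M2 : 0 <= M ^ 2 <= 1) by (split; [apply pow_le; lra|nra]).
  assert (K1 : C1 * dd * (3 * M ^ 2 * Rabs (hp - hm)) <= C1 * dd * (3 * M ^ 2 * (2 * Delta + 4 * C2 * M ^ 2))).
  { apply Rmult_le_compat_l; auto. apply Rmult_le_compat_l; lra. }
  assert (K2 : C1 * dd * (3 * M ^ 2 * (2 * Delta + 4 * C2 * M ^ 2)) =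
     6 * (C1 * dd) * (M ^ 2 * Delta) + 12 * (C1 * dd) * C2 * M ^ 4) by ring.
  assert (K3 : 6 * (C1 * dd) * (M ^ 2 * Delta) <= 6 * / 1000 * Delta).
  { assert (0 <= M ^ 2 * Delta <= Delta) by nra. nra. }
  assert (K4 : / 25 * (2.9 * Delta) <= / 25 * (c * Delta)) by (apply Rmult_le_compat_l; [lra|]; apply Rmult_le_compat_r; lra).
  replace (17 * (12 * C1 * C2 + 2 * C1) * dd * M ^ 4)
    with (17 * (12 * (C1 * dd) * C2 * M ^ 4 + 2 * (C1 * dd) * M ^ 4)) by ring.
  assert (0 <= 12 * (C1 * dd) * C2 * M ^ 4) by (repeat apply Rmult_le_pos; try lra; apply pow_le; lra).
  assert (0 <= 2 * (C1 * dd) * M ^ 4) by (repeat apply Rmult_le_pos; try lra; apply pow_le; lra).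
  lra.
Qed.

(** * Asymptotics of the collision points and angles *)

(** As a function of [c] the difference vanishes at [PI], and its derivative in [c] is [O(t ^ 3)],
    because the terms linear in [t] cancel. With [t = / q] this isolates a factor common to all
    collision points. *)
Lemma sin_linear_comparison c t : 0 <= t <= 1 -> Rabs (c - PI) <= 1 ->
  Rabs (sin (c * t) - c / PI * sin (PI * t)) <= 40 * Rabs (c - PI) * t ^ 3.
Proof.
  intros Ht Hc. assert (HP := PI_4). assert (HP2 := PI2_3_2).
  assert (Cos : forall z, Rabs (cos z - 1) <= z ^ 2 / 2).
  { intros z. replace z with (2 * (z / 2)) at 1 by field. rewrite cos_2a_sin.
    replace (1 - 2 * sin (z / 2) * sin (z / 2) - 1) with (- (2 * (sin (z / 2)) ^ 2)) by ring.
    rewrite Rabs_Ropp, Rabs_mult, (Rabs_right 2), <- RPow_abs by lra.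
    pose proof (Rabs_sin_diff (z / 2) 0) as B. rewrite sin_0, !Rminus_0_r in B.
    assert (Rabs (sin (z / 2)) ^ 2 <= Rabs (z / 2) ^ 2) by (apply pow_incr; split; [apply Rabs_pos|auto]).
    rewrite (pow2_abs (z / 2)) in H. lra. }
  assert (Sin : Rabs (sin (PI * t) - PI * t) <= / 2 * (PI * t) ^ 3).
  { pose proof (power_bound_of_derive (fun z => sin z - z) (fun z => cos z - 1) (PI * t + 1) (/ 2) 2 (PI * t)) as B.
    rewrite (Rabs_right (PI * t)) in B by nra. apply B; [lra|lra| | |].
    - intros z _. auto_derive; auto; ring.
    - rewrite sin_0; ring.
    - intros z _. rewrite pow2_abs. specialize (Cos z). lra. }
  assert (E : sin (PI * t) - PI / PI * sin (PI * t) = 0) by (field; lra).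
  set (f := fun c => sin (c * t) - c / PI * sin (PI * t)).
  assert (Df : forall z, is_derive f z (t * cos (z * t) - sin (PI * t) / PI)).
  { intros z. unfold f. auto_derive; [lra|]. field; lra. }
  destruct (MVT_gen f PI c (fun c => t * cos (c * t) - sin (PI * t) / PI)) as [xi [Hxi Em]].
  - intros z _. apply Df.
  - intros z _. apply continuity_pt_filterlim. exact (derive_cont f z _ (Df z)).
  - change (Rabs (f c) <= 40 * Rabs (c - PI) * t ^ 3).
    replace (f c) with (f c - f PI) by (unfold f at 2; rewrite E; ring). rewrite Em, Rabs_mult.
    assert (Bxi : 0 <= xi <= 5).
    { apply Rabs_le_between in Hc. unfold Rmin, Rmax in Hxi. destruct (Rle_dec PI c); lra. }
    apply Rle_trans with (40 * t ^ 3 * Rabs (c - PI)); [|right; ring].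
    apply Rmult_le_compat_r; [apply Rabs_pos|].
    replace (t * cos (xi * t) - sin (PI * t) / PI) with
      (t * (cos (xi * t) - 1) + - (sin (PI * t) - PI * t) / PI) by (field; lra).
    eapply Rle_trans; [apply Rabs_triang|]. unfold Rdiv. rewrite !Rabs_mult, Rabs_Ropp, (Rabs_right t) by lra.
    rewrite (Rabs_right (/ PI)) by (apply Rle_ge; left; apply Rinv_0_lt_compat; lra).
    assert (B1 : t * Rabs (cos (xi * t) - 1) <= t * ((5 * t) ^ 2 / 2)).
    { apply Rmult_le_compat_l; [lra|]. eapply Rle_trans; [apply Cos|].
      assert ((xi * t) ^ 2 <= (5 * t) ^ 2) by (apply pow_incr; nra). lra. }
    assert (B2 : Rabs (sin (PI * t) - PI * t) * / PI <= / 2 * (PI * t) ^ 3 * / PI).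
    { apply Rmult_le_compat_r; auto. left; apply Rinv_0_lt_compat; lra. }
    replace (/ 2 * (PI * t) ^ 3 * / PI) with (/ 2 * PI ^ 2 * t ^ 3) in B2 by (field; lra).
    assert (0 <= t ^ 3) by (apply pow_le; lra). assert (PI ^ 2 <= 16) by nra. nra.
Qed.

(** [close_to_circle] bounds some chain of derivatives of the difference; uniqueness of derivatives
    identifies it with the difference of the given chains. *)
Lemma near_disk_of_close x y dx dy delta s : boundary_curve x y dx dy ->
  close_to_circle delta x y dx dy -> delta <= 1 ->
  near_disk (Pert dx dy (dx 1%nat 0) (dy 1%nat 0) delta s).
Proof.
  intros BC (ex & ey & (Ex0 & Ex & _) & (Ey0 & Ey & _) & He) Hd.
  set (t1 := dx 1%nat 0) in *. set (t2 := dy 1%nat 0) in *.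
  assert (E : forall i, (i <= 8)%nat -> (forall s, ex (S i) s = dx (S i) s - disk_dx i t1 t2 s) /\
                        (forall s, ey (S i) s = dy (S i) s - disk_dy i t1 t2 s)).
  { induction i as [|i IH]; intros Hi.
    - split; intros z.
      + rewrite <- (is_derive_unique (ex 0%nat) z _ (proj2 (is_derive_Reals _ _ _) (Ex 0%nat ltac:(unfold r_reg; lia) z))).
        apply is_derive_unique. apply (is_derive_ext (fun s => x s - disk_x (x 0) t1 t2 s)); [intros; symmetry; apply Ex0|].
        apply derive_minus; [apply (curve_derive0 x y dx dy BC)|].
        unfold disk_x, disk_dx. pose proof PI_RGT_0. auto_derive; auto. simpl. rewrite Rmult_0_l, Rplus_0_r.
        field. lra.
      + rewrite <- (is_derive_unique (ey 0%nat) z _ (proj2 (is_derive_Reals _ _ _) (Ey 0%nat ltac:(unfold r_reg; lia) z))).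
        apply is_derive_unique. apply (is_derive_ext (fun s => y s - disk_y (y 0) t1 t2 s)); [intros; symmetry; apply Ey0|].
        apply derive_minus; [apply (curve_derive0 x y dx dy BC)|].
        unfold disk_y, disk_dy. pose proof PI_RGT_0. auto_derive; auto. simpl. rewrite Rmult_0_l, Rplus_0_r.
        field. lra.
    - destruct (IH ltac:(lia)) as [I1 I2]. split; intros z.
      + rewrite <- (is_derive_unique (ex (S i)) z _ (proj2 (is_derive_Reals _ _ _) (Ex (S i) ltac:(unfold r_reg; lia) z))).
        apply is_derive_unique. apply (is_derive_ext (fun s => dx (S i) s - disk_dx i t1 t2 s)); [intros; symmetry; apply I1|].
        apply derive_minus; [apply (curve_derive x y dx dy BC); lia|apply disk_dx_derive].
      + rewrite <- (is_derive_unique (ey (S i)) z _ (proj2 (is_derive_Reals _ _ _) (Ey (S i) ltac:(unfold r_reg; lia) z))).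
        apply is_derive_unique. apply (is_derive_ext (fun s => dy (S i) s - disk_dy i t1 t2 s)); [intros; symmetry; apply I2|].
        apply derive_minus; [apply (curve_derive x y dx dy BC); lia|apply disk_dy_derive]. }
  assert (Comp : forall u v w, sqrt (u ^ 2 + v ^ 2) <= w -> Rabs u <= w /\ Rabs v <= w).
  { intros u v w H. split; (eapply Rle_trans; [|apply H]); rewrite <- sqrt_Rsqr_abs; apply sqrt_le_1_alt;
      unfold Rsqr; pose proof (pow2_ge_0 u); pose proof (pow2_ge_0 v); nra. }
  unfold near_disk; simpl. repeat match goal with |- _ /\ _ => split end.
  - eapply Rle_trans; [apply sqrt_pos|apply (He 0%nat 0); lia].
  - exact Hd.
  - apply (unit_speed x y dx dy BC).
  - intros k z Hk. apply (curve_derive x y dx dy BC). lia.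
  - intros k z Hk. destruct (E k Hk) as [E1 E2]. rewrite <- E1, <- E2. apply Comp, He. unfold r_reg; lia.
  - intros z. apply (unit_speed x y dx dy BC).
  - intros z. apply (curve_periodic x y dx dy BC). lia.
Qed.

Section Link.
Variables (x y : R -> R) (dx dy : nat -> R -> R) (delta : R).
Hypothesis BC : boundary_curve x y dx dy.

Definition based (s : R) : pert := Pert dx dy (dx 1%nat 0) (dy 1%nat 0) delta s.

Let cont1 s t : continuous (fun h => dx 1%nat (s + h)) t /\ continuous (fun h => dy 1%nat (s + h)) t.
Proof.
  destruct (curve_derive x y dx dy BC 1 (s + t) ltac:(lia)) as [D1 D2].
  exact (conj (derive_cont _ _ _ (is_derive_shift _ _ _ _ D1)) (derive_cont _ _ _ (is_derive_shift _ _ _ _ D2))).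
Qed.

Lemma cross_chord s h :
  cross (dx 1%nat s) (dy 1%nat s) (x (s + h) - x s) (y (s + h) - y s) = h * avgA (based s) h.
Proof.
  assert (Ca : forall t, continuous (fun t => t ^ 0 * alpha (based s) (t * h)) t).
  { intros t. apply average_continuous. unfold alpha, fx, fy, based; simpl.
    apply cont_minus; (apply cont_mult; [apply continuous_const|]); apply (cont1 s (t * h)). }
  unfold avgA, average. rewrite <- RInt_scal_cont by exact Ca.
  rewrite (RInt_of_derive (fun t => dx 1%nat s * y (s + t * h) - dy 1%nat s * x (s + t * h))).
  - rewrite Rmult_0_l, Rmult_1_l, Rplus_0_r. unfold cross. req; ring.
  - intros t. unfold alpha, fx, fy, based; simpl. rewrite Rplus_0_r.
    assert (D : forall (f : R -> R) l, is_derive f (s + t * h) l -> is_derive (fun t => f (s + t * h)) t (h * l)).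
    { intros f l Hf. apply (is_derive_comp f (fun t => s + t * h)); auto. auto_derive; auto; ring. }
    destruct (curve_derive0 x y dx dy BC (s + t * h)) as [D1 D2].
    replace (h * (1 * (dx 1%nat s * dy 1%nat (s + t * h) - dy 1%nat s * dx 1%nat (s + t * h))))
      with (dx 1%nat s * (h * dy 1%nat (s + t * h)) - dy 1%nat s * (h * dx 1%nat (s + t * h))) by ring.
    apply derive_minus; apply is_derive_scal; now apply D.
  - intros t. apply cont_mult; [apply continuous_const|apply Ca].
Qed.

Lemma dot_chord s h :
  dx 1%nat s * (x (s + h) - x s) + dy 1%nat s * (y (s + h) - y s) = h * avgB (based s) h.
Proof.
  assert (Ca : forall t, continuous (fun t => t ^ 0 * beta (based s) (t * h)) t).
  { intros t. apply average_continuous. unfold beta, fx, fy, based; simpl.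
    apply cont_plus; (apply cont_mult; [apply continuous_const|]); apply (cont1 s (t * h)). }
  unfold avgB, average. rewrite <- RInt_scal_cont by exact Ca.
  rewrite (RInt_of_derive (fun t => dx 1%nat s * x (s + t * h) + dy 1%nat s * y (s + t * h))).
  - rewrite Rmult_0_l, Rmult_1_l, Rplus_0_r. req; ring.
  - intros t. unfold beta, fx, fy, based; simpl. rewrite Rplus_0_r.
    assert (D : forall (f : R -> R) l, is_derive f (s + t * h) l -> is_derive (fun t => f (s + t * h)) t (h * l)).
    { intros f l Hf. apply (is_derive_comp f (fun t => s + t * h)); auto. auto_derive; auto; ring. }
    destruct (curve_derive0 x y dx dy BC (s + t * h)) as [D1 D2].
    replace (h * (1 * (dx 1%nat s * dx 1%nat (s + t * h) + dy 1%nat s * dy 1%nat (s + t * h))))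
      with (dx 1%nat s * (h * dx 1%nat (s + t * h)) + dy 1%nat s * (h * dy 1%nat (s + t * h))) by ring.
    apply derive_plus; apply is_derive_scal; now apply D.
  - intros t. apply cont_mult; [apply continuous_const|apply Ca].
Qed.

Lemma chord_average s h : chord x y s (s + h) = Rabs h * sqrt (chord_sq (based s) h).
Proof.
  rewrite <- sqrt_Rsqr_abs, <- sqrt_mult_alt by apply Rle_0_sqr. unfold chord. f_equal.
  unfold chord_sq, Rsqr.
  replace (h * h * (avgA (based s) h * avgA (based s) h + avgB (based s) h * avgB (based s) h))
    with ((h * avgA (based s) h) ^ 2 + (h * avgB (based s) h) ^ 2) by ring.
  rewrite <- cross_chord, <- dot_chord. unfold cross.
  pose proof (unit_speed x y dx dy BC s) as U.
  set (X := x (s + h) - x s). set (Y := y (s + h) - y s). set (P := dx 1%nat s) in *. set (Q := dy 1%nat s) in *.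
  transitivity ((P ^ 2 + Q ^ 2) * (X ^ 2 + Y ^ 2)); [rewrite U; ring|ring].
Qed.

Hypothesis Hpos : forall s h, Rabs h < 3/5 -> / 200 <= chord_sq (based s) h.

Let sqrt_pos' s h : Rabs h < 3/5 -> 0 < sqrt (chord_sq (based s) h).
Proof. intros H. apply sqrt_lt_R0. specialize (Hpos s h H). lra. Qed.

Lemma cos_depart_pos s h : 0 < h < 3/5 -> cos_depart x y dx dy s (s + h) = cosine (based s) h.
Proof.
  intros Hh. assert (A : Rabs h < 3/5) by (rewrite Rabs_right; lra).
  unfold cos_depart, cosine. rewrite dot_chord, chord_average, (Rabs_right h) by lra.
  pose proof (sqrt_pos' s h A). field. lra.
Qed.

Lemma cos_depart_neg s h : - (3/5) < h < 0 -> cos_depart x y dx dy s (s + h) = - cosine (based s) h.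
Proof.
  intros Hh. assert (A : Rabs h < 3/5) by (rewrite Rabs_left; lra).
  unfold cos_depart, cosine. rewrite dot_chord, chord_average, (Rabs_left h) by lra.
  pose proof (sqrt_pos' s h A). field. lra.
Qed.

Lemma cos_arrive_depart s h : cos_arrive x y dx dy (s + h) s = - cos_depart x y dx dy s (s + h).
Proof.
  unfold cos_arrive, cos_depart. rewrite (chord_sym x y (s + h) s). unfold Rdiv. ring.
Qed.

Lemma sine_sign s h : h <> 0 -> Rabs h < 3/5 -> 0 < h * sine (based s) h.
Proof.
  intros H0 A. pose proof (sqrt_pos' s h A) as S.
  assert (C : 0 < cross (dx 1%nat s) (dy 1%nat s) (x (s + h) - x s) (y (s + h) - y s)).
  { apply (convex_cross x y dx dy BC). replace (s + h - s) with h by ring.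
    split; [now apply Rabs_pos_lt|lra]. }
  rewrite cross_chord in C. unfold sine. rewrite <- Rmult_assoc.
  apply Rmult_lt_0_compat; auto. now apply Rinv_0_lt_compat.
Qed.

Lemma sine_cosine_sq s h : Rabs h < 3/5 -> sine (based s) h ^ 2 + cosine (based s) h ^ 2 = 1.
Proof.
  intros A. pose proof (sqrt_pos' s h A) as S. unfold sine, cosine.
  assert (E : sqrt (chord_sq (based s) h) * sqrt (chord_sq (based s) h) = chord_sq (based s) h).
  { apply sqrt_sqrt. specialize (Hpos s h A). lra. }
  set (n := sqrt (chord_sq (based s) h)) in *. unfold chord_sq in E.
  replace ((avgA (based s) h * / n) ^ 2 + (avgB (based s) h * / n) ^ 2)
    with ((avgA (based s) h * avgA (based s) h + avgB (based s) h * avgB (based s) h) / (n * n)) by (field; lra).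
  rewrite <- E. field. lra.
Qed.

Lemma sin_angle_sine s h : 0 < h < 3/5 -> sin_angle x y dx dy s (s + h) = sine (based s) h.
Proof.
  intros Hh. assert (A : Rabs h < 3/5) by (rewrite Rabs_right; lra).
  pose proof (sqrt_pos' s h A) as S. pose proof (sine_sign s h ltac:(lra) A) as P.
  unfold sin_angle. rewrite cross_chord, chord_average, (Rabs_right h) by lra.
  unfold sine in *. assert (0 < avgA (based s) h).
  { assert (0 < avgA (based s) h * / sqrt (chord_sq (based s) h)) by nra.
    apply (Rmult_lt_reg_r (/ sqrt (chord_sq (based s) h))); [now apply Rinv_0_lt_compat|lra]. }
  rewrite Rabs_right by nra. field. lra.
Qed.

(** Equal cosines leave the sines equal up to sign, and strict convexity fixes the signs. The terms
    add up to zero because on the incoming side the chord is divided by a negative [h]. *)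
Lemma reflection_sine s hp hm : 0 < hp < 3/5 -> 0 < hm < 3/5 ->
  cos_arrive x y dx dy (s - hm) s = cos_depart x y dx dy s (s + hp) ->
  sine (based s) hp + sine (based s) (- hm) = 0.
Proof.
  intros Hp Hm E.
  assert (A1 : Rabs hp < 3/5) by (rewrite Rabs_right; lra).
  assert (A2 : Rabs (- hm) < 3/5) by (rewrite Rabs_Ropp, Rabs_right; lra).
  replace (s - hm) with (s + - hm) in E by ring.
  rewrite cos_arrive_depart, (cos_depart_pos s hp), (cos_depart_neg s (- hm)) in E by lra.
  pose proof (sine_cosine_sq s hp A1) as S1. pose proof (sine_cosine_sq s (- hm) A2) as S2.
  pose proof (sine_sign s hp ltac:(lra) A1) as P1. pose proof (sine_sign s (- hm) ltac:(lra) A2) as P2.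
  set (u := sine (based s) hp) in *. set (v := sine (based s) (- hm)) in *.
  assert (0 < u) by nra. assert (v < 0) by nra.
  assert (F : (u + v) * (u - v) = 0).
  { replace ((u + v) * (u - v)) with (u ^ 2 - v ^ 2) by ring.
    rewrite <- E in S1. rewrite Ropp_involutive in S1. lra. }
  apply Rmult_integral in F. destruct F; lra.
Qed.

Variable eta : R.
Hypothesis Heta : forall s h, Rabs h < 3/5 -> Rabs (cosine (based s) h - cos (PI * h)) <= eta.

(** The families reach only [|h| < 3/5]; a longer step is read as a backward step of length at most
    2/5. *)
Lemma cos_depart_close s h : 0 < h < 1 -> Rabs (cos_depart x y dx dy s (s + h) - cos (PI * h)) <= eta.
Proof.
  intros Hh. destruct (Rlt_dec h (3/5)).
  - rewrite cos_depart_pos by lra. apply Heta. rewrite Rabs_right; lra.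
  - rewrite <- (cos_depart_shift_r x y dx dy BC).
    replace (s + h - 1) with (s + (h - 1)) by ring. rewrite cos_depart_neg by lra.
    replace (PI * h) with (PI * (h - 1) + PI) by ring. rewrite neg_cos.
    replace (- cosine (based s) (h - 1) - - cos (PI * (h - 1))) with (- (cosine (based s) (h - 1) - cos (PI * (h - 1)))) by ring.
    rewrite Rabs_Ropp. apply Heta. rewrite Rabs_left; lra.
Qed.

Lemma cos_arrive_close s h : 0 < h < 1 -> Rabs (cos_arrive x y dx dy (s - h) s - cos (PI * h)) <= eta.
Proof.
  intros Hh. destruct (Rlt_dec h (3/5)).
  - replace (s - h) with (s + - h) by ring. rewrite cos_arrive_depart, cos_depart_neg by lra.
    rewrite Ropp_involutive. rewrite <- cos_neg. replace (- (PI * h)) with (PI * - h) by ring.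
    apply Heta. rewrite Rabs_Ropp, Rabs_right; lra.
  - replace (s - h) with (s + (1 - h) - 1) by ring. rewrite (cos_arrive_shift_l x y dx dy BC), cos_arrive_depart.
    rewrite cos_depart_pos by lra.
    replace (PI * h) with (- (PI * (1 - h)) + PI) by ring. rewrite neg_cos, cos_neg.
    replace (- cosine (based s) (1 - h) - - cos (PI * (1 - h))) with (- (cosine (based s) (1 - h) - cos (PI * (1 - h)))) by ring.
    rewrite Rabs_Ropp. apply Heta. rewrite Rabs_right; lra.
Qed.
End Link.

(** Here [a] is a step too long for [turning_step] and [b] a much shorter neighbour. The gap 1/100
    exceeds two closeness errors of 1/1000, so the reflection law forbids such a pair. *)
Lemma cos_gap a b : 2/5 <= a <= 1 -> 0 <= b <= 7/20 -> / 100 <= cos (PI * b) - cos (PI * a).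
Proof.
  intros Ha Hb. pose proof PI_RGT_0.
  assert (C1 : cos (PI * a) <= cos (PI * (2/5))) by (apply cos_decr_1; nra).
  assert (C2 : cos (PI * (7/20)) <= cos (PI * b)) by (apply cos_decr_1; nra).
  assert (C3 : / 100 <= cos (PI * (7/20)) - cos (PI * (2/5))).
  { rewrite form2.
    replace ((PI * (7/20) - PI * (2/5)) / 2) with (- (PI * (1/40))) by field.
    replace ((PI * (7/20) + PI * (2/5)) / 2) with (PI * (3/8)) by field. rewrite sin_neg.
    pose proof (sin_PI_lower (1/40) ltac:(lra)). pose proof (sin_PI_lower (3/8) ltac:(lra)). nra. }
  lra.
Qed.

Lemma telescope_bound (f : nat -> R) n i j : (i <= n)%nat -> (j <= n)%nat ->
  Rabs (f j - f i) <= sumR n (fun l => Rabs (f (S l) - f l)).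
Proof.
  assert (L : forall i j, (i <= j)%nat -> (j <= n)%nat ->
     Rabs (f j - f i) <= sumR n (fun l => Rabs (f (S l) - f l))).
  { clear i j. intros i j Hij Hj.
    replace (f j - f i) with (sumR (j - i) (fun l => f (S (i + l)) - f (i + l)%nat)).
    - eapply Rle_trans; [apply sumR_abs|].
      replace n with (i + ((j - i) + (n - j)))%nat by lia. rewrite sumR_add, sumR_add.
      assert (0 <= sumR i (fun l => Rabs (f (S l) - f l))) by (apply sumR_nonneg; intros; apply Rabs_pos).
      assert (0 <= sumR (n - j) (fun i0 => Rabs (f (S (i + (j - i + i0))) - f (i + (j - i + i0))%nat)))
        by (apply sumR_nonneg; intros; apply Rabs_pos).
      lra.
    - rewrite (sumR_ext (j - i) _ (fun l => f (i + S l)%nat - f (i + l)%nat))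
        by (intros; now rewrite Nat.add_succ_r).
      rewrite (sumR_telescope (j - i) (fun l => f (i + l)%nat)). rewrite Nat.add_0_r. do 2 f_equal. lia. }
  intros Hi Hj. destruct (le_lt_dec i j); [apply L; auto|].
  rewrite Rabs_minus_sym. apply L; auto; lia.
Qed.

Lemma finite_max (f : nat -> R) n : (1 <= n)%nat -> exists m, (m < n)%nat /\ forall j, (j < n)%nat -> f j <= f m.
Proof.
  intros Hn. induction n as [|n IH]; [lia|]. destruct (Nat.eq_dec n 0) as [->|N].
  - exists 0%nat. split; [lia|]. intros j Hj. replace j with 0%nat by lia. lra.
  - destruct IH as [m [Hm H]]; [lia|]. destruct (Rle_dec (f m) (f n)).
    + exists n. split; [lia|]. intros j Hj. destruct (Nat.eq_dec j n) as [->|]; [lra|].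
      specialize (H j ltac:(lia)). lra.
    + exists m. split; [lia|]. intros j Hj. destruct (Nat.eq_dec j n) as [->|]; [lra|]. apply H; lia.
Qed.

(* The oscillation of [y] is at most [2 K M^3] with [M = max y], because one factor of each fourth power is summed to
   1; this bounds [M] by [2 / q] first, and then the oscillation by [O(q^-3)]. *)
Lemma steps_equalize (K : R) (q : nat) (y : nat -> R) : (1 <= q)%nat -> 0 <= K <= / 4 ->
  (forall j, (j < q)%nat -> 0 <= y j) -> sumR q y = 1 ->
  (forall j, (S j < q)%nat -> Rabs (y (S j) - y j) <= K * (y j ^ 4 + y (S j) ^ 4)) ->
  forall j, (j < q)%nat -> y j <= 2 / INR q /\ Rabs (y j - / INR q) <= 16 * K / INR q ^ 3.
Proof.
  intros Hq HK Hy Hsum Hd. assert (HQ : 0 < INR q) by (apply lt_0_INR; lia).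
  destruct (finite_max y q Hq) as [m [Hm Hmax]].
  set (M := y m) in *. assert (M0 : 0 <= M) by (apply Hy; auto).
  assert (En : exists n, q = S n) by (exists (q - 1)%nat; lia). destruct En as [n En].
  assert (M1 : M <= 1).
  { rewrite <- Hsum. replace q with (m + (1 + (q - m - 1)))%nat by lia.
    rewrite !sumR_add. cbn [sumR]. rewrite Nat.add_0_r. fold M.
    assert (0 <= sumR m y) by (apply sumR_nonneg; intros; apply Hy; lia).
    assert (0 <= sumR (q - m - 1) (fun i => y (m + (1 + i))%nat)) by (apply sumR_nonneg; intros; apply Hy; lia).
    lra. }
  assert (P4 : forall j, (j < q)%nat -> y j ^ 4 <= M ^ 3 * y j).
  { intros j Hj. specialize (Hy j Hj). specialize (Hmax j Hj). fold M in Hmax.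
    replace (y j ^ 4) with (y j ^ 3 * y j) by ring. apply Rmult_le_compat_r; auto. apply pow_incr; auto. }
  assert (Hosc : forall i j, (i < q)%nat -> (j < q)%nat -> Rabs (y j - y i) <= 2 * K * M ^ 3).
  { intros i j Hi Hj.
    eapply Rle_trans; [apply (telescope_bound y n i j); lia|].
    apply Rle_trans with (sumR n (fun l => K * M ^ 3 * (y l + y (S l)))).
    - apply sumR_le. intros l Hl. eapply Rle_trans; [apply Hd; lia|].
      pose proof (P4 l ltac:(lia)). pose proof (P4 (S l) ltac:(lia)).
      replace (K * M ^ 3 * (y l + y (S l))) with (K * (M ^ 3 * y l + M ^ 3 * y (S l))) by ring.
      apply Rmult_le_compat_l; lra.
    - rewrite sumR_scal, sumR_plus.
      assert (B1 : sumR n y <= 1).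
      { rewrite <- Hsum, En. cbn [sumR]. specialize (Hy n ltac:(lia)). lra. }
      assert (B2 : sumR n (fun l => y (S l)) <= 1).
      { rewrite <- Hsum, En. change (S n) with (1 + n)%nat. rewrite sumR_add. cbn [sumR].
        specialize (Hy 0%nat ltac:(lia)). simpl Nat.add. lra. }
      assert (0 <= K * M ^ 3) by (apply Rmult_le_pos; [lra|apply pow_le; auto]). nra. }
  assert (Hmean : forall j, (j < q)%nat -> Rabs (y j - / INR q) <= 2 * K * M ^ 3).
  { intros j Hj. apply (Rmult_le_reg_l (INR q)); auto.
    rewrite <- (Rabs_right (INR q)) at 1 by lra. rewrite <- Rabs_mult.
    replace (INR q * (y j - / INR q)) with (sumR q (fun i => y j - y i)).
    - eapply Rle_trans; [apply sumR_abs|]. rewrite <- sumR_const. apply sumR_le; auto.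
    - rewrite sumR_minus, sumR_const, Hsum. field. lra. }
  assert (HM : M <= 2 / INR q).
  { pose proof (Hmean m Hm) as B. fold M in B. apply Rabs_le_between in B.
    assert (M ^ 3 <= M) by (assert (M ^ 2 <= 1) by nra; simpl in *; nra).
    assert (2 * K * M ^ 3 <= / 2 * M).
    { assert (0 <= M ^ 3) by (apply pow_le; auto). nra. }
    unfold Rdiv. lra. }
  intros j Hj. split.
  - eapply Rle_trans; [apply Hmax; auto|exact HM].
  - eapply Rle_trans; [apply Hmean; auto|].
    assert (M ^ 3 <= (2 / INR q) ^ 3) by (apply pow_incr; auto).
    replace (16 * K / INR q ^ 3) with (2 * K * (2 / INR q) ^ 3) by (field; lra).
    apply Rmult_le_compat_l; lra.
Qed.

Section Lazutkin.
Variables (x y : R -> R) (dx dy : nat -> R -> R).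
Hypothesis BC : boundary_curve x y dx dy.
Hypothesis SM : symmetric_marked x y.
Hypothesis HT : 1 <= laz_total dx dy.
Hypothesis Cr : forall s, continuous (laz_density dx dy) s.

Lemma curvature_periodic s : curvature dx dy (s + 1) = curvature dx dy s.
Proof.
  unfold curvature. destruct (curve_periodic x y dx dy BC 1 s ltac:(lia)) as [-> ->].
  destruct (curve_periodic x y dx dy BC 2 s ltac:(lia)) as [-> ->]. reflexivity.
Qed.

Lemma laz_density_periodic s : laz_density dx dy (s + 1) = laz_density dx dy s.
Proof. unfold laz_density, cbrt_curv. now rewrite curvature_periodic. Qed.

Lemma laz_density_even s : laz_density dx dy (- s) = laz_density dx dy s.
Proof. unfold laz_density, cbrt_curv. now rewrite (curvature_even x y dx dy BC SM). Qed.

Lemma laz_0 : laz dx dy 0 = 0.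
Proof. unfold laz. rewrite (RInt_point (V:=R_CompleteNormedModule)). apply Rmult_0_r. Qed.

Lemma laz_period s : laz dx dy (s + 1) = laz dx dy s + 1.
Proof.
  unfold laz. rewrite <- (RInt_Chasles_cont (laz_density dx dy) 0 s (s + 1) Cr).
  rewrite (RInt_periodic (laz_density dx dy) s Cr laz_density_periodic).
  fold (laz_total dx dy). field. lra.
Qed.

Lemma laz_opp s : laz dx dy (- s) = - laz dx dy s.
Proof.
  unfold laz.
  pose proof (RInt_reflect (laz_density dx dy) 0 s 0 Cr) as E.
  rewrite Rminus_diag, Rminus_0_l in E.
  rewrite (RInt_ext (fun t => laz_density dx dy (0 - t)) (laz_density dx dy)) in E
    by (intros; rewrite Rminus_0_l; apply laz_density_even).
  pose proof (RInt_Chasles_cont (laz_density dx dy) 0 (- s) 0 Cr) as E2.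
  rewrite (RInt_point (V:=R_CompleteNormedModule)) in E2. change zero with 0 in E2.
  rewrite <- E in E2. replace (RInt (laz_density dx dy) 0 (- s)) with (- RInt (laz_density dx dy) 0 s) by lra. ring.
Qed.

Lemma laz_1 : laz dx dy 1 = 1.
Proof. replace 1 with (0 + 1) at 1 by ring. rewrite laz_period, laz_0. ring. Qed.

Lemma laz_half : laz dx dy (1 / 2) = 1 / 2.
Proof.
  pose proof (laz_period (- (1/2))) as E. replace (- (1/2) + 1) with (1/2) in E by field.
  rewrite laz_opp in E. lra.
Qed.
End Lazutkin.

(** Nothing is known beforehand about the steps, while [turning_step] stops at length 2/5; long
    steps are therefore excluded before any expansion. The constants depend neither on the curve nor
    on [q], so small periods are covered as well. *)
Lemma maximizer_orbit_asymptotics : exists C d, 0 <= C /\ 0 < d <= 1 /\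
  forall x y dx dy delta, boundary_curve x y dx dy -> symmetric_marked x y ->
  close_to_circle delta x y dx dy -> delta <= d ->
  forall q s, (2 <= q)%nat -> maximizer x y q s ->
  forall j, (j < q)%nat ->
    Rabs (laz dx dy (lift_orbit q s (S j)) - laz dx dy (lift_orbit q s j) - / INR q) <= C * delta / INR q ^ 3 /\
    Rabs (sin_angle x y dx dy (lift_orbit q s j) (lift_orbit q s (S j))
          - laz_angle dx dy (lift_orbit q s j) / PI * sin (PI / INR q)) <= C * delta / INR q ^ 3.
Proof.
  destruct close_angle as (d1 & Hd1 & Hchord & Cang).
  destruct (Cang 0%nat ltac:(lia)) as [_ [[Ca [HCa Bcos]] _]].
  destruct close_lazutkin as (d2 & Hd2 & _ & _ & Dg & HT & _).
  destruct turning_step as (C3 & d3 & HC3 & Hd3 & T3).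
  destruct sine_taylor as (C4 & d4 & HC4 & Hd4 & T4).
  destruct laz_taylor as (C5 & d5 & HC5 & Hd5 & T5).
  set (d6 := / (1000 * (Ca + C3 + C5 + 1))).
  assert (Hd6 : 0 < d6) by (apply Rinv_0_lt_compat; lra).
  set (d := Rmin (Rmin d1 (Rmin d2 d3)) (Rmin d4 (Rmin d5 d6))).
  assert (L1 : d <= d1) by (eapply Rle_trans; [apply Rmin_l|apply Rmin_l]).
  assert (L2 : d <= d2) by (eapply Rle_trans; [apply Rmin_l|eapply Rle_trans; [apply Rmin_r|apply Rmin_l]]).
  assert (L3 : d <= d3) by (eapply Rle_trans; [apply Rmin_l|eapply Rle_trans; [apply Rmin_r|apply Rmin_r]]).
  assert (L4 : d <= d4) by (eapply Rle_trans; [apply Rmin_r|apply Rmin_l]).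
  assert (L5 : d <= d5) by (eapply Rle_trans; [apply Rmin_r|eapply Rle_trans; [apply Rmin_r|apply Rmin_l]]).
  assert (L6 : d <= d6) by (eapply Rle_trans; [apply Rmin_r|eapply Rle_trans; [apply Rmin_r|apply Rmin_r]]).
  assert (Hd : 0 < d) by (unfold d; repeat apply Rmin_glb_lt; lra).
  (* [256 C3] is [16 * 16 C3] from [steps_equalize]; [h ^ 3 <= 64 / q ^ 3] enters twice with [C4];
     the 5 bounds [laz_angle]; [40 C5] comes from [sin_linear_comparison]. *)
  exists (256 * C3 + 128 * C4 + 5 * (256 * C3) + 40 * C5), d.
  split; [nra|]. split; [lra|].
  intros x y dx dy delta BC SM CL Hdl q s Hq HM.
  assert (ND : forall z, near_disk (based dx dy delta z)).
  { intros z. apply (near_disk_of_close x y); auto. lra. }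
  assert (Hdel := near_disk_dl _ (ND 0)). change (0 <= delta <= 1) in Hdel.
  assert (NDL : forall e, d <= e -> forall z, near_disk_le e (based dx dy delta z)).
  { intros e He z. split; [apply ND|]. change (delta <= e). lra. }
  assert (Hsm : forall K, 0 <= K -> K <= Ca + C3 + C5 -> K * delta <= / 1000).
  { intros K HK0 HK. apply Rle_trans with ((Ca + C3 + C5 + 1) * d6).
    - apply Rmult_le_compat; lra.
    - unfold d6. right. field. lra. }
  assert (Hpos : forall z h, Rabs h < 3/5 -> / 200 <= chord_sq (based dx dy delta z) h).
  { intros z h Hh. apply Hchord; auto. }
  assert (Hcos : forall z h, Rabs h < 3/5 -> Rabs (cosine (based dx dy delta z) h - cos (PI * h)) <= / 1000).
  { intros z h Hh. destruct (Bcos _ (NDL d1 L1 z) h Hh) as (_ & _ & B).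
    eapply Rle_trans; [apply B|]. apply (Hsm Ca); lra. }
  assert (HTot : 1 <= laz_total dx dy) by (apply (HT _ (NDL d2 L2 0))).
  assert (Cr : forall z, continuous (laz_density dx dy) z).
  { intros z. apply ex_derive_cont. unfold laz_density.
    apply ex_derive_mult; apply (Dg _ (NDL d2 L2 0)). }
  set (sg := lift_orbit q s). set (h := fun j => sg (S j) - sg j).
  assert (S0 : sg 0%nat = 0) by (eapply lift_0; eauto).
  assert (Sq : sg q = 1) by (eapply lift_q; eauto).
  assert (Sinc : forall j, (j < q)%nat -> sg j < sg (S j)) by (apply (lift_strict x y dx dy BC SM q s Hq HM)).
  assert (Smono : forall i j, (i <= j)%nat -> (j <= q)%nat -> sg i <= sg j).
  { intros i j Hij. induction Hij; intros Hj; [lra|]. specialize (Sinc m ltac:(lia)). specialize (IHHij ltac:(lia)). lra. }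
  assert (Smir : forall j, (j <= q)%nat -> sg (q - j)%nat = 1 - sg j) by (intros j; eapply lift_mirror; eauto).
  assert (Refl : forall j, (1 <= j)%nat -> (j < q)%nat ->
     cos_arrive x y dx dy (sg (j - 1)%nat) (sg j) = cos_depart x y dx dy (sg j) (sg (S j)))
    by (apply (lift_reflection x y dx dy BC SM q s Hq HM)).
  assert (Hrange : forall j, (j <= q)%nat -> 0 <= sg j <= 1).
  { intros j Hj. rewrite <- S0, <- Sq at 1. split; apply Smono; lia. }
  assert (Hh : forall j, (j < q)%nat -> 0 < h j <= 1).
  { intros j Hj. unfold h. specialize (Sinc j Hj). pose proof (Hrange j ltac:(lia)). pose proof (Hrange (S j) ltac:(lia)). lra. }
  (* Beside a step longer than 2/5 every neighbouring step exceeds 7/20, by [cos_gap]; a long step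
     and its two neighbours together exceed the perimeter. *)
  assert (Hlong : (3 <= q)%nat -> forall j, (j < q)%nat -> h j <= 2/5).
  { intros Hq3.
    assert (Hh1 : forall j, (j < q)%nat -> h j < 1).
    { intros j Hj. unfold h. destruct (Nat.eq_dec j 0) as [->|N].
      - pose proof (Sinc 1%nat ltac:(lia)). pose proof (Hrange 2%nat ltac:(lia)). lra.
      - pose proof (Smono 1%nat j ltac:(lia) ltac:(lia)). pose proof (Sinc 0%nat ltac:(lia)).
        pose proof (Hrange (S j) ltac:(lia)). lra. }
    assert (Nb : forall j, (S j < q)%nat -> (h j > 2/5 -> h (S j) > 7/20) /\ (h (S j) > 2/5 -> h j > 7/20)).
    { intros j Hj. pose proof (Refl (S j) ltac:(lia) Hj) as E. replace (S j - 1)%nat with j in E by lia.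
      pose proof (Hh j ltac:(lia)). pose proof (Hh (S j) ltac:(lia)).
      pose proof (Hh1 j ltac:(lia)). pose proof (Hh1 (S j) ltac:(lia)).
      pose proof (cos_arrive_close x y dx dy delta BC Hpos (/ 1000) Hcos (sg (S j)) (h j) ltac:(lra)) as B1.
      pose proof (cos_depart_close x y dx dy delta BC Hpos (/ 1000) Hcos (sg (S j)) (h (S j)) ltac:(lra)) as B2.
      replace (sg (S j) - h j) with (sg j) in B1 by (unfold h; ring).
      replace (sg (S j) + h (S j)) with (sg (S (S j))) in B2 by (unfold h; ring).
      rewrite E in B1. apply Rabs_le_between in B1. apply Rabs_le_between in B2.
      split; intros Hbig.
      - destruct (Rlt_dec (7/20) (h (S j))) as [|Nn]; [lra|].
        pose proof (cos_gap (h j) (h (S j)) ltac:(lra) ltac:(lra)). lra.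
      - destruct (Rlt_dec (7/20) (h j)) as [|Nn]; [lra|].
        pose proof (cos_gap (h (S j)) (h j) ltac:(lra) ltac:(lra)). lra. }
    (* The first step has a single neighbour within the lift; the last step, its mirror image,
       supplies the missing length. *)
    assert (Z0 : h 0%nat <= 2/5).
    { destruct (Rle_dec (h 0%nat) (2/5)) as [|N]; auto. exfalso.
      destruct (Nb 0%nat ltac:(lia)) as [A _]. specialize (A ltac:(lra)).
      pose proof (Smir 1%nat ltac:(lia)) as E.
      pose proof (Smono 2%nat (q - 1)%nat ltac:(lia) ltac:(lia)) as E2. unfold h in *. lra. }
    intros j Hj. destruct (Rle_dec (h j) (2/5)) as [|N]; auto. exfalso.
    destruct (Nat.eq_dec j 0) as [->|N0]; [lra|].
    destruct (Nat.eq_dec (S j) q) as [Ej|N1].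
    - pose proof (Smir 1%nat ltac:(lia)) as E. replace (q - 1)%nat with j in E by lia.
      unfold h in N. rewrite Ej, Sq, E in N. unfold h in Z0. rewrite S0 in Z0. lra.
    - destruct (Nb (j - 1)%nat ltac:(lia)) as [_ A]. replace (S (j - 1)) with j in A by lia.
      specialize (A ltac:(lra)). destruct (Nb j ltac:(lia)) as [B _]. specialize (B ltac:(lra)).
      pose proof (Hrange (j - 1)%nat ltac:(lia)). pose proof (Hrange (S (S j)) ltac:(lia)).
      unfold h in *. replace (S (j - 1)) with j in A by lia. lra. }
  set (X := laz dx dy). set (yy := fun j => X (sg (S j)) - X (sg j)).
  assert (HYf : forall j, (j < q)%nat -> Yf (based dx dy delta (sg j)) (h j) = yy j).
  { intros j Hj. unfold Yf, yy, X, h, based; simpl. do 2 f_equal. ring. }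
  (* For [q = 2] both steps are 1/2, beyond the range of [turning_step]; symmetry alone determines
     them. *)
  assert (Hhalf : forall j, (j < q)%nat -> h j <= 1/2).
  { destruct (Nat.eq_dec q 2) as [E2|N2]; [|intros j Hj; specialize (Hlong ltac:(lia) j Hj); lra].
    assert (E : sg 1%nat = 1/2).
    { pose proof (Smir 1%nat ltac:(lia)) as E. rewrite E2 in E. simpl in E. lra. }
    rewrite E2 in Sq. intros j Hj. unfold h.
    assert (Hj' : j = 0%nat \/ j = 1%nat) by lia. destruct Hj' as [-> | ->]; lra. }
  assert (Hcomp : forall j, (j < q)%nat -> h j <= 2 * yy j /\ 0 <= yy j).
  { intros j Hj. destruct (T5 _ (NDL d5 L5 (sg j))) as (_ & D & _ & B).
    pose proof (Hhalf j Hj). pose proof (Hh j Hj).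
    destruct (B (h j)) as [B1 _]; [rewrite Rabs_right; lra|]. rewrite (HYf j Hj), (Rabs_right (h j)) in B1 by lra.
    change (pdl (based dx dy delta (sg j))) with delta in B1.
    pose proof (Hsm C5 HC5 ltac:(lra)). apply Rabs_le_between in B1. split; nra. }
  assert (HX0 : X 0 = 0) by apply laz_0.
  assert (HX1 : X 1 = 1) by (apply (laz_1 x y dx dy BC HTot Cr)).
  assert (Hsum : sumR q yy = 1).
  { unfold yy. rewrite (sumR_telescope q (fun j => X (sg j))). rewrite S0, Sq, HX0, HX1. ring. }
  (* The bound of [turning_step] is in terms of [h]; passing to Lazutkin steps through [h <= 2 yy]
     multiplies the fourth powers by 16. For [q = 2] the Lazutkin steps are exactly 1/2. *)
  assert (Heq : forall j, (j < q)%nat -> yy j <= 2 / INR q /\ Rabs (yy j - / INR q) <= 16 * (16 * C3 * delta) / INR q ^ 3).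
  { assert (HQ : 0 < INR q) by (apply lt_0_INR; lia).
    assert (HC3d : 0 <= 16 * C3 * delta <= / 4).
    { pose proof (Hsm C3 HC3 ltac:(lra)). split; [repeat apply Rmult_le_pos; lra|lra]. }
    destruct (Nat.eq_dec q 2) as [E2|N2].
    - assert (E : sg 1%nat = 1/2).
      { pose proof (Smir 1%nat ltac:(lia)) as E. rewrite E2 in E. simpl in E. lra. }
      assert (HXh : X (1/2) = 1/2) by (apply (laz_half x y dx dy BC SM HTot Cr)).
      assert (Ey : forall j, (j < q)%nat -> yy j = 1/2).
      { intros j Hj. unfold yy. assert (Hj' : j = 0%nat \/ j = 1%nat) by lia. destruct Hj' as [-> | ->].
        - rewrite E, S0, HXh, HX0. field.
        - rewrite <- E2, Sq, E, HXh, HX1. field. }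
      intros j Hj. rewrite Ey by auto. rewrite E2. simpl INR. split; [lra|].
      replace (1 / 2 - / (1 + 1)) with 0 by field. rewrite Rabs_R0. apply Rdiv_le_0_compat; [lra|]. apply pow_lt; lra.
    - apply steps_equalize; auto; [lia| |].
      + intros j Hj. now apply Hcomp.
      + intros j Hj.
        pose proof (Hlong ltac:(lia) j ltac:(lia)) as B1. pose proof (Hlong ltac:(lia) (S j) Hj) as B2.
        pose proof (Hh j ltac:(lia)) as P1. pose proof (Hh (S j) Hj) as P2.
        pose proof (Refl (S j) ltac:(lia) Hj) as E. replace (S j - 1)%nat with j in E by lia.
        replace (sg j) with (sg (S j) - h j) in E by (unfold h; ring).
        replace (sg (S (S j))) with (sg (S j) + h (S j)) in E by (unfold h; ring).
        pose proof (reflection_sine x y dx dy delta BC Hpos (sg (S j)) (h (S j)) (h j) ltac:(lra) ltac:(lra) E) as Es.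
        pose proof (T3 _ (NDL d3 L3 (sg (S j))) (h (S j)) (h j) ltac:(lra) ltac:(lra) Es) as B.
        rewrite (HYf (S j) Hj) in B. change (pdl (based dx dy delta (sg (S j)))) with delta in B.
        replace (Yf (based dx dy delta (sg (S j))) (- h j)) with (- yy j) in B.
        2:{ unfold Yf, yy, X, h, based; simpl. replace (sg (S j) + - (sg (S j) - sg j)) with (sg j) by ring. ring. }
        eapply Rle_trans; [apply B|].
        destruct (Hcomp j ltac:(lia)) as [H1 H1']. destruct (Hcomp (S j) Hj) as [H2 H2'].
        replace (16 * C3 * delta * (yy j ^ 4 + yy (S j) ^ 4)) with (C3 * delta * ((2 * yy j) ^ 4 + (2 * yy (S j)) ^ 4)) by ring.
        apply Rmult_le_compat_l; [nra|].
        assert (0 <= (2 * yy j) ^ 4) by (apply pow_le; lra). assert (0 <= (2 * yy (S j)) ^ 4) by (apply pow_le; lra).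
        apply Rmax_case.
        * assert (h (S j) ^ 4 <= (2 * yy (S j)) ^ 4) by (apply pow_incr; lra). lra.
        * assert (h j ^ 4 <= (2 * yy j) ^ 4) by (apply pow_incr; lra). lra. }
  intros j Hj. destruct (Heq j Hj) as [Y1 Y2].
  assert (HQ : 2 <= INR q) by (change 2 with (INR 2); now apply le_INR).
  set (Q := INR q) in *. assert (HQ3 : 0 < / Q ^ 3) by (apply Rinv_0_lt_compat, pow_lt; lra).
  change (laz dx dy (lift_orbit q s (S j)) - laz dx dy (lift_orbit q s j)) with (yy j).
  fold sg.
  assert (P4 : 0 <= C4 * delta) by nra. assert (P3 : 0 <= C3 * delta) by nra. assert (P5 : 0 <= C5 * delta) by nra.
  split.
  - eapply Rle_trans; [apply Y2|]. unfold Rdiv. apply Rmult_le_compat_r; lra.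
  (* Three replacements: the Taylor expansion gives [sin (c * yy j)], the step estimate turns [yy j]
     into [/ Q], and [sin_linear_comparison] extracts the factor [sin (PI / Q)], which does not
     depend on [j]. *)
  - pose proof (Hh j Hj) as P1. pose proof (Hhalf j Hj) as P2. destruct (Hcomp j Hj) as [H1 H1'].
    replace (sg (S j)) with (sg j + h j) by (unfold h; ring).
    rewrite (sin_angle_sine x y dx dy delta BC Hpos) by lra.
    destruct (T4 _ (NDL d4 L4 (sg j))) as (p3 & Bp3 & B4). specialize (B4 (h j)).
    rewrite Rabs_right in B4 by lra. specialize (B4 ltac:(lra)).
    destruct (T5 _ (NDL d5 L5 (sg j))) as (Bc & _).
    rewrite (HYf j Hj) in B4. change (pdl (based dx dy delta (sg j))) with delta in *.
    change (cf (based dx dy delta (sg j))) with (laz_angle dx dy (sg j)) in *.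
    set (c := laz_angle dx dy (sg j)) in *. set (Sn := sine (based dx dy delta (sg j)) (h j)) in *.
    assert (Hh3 : h j ^ 3 <= 64 * / Q ^ 3).
    { replace (64 * / Q ^ 3) with ((4 / Q) ^ 3) by (field; lra). apply pow_incr. unfold Rdiv in *. lra. }
    assert (Hh30 : 0 <= h j ^ 3) by (apply pow_le; lra).
    assert (Hh4 : 0 <= h j ^ 4 <= h j ^ 3).
    { split; [apply pow_le; lra|]. replace (h j ^ 4) with (h j ^ 3 * h j) by ring. nra. }
    assert (E1 : Rabs (Sn - sin (c * yy j)) <= 128 * (C4 * delta) * / Q ^ 3).
    { replace (Sn - sin (c * yy j)) with ((Sn - sin (c * yy j) - p3 * h j ^ 3) + p3 * h j ^ 3) by ring.
      eapply Rle_trans; [apply Rabs_triang|]. rewrite (Rabs_mult p3), (Rabs_right (h j ^ 3)) by lra.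
      assert (Rabs p3 * h j ^ 3 <= C4 * delta * h j ^ 3) by (apply Rmult_le_compat_r; auto).
      assert (C4 * delta * h j ^ 4 <= C4 * delta * h j ^ 3) by (apply Rmult_le_compat_l; lra).
      assert (C4 * delta * h j ^ 3 <= C4 * delta * (64 * / Q ^ 3)) by (apply Rmult_le_compat_l; lra).
      lra. }
    pose proof (Hsm C5 HC5 ltac:(lra)) as Hc5. pose proof PI_4 as HP4. pose proof PI2_3_2 as HP2.
    assert (Bc5 : Rabs c <= 5) by (apply Rabs_le; apply Rabs_le_between in Bc; lra).
    assert (E2 : Rabs (sin (c * yy j) - sin (c * / Q)) <= 5 * (256 * C3 * delta) * / Q ^ 3).
    { eapply Rle_trans; [apply Rabs_sin_diff|].
      replace (c * yy j - c * / Q) with (c * (yy j - / Q)) by ring. rewrite Rabs_mult.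
      rewrite Rmult_assoc. apply Rmult_le_compat; auto; try apply Rabs_pos.
      eapply Rle_trans; [apply Y2|]. right; field; lra. }
    assert (HiQ : 0 <= / Q <= 1).
    { split; [left; apply Rinv_0_lt_compat; lra|]. rewrite <- Rinv_1. apply Rinv_le_contravar; lra. }
    pose proof (sin_linear_comparison c (/ Q) HiQ ltac:(lra)) as E3.
    assert (E3' : Rabs (sin (c * / Q) - c / PI * sin (PI / Q)) <= 40 * (C5 * delta) * / Q ^ 3).
    { eapply Rle_trans; [apply E3|]. rewrite pow_inv. apply Rmult_le_compat_r; lra. }
    replace (Sn - c / PI * sin (PI / Q)) with
      ((Sn - sin (c * yy j)) + (sin (c * yy j) - sin (c * / Q)) + (sin (c * / Q) - c / PI * sin (PI / Q))) by ring.
    eapply Rle_trans; [apply Rabs_triang|].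
    eapply Rle_trans; [apply Rplus_le_compat_r, Rabs_triang|].
    unfold Rdiv at 2.
    replace ((256 * C3 + 128 * C4 + 5 * (256 * C3) + 40 * C5) * delta * / Q ^ 3) with
      (256 * (C3 * delta) * / Q ^ 3 + 128 * (C4 * delta) * / Q ^ 3 + 5 * (256 * C3 * delta) * / Q ^ 3 + 40 * (C5 * delta) * / Q ^ 3) by ring.
    assert (0 <= 256 * (C3 * delta) * / Q ^ 3) by nra. lra.
Qed.

(** * Injectivity *)

(** The inverse exists by the intermediate value theorem between consecutive integers, which [f]
    fixes. The lower bound on [df] makes it Lipschitz, and this is the continuity that the
    derivative of an inverse requires. *)
Lemma circle_lift_inverse (f df : R -> R) (m : R) : 0 < m ->
  (forall s, is_derive f s (df s)) -> (forall s, m <= df s) ->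
  f 0 = 0 -> (forall s, f (s + 1) = f s + 1) ->
  exists g, (forall t, f (g t) = t) /\ (forall s, g (f s) = s) /\ forall t, is_derive g t (/ df (g t)).
Proof.
  intros Hm Hd Hlow H0 Hper.
  assert (Hc : continuity f).
  { intros s. apply continuity_pt_filterlim. exact (derive_cont f s _ (Hd s)). }
  assert (Hn : forall n : Z, f (IZR n) = IZR n).
  { intros n. pose proof (periodic_Z (fun s => f s - s)) as P. cbv beta in P.
    assert (Pp : forall t, f (t + 1) - (t + 1) = f t - t) by (intros t; rewrite Hper; ring).
    specialize (P Pp n 0). rewrite H0, Rplus_0_l in P. lra. }
  assert (Hinc : forall a b, a <= b -> m * (b - a) <= f b - f a).
  { intros a b Hab. destruct (MVT_gen f a b df) as [c [_ E]]; [intros; apply Hd|intros; apply Hc|].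
    rewrite E. apply Rmult_le_compat_r; [lra|apply Hlow]. }
  assert (Ex : forall t, { s | f s = t }).
  { intros t. destruct (base_Int_part t) as [B1 B2].
    destruct (IVT_cor (fun s => f s - t) (IZR (Int_part t)) (IZR (Int_part t) + 1)) as [z [_ Hz]].
    - intros s. apply continuity_pt_minus; [apply Hc|apply continuity_pt_const; intros a b; reflexivity].
    - lra.
    - rewrite Hper, Hn. nra.
    - exists z. lra. }
  set (g := fun t => proj1_sig (Ex t)).
  assert (Hfg : forall t, f (g t) = t) by (intros t; exact (proj2_sig (Ex t))).
  assert (Hinj : forall a b, f a = f b -> a = b).
  { intros a b E. destruct (Rle_dec a b).
    - pose proof (Hinc a b ltac:(lra)). nra.
    - pose proof (Hinc b a ltac:(lra)). nra. }
  assert (Hgf : forall s, g (f s) = s) by (intros s; apply Hinj, Hfg).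
  exists g. split; auto. split; auto. intros t.
  assert (Hlip : forall a b, a <= b -> 0 <= g b - g a <= / m * (b - a)).
  { intros a b Hab. destruct (Rle_dec (g a) (g b)) as [L|L].
    - pose proof (Hinc _ _ L) as I. rewrite !Hfg in I. split; [lra|].
      apply (Rmult_le_reg_l m); auto. rewrite <- Rmult_assoc, Rinv_r by lra. lra.
    - pose proof (Hinc (g b) (g a) ltac:(lra)) as I. rewrite !Hfg in I. nra. }
  assert (Hgc : continuity_pt g t).
  { intros e He. exists (m * e). split; [nra|]. intros z [_ Hz]. unfold Rlimit.dist in *; simpl in *. unfold R_dist in *.
    assert (B : Rabs (g z - g t) <= / m * Rabs (z - t)).
    { destruct (Rle_dec t z).
      - pose proof (Hlip t z ltac:(lra)). rewrite !Rabs_right by lra. lra.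
      - pose proof (Hlip z t ltac:(lra)). rewrite !Rabs_left1 by lra. lra. }
    assert (0 < / m) by (now apply Rinv_0_lt_compat).
    apply Rle_lt_trans with (1 := B). apply (Rmult_lt_reg_l m); auto.
    rewrite <- Rmult_assoc, Rinv_r, Rmult_1_l by lra. lra. }
  assert (Prf : forall a, g (t - 1) <= a <= g (t + 1) -> derivable_pt f a).
  { intros a _. exists (df a). apply is_derive_Reals, Hd. }
  assert (Hg1 : g (t - 1) <= g t <= g (t + 1)).
  { pose proof (Hlip (t - 1) t ltac:(lra)). pose proof (Hlip t (t + 1) ltac:(lra)). lra. }
  assert (Ed : derive_pt f (g t) (Prf (g t) Hg1) = df (g t)).
  { apply derive_pt_eq_0, is_derive_Reals, Hd. }
  pose proof (Ranalysis5.derivable_pt_lim_recip_interv f g (t - 1) (t + 1) t Prf Hgc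
    ltac:(lra) ltac:(lra) Hg1) as D.
  rewrite Ed in D. apply is_derive_Reals. unfold Rdiv in D. rewrite Rmult_1_l in D. apply D.
  - intros z _. apply Hfg.
  - specialize (Hlow (g t)). lra.
Qed.

Section Transfer.
Variables (x y : R -> R) (dx dy : nat -> R -> R).
Hypothesis BC : boundary_curve x y dx dy.
Hypothesis SM : symmetric_marked x y.
Hypothesis Hk : forall s, 1 <= curvature dx dy s.
Hypothesis Hg : forall s, 1 <= cbrt_curv dx dy s.
Hypothesis HT : 1 <= laz_total dx dy.
Hypothesis Dlaz : forall s, is_derive (laz dx dy) s (/ laz_total dx dy * laz_density dx dy s).
Variable nu : R -> R.
Variable d : nat -> R -> R.
Hypothesis Hnu : forall i s, (i <= 2)%nat -> is_derive (d i) s (d (S i) s).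
Hypothesis Hnu0 : forall s, d 0%nat s = nu s.
Hypothesis Hper : forall s, nu (s + 1) = nu s.
Hypothesis Heven : forall s, nu (- s) = nu s.

Let g := cbrt_curv dx dy.
Let T := laz_total dx dy.
Let K1 s := dx 1%nat s * dy 3%nat s - dy 1%nat s * dx 3%nat s.
Let K2 s := dx 2%nat s * dy 3%nat s + dx 1%nat s * dy 4%nat s - (dy 2%nat s * dx 3%nat s + dy 1%nat s * dx 4%nat s).

Let Ddx k s : (k <= 8)%nat -> is_derive (dx k) s (dx (S k) s).
Proof. intros H; apply (curve_derive x y dx dy BC k s H). Qed.
Let Ddy k s : (k <= 8)%nat -> is_derive (dy k) s (dy (S k) s).
Proof. intros H; apply (curve_derive x y dx dy BC k s H). Qed.

Let prod_derive (a b : R -> R) s la lb : is_derive a s la -> is_derive b s lb ->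
  is_derive (fun s => a s * b s) s (la * b s + a s * lb).
Proof. intros; apply (is_derive_mult (K:=R_AbsRing)); auto; intros; apply Rmult_comm. Qed.

Let DK0 s : is_derive (curvature dx dy) s (K1 s).
Proof.
  unfold K1. replace (dx 1%nat s * dy 3%nat s - dy 1%nat s * dx 3%nat s) with
    ((dx 2%nat s * dy 2%nat s + dx 1%nat s * dy 3%nat s) - (dy 2%nat s * dx 2%nat s + dy 1%nat s * dx 3%nat s)) by ring.
  apply derive_minus; apply prod_derive; try apply Ddx; try apply Ddy; lia.
Qed.

Let DK1 s : is_derive K1 s (K2 s).
Proof. apply derive_minus; apply prod_derive; try apply Ddx; try apply Ddy; lia. Qed.

Let EK2 s : ex_derive K2 s.
Proof.
  exists (((dx 3%nat s * dy 3%nat s + dx 2%nat s * dy 4%nat s) + (dx 2%nat s * dy 4%nat s + dx 1%nat s * dy 5%nat s))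
     - ((dy 3%nat s * dx 3%nat s + dy 2%nat s * dx 4%nat s) + (dy 2%nat s * dx 4%nat s + dy 1%nat s * dx 5%nat s))).
  unfold K2. apply derive_minus; apply derive_plus;
    apply prod_derive; try apply Ddx; try apply Ddy; lia.
Qed.

(** The logarithmic derivative of [g]: writing [g' = g * r] keeps all later derivatives rational in
    [g]. *)
Let r s := K1 s / (3 * curvature dx dy s).
Let r1 s := (K2 s * curvature dx dy s - K1 s * K1 s) / (3 * curvature dx dy s ^ 2).

Let Dg s : is_derive g s (g s * r s).
Proof.
  pose proof (Hk s) as Hks. pose proof (DK0 s) as DKs.
  assert (A : is_derive (fun s => / 3 * ln (curvature dx dy s)) s (r s)).
  { replace (r s) with (/ 3 * (K1 s * / curvature dx dy s)) by (unfold r; field; lra).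
    apply is_derive_scal. apply (is_derive_comp ln (curvature dx dy)); auto.
    apply is_derive_Reals, derivable_pt_lim_ln. lra. }
  unfold g. replace (cbrt_curv dx dy s * r s) with (r s * cbrt_curv dx dy s) by ring.
  apply (is_derive_comp exp (fun s => / 3 * ln (curvature dx dy s))); auto.
  apply is_derive_Reals, derivable_pt_lim_exp.
Qed.

Let Dr s : is_derive r s (r1 s).
Proof.
  pose proof (Hk s) as Hks. unfold r, r1.
  replace ((K2 s * curvature dx dy s - K1 s * K1 s) / (3 * curvature dx dy s ^ 2))
    with ((K2 s * (3 * curvature dx dy s) - K1 s * (3 * K1 s)) / (3 * curvature dx dy s) ^ 2) by (field; lra).
  apply (is_derive_div K1 (fun s => 3 * curvature dx dy s)); auto; [|lra].
  apply is_derive_scal, DK0.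
Qed.

Let Er1 s : ex_derive r1 s.
Proof.
  pose proof (Hk s) as Hks. unfold r1.
  assert (E0 : ex_derive (curvature dx dy) s) by exact (ex_intro _ _ (DK0 s)).
  assert (E1 : ex_derive K1 s) by exact (ex_intro _ _ (DK1 s)).
  assert (E2 := EK2 s).
  auto_derive. repeat split; auto. apply Rmult_integral_contrapositive_currified; [lra|].
  repeat apply Rmult_integral_contrapositive_currified; lra.
Qed.

Let W s := d 1%nat s + nu s * r s.
Let W1 s := d 2%nat s + (d 1%nat s * r s + nu s * r1 s).

Let Dnu s : is_derive nu s (d 1%nat s).
Proof. apply (is_derive_ext (d 0%nat)); [apply Hnu0|apply Hnu; lia]. Qed.

Let DW s : is_derive W s (W1 s).
Proof.
  apply derive_plus; [apply Hnu; lia|].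
  apply prod_derive; auto.
Qed.

Definition transferred (s : R) : R := nu s * laz_angle dx dy s.

Let F s := transferred s.
(** [F1] and [F2] are the derivatives of [F] in the Lazutkin coordinate: each derivative in [s] is
    divided by [laz' = g ^ 2 / T]. *)
Let F1 s := T * T * / 2 * (W s / g s).
Let F2 s := T * T * T * / 2 * ((W1 s - W s * r s) / (g s * g s * g s)).

Let DF s : is_derive F s (F1 s * (/ T * laz_density dx dy s)).
Proof.
  pose proof (Hg s) as G1. fold g in G1. assert (G2 : g s <> 0) by lra.
  assert (T2 : T <> 0) by (unfold T; lra).
  apply (is_derive_ext (fun s => (T * / 2) * (nu s * g s))).
  - intros t. unfold F, transferred, laz_angle. fold g T. req; ring.
  - replace (F1 s * (/ T * laz_density dx dy s)) with ((T * / 2) * (d 1%nat s * g s + nu s * (g s * r s))).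
    + apply is_derive_scal, prod_derive; auto.
    + unfold F1, W, laz_density. fold g. field. auto.
Qed.

Let DF1 s : is_derive F1 s (F2 s * (/ T * laz_density dx dy s)).
Proof.
  pose proof (Hg s) as G1. fold g in G1. assert (G2 : g s <> 0) by lra.
  assert (T2 : T <> 0) by (unfold T; lra).
  unfold F1. replace (F2 s * (/ T * laz_density dx dy s)) with
    (T * T * / 2 * ((W1 s * g s - W s * (g s * r s)) / g s ^ 2)).
  - apply is_derive_scal, (is_derive_div W g); auto.
  - unfold F2, laz_density. fold g. field. auto.
Qed.

Let CF2 s : continuous F2 s.
Proof.
  pose proof (Hg s) as G1. fold g in G1. assert (G2 : g s <> 0) by lra.
  apply ex_derive_cont.
  assert (Eg : ex_derive g s) by exact (ex_intro _ _ (Dg s)).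
  assert (Ew : ex_derive W s) by exact (ex_intro _ _ (DW s)).
  assert (Er : ex_derive r s) by exact (ex_intro _ _ (Dr s)).
  assert (Er' := Er1 s).
  assert (E1 : ex_derive (d 1%nat) s) by exact (ex_intro _ _ (Hnu 1%nat s ltac:(lia))).
  assert (E2 : ex_derive (d 2%nat) s) by exact (ex_intro _ _ (Hnu 2%nat s ltac:(lia))).
  assert (E0 : ex_derive nu s) by exact (ex_intro _ _ (Dnu s)).
  unfold F2, W1. auto_derive. repeat split; auto.
Qed.

Lemma transfer_to_lazutkin : RInt (fun s => nu s * curvature dx dy s) 0 1 = 0 -> nu 0 = 0 ->
  exists u u1 u2 : R -> R,
  (forall t, is_derive u t (u1 t)) /\ (forall t, is_derive u1 t (u2 t)) /\ (forall t, continuous u2 t) /\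
  (forall t, u (t + 1) = u t) /\ (forall t, u (- t) = u t) /\ RInt u 0 1 = 0 /\ u 0 = 0 /\
  forall s, u (laz dx dy s) = transferred s.
Proof.
  intros Hmean Hzero.
  assert (Cr : forall s, continuous (laz_density dx dy) s).
  { intros s. apply cont_mult; exact (derive_cont g s _ (Dg s)). }
  assert (HiT : 0 < / T) by (apply Rinv_0_lt_compat; unfold T; lra).
  destruct (circle_lift_inverse (laz dx dy) (fun s => / T * laz_density dx dy s) (/ T) HiT Dlaz) as (Z & Z1 & Z2 & DZ).
  { intros s. unfold laz_density. specialize (Hg s). assert (1 <= cbrt_curv dx dy s * cbrt_curv dx dy s) by nra. nra. }
  { apply laz_0. }
  { apply (laz_period x y dx dy BC HT Cr). }
  assert (Zinj : forall a b, laz dx dy a = laz dx dy b -> a = b).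
  { intros a b E. rewrite <- (Z2 a), <- (Z2 b), E. reflexivity. }
  assert (Zper : forall t, Z (t + 1) = Z t + 1).
  { intros t. apply Zinj. rewrite (laz_period x y dx dy BC HT Cr), !Z1. reflexivity. }
  assert (Zodd : forall t, Z (- t) = - Z t).
  { intros t. apply Zinj. rewrite (laz_opp x y dx dy BC SM Cr), !Z1. reflexivity. }
  assert (Z0 : Z 0 = 0) by (rewrite <- (laz_0 dx dy) at 1; apply Z2).
  assert (Dpos : forall s, / T * laz_density dx dy s <> 0).
  { intros s. unfold laz_density. specialize (Hg s). assert (1 <= cbrt_curv dx dy s * cbrt_curv dx dy s) by nra. nra. }
  assert (Comp : forall f f1 : R -> R, (forall s, is_derive f s (f1 s * (/ T * laz_density dx dy s))) ->
     forall t, is_derive (fun t => f (Z t)) t (f1 (Z t))).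
  { intros f f1 D t.
    replace (f1 (Z t)) with (/ (/ T * laz_density dx dy (Z t)) * (f1 (Z t) * (/ T * laz_density dx dy (Z t)))).
    2:{ pose proof (Dpos (Z t)) as P. set (v := / T * laz_density dx dy (Z t)) in *. field. exact P. }
    apply (is_derive_comp f Z); auto. }
  exists (fun t => F (Z t)), (fun t => F1 (Z t)), (fun t => F2 (Z t)).
  assert (Eu : forall s, F (Z (laz dx dy s)) = transferred s) by (intros s; now rewrite Z2).
  split; [exact (Comp F F1 DF)|]. split; [exact (Comp F1 F2 DF1)|].
  repeat match goal with |- _ /\ _ => split end; [| | | | |exact Eu].
  - intros t. apply (continuous_comp Z F2); [exact (derive_cont Z t _ (DZ t))|apply CF2].
  - intros t. rewrite Zper. unfold F, transferred, laz_angle. rewrite Hper.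
    unfold cbrt_curv. rewrite (curvature_periodic x y dx dy BC). reflexivity.
  - intros t. rewrite Zodd. unfold F, transferred, laz_angle. rewrite Heven.
    unfold cbrt_curv. rewrite (curvature_even x y dx dy BC SM). reflexivity.
  (* After the change of variables the integrand is [nu] times [laz_angle * laz'], which is half the
     cube of [cbrt_curv], that is, half the curvature. *)
  - pose proof (RInt_comp (V:=R_CompleteNormedModule) (fun t => F (Z t)) (laz dx dy)
      (fun s => / T * laz_density dx dy s) 0 1) as E.
    rewrite (laz_0 dx dy), (laz_1 x y dx dy BC HT Cr) in E. rewrite <- E.
    + rewrite (RInt_ext _ (fun s => / 2 * (nu s * curvature dx dy s))).
      * rewrite RInt_scal_cont; [rewrite Hmean; req; ring|].
        intros t. apply cont_mult; [exact (derive_cont nu t _ (Dnu t))|exact (derive_cont _ t _ (DK0 t))].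
      * intros s _. change (scal ?a ?b) with (a * b). rewrite Eu. unfold transferred, laz_angle, laz_density.
        rewrite <- (cbrt_curv_cube dx dy s) by (specialize (Hk s); lra). fold T. req. field. unfold T; lra.
    + intros s _. refine (derive_cont _ _ _ (Comp F F1 DF _)).
    + intros s _. split; [apply Dlaz|]. apply cont_mult; [apply continuous_const|apply Cr].
  - unfold F, transferred. rewrite Z0, Hzero. ring.
Qed.
End Transfer.

Theorem theorem4p8 :
  exists delta : R, 0 < delta /\
  forall (x y : R -> R) (dx dy : nat -> R -> R),
    boundary_curve x y dx dy ->
    symmetric_marked x y ->
    close_to_circle delta x y dx dy ->
    forall orb : nat -> nat -> R,
      (forall q, (2 <= q)%nat -> maximizer x y q (orb q)) ->
      forall nu1 nu2 : R -> R, C_sym nu1 -> C_sym nu2 ->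
        (* T nu1 = T nu2 *)
        (exists I, is_RInt (fun s => nu1 s * curvature dx dy s) 0 1 I /\
                   is_RInt (fun s => nu2 s * curvature dx dy s) 0 1 I) ->
        nu1 0 = nu2 0 ->
        (forall q, (2 <= q)%nat ->
           ell_q x y dx dy q (orb q) nu1 = ell_q x y dx dy q (orb q) nu2) ->
        forall s, nu1 s = nu2 s.
Proof.
  destruct maximizer_orbit_asymptotics as (C & d1 & HC & Hd1 & Horb).
  destruct close_lazutkin as (d2 & Hd2 & Hk & Hg & Dg & HT & Dlaz & _).
  (* [/ 4000000] is the threshold of the rigidity lemma; the factor 16 comes from [PI <= 4],
     [/ c <= 2] and [/ sn <= 2 q], where [c] is [laz_angle] and [sn] is [sin (PI / q)]. *)
  set (d3 := / (16 * 4000000 * (C + 1))).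
  assert (Hd3 : 0 < d3) by (apply Rinv_0_lt_compat; lra).
  set (delta := Rmin d1 (Rmin d2 d3)).
  assert (L1 : delta <= d1) by apply Rmin_l.
  assert (L2 : delta <= d2) by (eapply Rle_trans; [apply Rmin_r|apply Rmin_l]).
  assert (L3 : delta <= d3) by (eapply Rle_trans; [apply Rmin_r|apply Rmin_r]).
  assert (Hdelta : 0 < delta) by (repeat apply Rmin_glb_lt; lra).
  exists delta. split; [exact Hdelta|].
  intros x y dx dy BC SM CL orb HM nu1 nu2 [[e1 (E10 & E1 & _)] [P1 V1]] [[e2 (E20 & E2 & _)] [P2 V2]]
    [I [[pr1 I1] [pr2 I2]]] H0 Hell s.
  assert (ND : near_disk_le d2 (based dx dy delta 0)).
  { split; [|exact L2]. apply (near_disk_of_close x y); auto. lra. }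
  specialize (Hk _ ND). specialize (Hg _ ND). specialize (Dg _ ND). specialize (HT _ ND). specialize (Dlaz _ ND).
  change (pdx (based dx dy delta 0)) with dx in *. change (pdy (based dx dy delta 0)) with dy in *.
  change (Tf (based dx dy delta 0)) with (laz_total dx dy) in *.
  set (nu := fun s => nu1 s - nu2 s).
  assert (Hnu : forall i s, (i <= 2)%nat ->
     is_derive (fun s => e1 i s - e2 i s) s (e1 (S i) s - e2 (S i) s)).
  { intros i z Hi. apply derive_minus; apply is_derive_Reals;
      [apply E1|apply E2]; unfold r_reg; lia. }
  assert (Hmean : RInt (fun s => nu s * curvature dx dy s) 0 1 = 0).
  { rewrite (RInt_ext _ (fun s => nu1 s * curvature dx dy s - nu2 s * curvature dx dy s))
      by (intros; unfold nu; req; ring).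
    rewrite (RInt_minus (V:=R_CompleteNormedModule)) by (now apply ex_RInt_Reals_1).
    rewrite (RInt_Reals _ _ _ pr1), (RInt_Reals _ _ _ pr2), I1, I2. apply Rminus_diag. }
  destruct (transfer_to_lazutkin x y dx dy BC SM Hk Hg HT Dlaz nu (fun i s => e1 i s - e2 i s) Hnu)
    as (u & u1 & u2 & Du & Du1 & Cu2 & Pu & Eu & Mu & Zu & Hu).
  { intros z. unfold nu. rewrite E10, E20. reflexivity. }
  { intros z. unfold nu. now rewrite P1, P2. }
  { intros z. unfold nu. now rewrite V1, V2. }
  { exact Hmean. }
  { unfold nu. rewrite H0. ring. }
  assert (Hc : forall z, / 2 <= laz_angle dx dy z).
  { intros z. unfold laz_angle. specialize (Hg z). assert (1 <= cbrt_curv dx dy z * laz_total dx dy) by nra. lra. }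
  assert (HCd : 0 <= C * delta) by nra.
  assert (Heps : 0 <= 16 * (C * delta) <= / 4000000).
  { split; [lra|]. assert (C * delta <= (C + 1) * d3) by (apply Rmult_le_compat; lra).
    replace ((C + 1) * d3) with (/ (16 * 4000000)) in H by (unfold d3; field; lra). lra. }
  assert (Hu0 : forall t, u t = 0).
  { apply (almost_equidistributed_rigidity (16 * (C * delta)) u u1 u2); auto.
    intros q Hq. set (sg := lift_orbit q (orb q)).
    assert (HQ : 2 <= INR q) by (change 2 with (INR 2); now apply le_INR).
    assert (HPI := PI_4). assert (HPI0 := PI_RGT_0).
    (* Dividing by a quantity of size [1 / q] turns the error [delta / q ^ 3] of the sines into the
       error [delta / q ^ 2] allowed for the weights. *)
    assert (Hsin : / (2 * INR q) <= sin (PI / INR q)).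
    { assert (HiQ : 0 < / INR q <= / 2).
      { split; [apply Rinv_0_lt_compat; lra|]. apply Rinv_le_contravar; lra. }
      pose proof (sin_PI_lower (/ INR q) ltac:(lra)) as B. rewrite Rinv_mult. unfold Rdiv. nra. }
    assert (Hsin0 : 0 < / (2 * INR q)) by (apply Rinv_0_lt_compat; lra).
    set (sn := sin (PI / INR q)) in *.
    (* With this weight [u] times [w] is [PI / sn] times [nu * sin_angle], because [laz_angle]
       cancels; the weighted sum is thus a multiple of the difference of the two values of
       [ell_q]. *)
    exists (fun j => laz dx dy (sg j)),
      (fun j => sin_angle x y dx dy (sg j) (sg (S j)) * PI / (laz_angle dx dy (sg j) * sn)).
    repeat match goal with |- _ /\ _ => split end.
    - replace (sg 0%nat) with 0 by (symmetry; eapply lift_0; eauto). apply laz_0.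
    - replace (sg q) with 1 by (symmetry; eapply lift_q; eauto).
      apply (laz_1 x y dx dy BC HT). intros z.
      apply ex_derive_cont. apply ex_derive_mult; apply Dg.
    - intros j Hj. destruct (Horb x y dx dy delta BC SM CL L1 q (orb q) Hq (HM q Hq) j Hj) as [B _].
      eapply Rle_trans; [apply B|]. unfold Rdiv. apply Rmult_le_compat_r; [|lra].
      left. apply Rinv_0_lt_compat, pow_lt. lra.
    - intros j Hj. destruct (Horb x y dx dy delta BC SM CL L1 q (orb q) Hq (HM q Hq) j Hj) as [_ B].
      fold sg sn in B. specialize (Hc (sg j)). set (c := laz_angle dx dy (sg j)) in *.
      set (sa := sin_angle x y dx dy (sg j) (sg (S j))) in *.
      replace (sa * PI / (c * sn) - 1) with ((sa - c / PI * sn) * (PI * (/ c * / sn))) by (field; lra).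
      rewrite Rabs_mult.
      assert (Hic : 0 < / c <= 2).
      { split; [apply Rinv_0_lt_compat; lra|]. replace 2 with (/ / 2) by field. apply Rinv_le_contravar; lra. }
      assert (His : 0 < / sn <= 2 * INR q).
      { split; [apply Rinv_0_lt_compat; lra|]. rewrite <- (Rinv_inv (2 * INR q)). apply Rinv_le_contravar; lra. }
      assert (HP : Rabs (PI * (/ c * / sn)) <= 16 * INR q).
      { rewrite Rabs_right by (apply Rle_ge, Rmult_le_pos; [lra|apply Rmult_le_pos; lra]).
        replace (16 * INR q) with (4 * (2 * (2 * INR q))) by ring.
        assert (0 <= / c * / sn) by (apply Rmult_le_pos; lra).
        assert (/ c * / sn <= 2 * (2 * INR q)) by (apply Rmult_le_compat; lra).
        apply Rmult_le_compat; lra. }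
      apply Rle_trans with (C * delta / INR q ^ 3 * (16 * INR q)).
      + apply Rmult_le_compat; auto; apply Rabs_pos.
      + right. field. lra.
    - assert (E : sumR q (fun j => nu (sg j) * sin_angle x y dx dy (sg j) (sg (S j))) = 0).
      { pose proof (Hell q Hq) as E.
        rewrite !(ell_q_lift x y dx dy BC q (orb q) Hq (HM q Hq)) in E by assumption.
        fold sg in E. unfold nu.
        rewrite (sumR_ext q _ (fun j => nu1 (sg j) * sin_angle x y dx dy (sg j) (sg (S j))
                                      - nu2 (sg j) * sin_angle x y dx dy (sg j) (sg (S j)))) by (intros; ring).
        rewrite sumR_minus, E. ring. }
      rewrite (sumR_ext q _ (fun j => PI / sn * (nu (sg j) * sin_angle x y dx dy (sg j) (sg (S j))))).
      + rewrite sumR_scal, E. ring.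
      + intros j _. rewrite Hu. unfold transferred. specialize (Hc (sg j)). field. lra. }
  (* [laz_angle] is bounded below, so the vanishing of [u] passes to [nu]. *)
  pose proof (Hu s) as F. rewrite Hu0 in F. unfold transferred in F. specialize (Hc s).
  symmetry in F. apply Rmult_integral in F. destruct F as [F|F]; [|lra]. unfold nu in F. lra.
Qed.
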